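(* Let $\mathfrak{M}$ be the monotone $C^*$-algebra and let $\varphi$ be a state on $\mathfrak{M}$. The following conditions are equivalent: (i) $\varphi$ is symmetric, i.e. $\varphi(T_\sigma(X))=\varphi(X)$ for every $X\in\mathfrak{M}_0$ and every $\sigma\in\mathbb{P}_{\mathbb{Z}}$; (ii) the stochastic process $\big(\mathbb{M}_2(\mathbb{C})\oplus\mathbb{C},\mathcal{H}_\varphi,\{\iota_j\}_{j\in\mathbb{Z}},\xi_\varphi\big)$ corresponding to $\varphi$ is conditionally independent and identically distributed with respect to its tail algebra.
   Context: Monotone $C^*$-algebra. For $k\ge 1$ let $I_k=\{(i_1,\dots,i_k)\in\mathbb{Z}^k: i_1<\dots<i_k\}$. The discrete monotone Fock space is $\mathcal{F}_m=\bigoplus_{k\ge 0}\mathcal{H}_k$ with $\mathcal{H}_k=\ell^2(I_k)$ for $k\geq 1$ and $\mathcal{H}_0=\mathbb{C}\zeta$, $\zeta$ a unit vector (the vacuum); its canonical orthonormal basis is $\{\zeta\}\cup\{e_{(i_1,\dots,i_k)}\}$. For $i\in\mathbb{Z}$ the creation operator $a_i^\dagger$ is the bounded operator with $a_i^\dagger\zeta=e_{(i)}$ and $a_i^\dagger e_{(i_1,\dots,i_k)}=e_{(i,i_1,\dots,i_k)}$ if $i<i_1$, and $0$ otherwise. The annihilation operator $a_i$ is its adjoint: $a_i\zeta=0$, $a_ie_{(i_1,\dots,i_k)}=e_{(i_2,\dots,i_k)}$ if $i=i_1$ (with $a_ie_{(i)}=\zeta$), and $0$ otherwise. $\mathfrak{M}\subset\mathcal{B}(\mathcal{F}_m)$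 is the unital $C^*$-algebra generated by $\{a_i:i\in\mathbb{Z}\}$ and $\mathfrak{M}_0$ is the unital $*$-algebra generated by the same set. Hamel basis of $\mathfrak{M}_0$. For finite subsets $\lambda_1=\{i_1<\dots<i_m\}$, $\lambda_2=\{j_n<\dots<j_1\}$ of $\mathbb{Z}$ (possibly empty) put $X_{(\lambda_1,\lambda_2)}=a_ia_i^\dagger$ if $\lambda_1=\lambda_2=\{i\}$, and $X_{(\lambda_1,\lambda_2)}=a_{i_1}^\dagger\cdots a_{i_m}^\dagger a_{j_1}\cdots a_{j_n}$ in all other cases (with $X_{(\emptyset,\emptyset)}=I$). It is known that these elements form a Hamel basis of $\mathfrak{M}_0$. Maps $T_\sigma$. $\mathbb{P}_{\mathbb{Z}}$ is the group of permutations of $\mathbb{Z}$ moving only finitely many elements. For $\sigma\in\mathbb{P}_{\mathbb{Z}}$, $T_\sigma:\mathfrak{M}_0\to\mathfrak{M}_0$ is the linear map with $T_\sigma(X_{(\lambda_1,\lambda_2)})=X_{(\sigma(\lambda_1),\sigma(\lambda_2))}$ if $\sigma$ is strictly increasing on $\lambda_1$ and strictly increasing on $\lambda_2$, and $T_\sigma(X_{(\lambda_1,\lambda_2)})=0$ otherwise. Process of a state. Let $(\mathcal{H}_\varphi,\pi_\varphi,\xi_\varphi)$ be the GNS triple of $\varphi$. The process corresponding to $\varphi$ has sample algebra $\mathfrak{A}=\mathbb{M}_2(\mathbb{C})\oplus\mathbb{C}$ and unital $*$-homomorphisms $\iota_j:\mathfrak{A}\to\mathcal{B}(\mathcal{H}_\varphi)$,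 $j\in\mathbb{Z}$, given for a matrix $(\alpha_{r,s})\in\mathbb{M}_2(\mathbb{C})$ and $\beta\in\mathbb{C}$ by $$\iota_j\big((\alpha_{r,s})\oplus\beta\big)=\pi_\varphi\Big(\alpha_{1,1}a_ja_j^\dagger+\alpha_{1,2}a_j+\alpha_{2,1}a_j^\dagger+\alpha_{2,2}a_j^\dagger a_j+\beta\sum_{k<j}a_k^\dagger a_k\Big),$$ where $\sum_{k<j}a_k^\dagger a_k$ converges strongly and equals $I-a_ja_j^\dagger-a_j^\dagger a_j\in\mathfrak{M}$. Tail algebra. For a family of algebras, $\bigvee$ denotes the von Neumann algebra they generate. The tail algebra of a process $(\mathfrak{A},\mathcal{H},\{\iota_j\}_{j\in J},\xi)$ with corresponding state $\varphi$ is $$\xi_\varphi^\perp:=\bigcap_{I\subset J,\ I\text{ finite}}\Big(\bigcup_{K\cap I=\emptyset,\ K\text{ finite}}\Big(\bigvee_{k\in K}\iota_k(\mathfrak{A})\Big)\Big)''.$$ Conditional independence and identical distribution. The process $(\mathfrak{A},\mathcal{H},\{\iota_j\}_{j\in J},\xi)$ is conditionally independent and identically distributed with respect to the tail algebra if there is a conditional expectation $E_\varphi:\bigvee_{j\in J}\iota_j(\mathfrak{A})\to\xi_\varphi^\perp$ (a positive linear map that is the identity on $\xi_\varphi^\perp$ and satisfies $E_\varphi(b_1xb_2)=b_1E_\varphi(x)b_2$ for $b_1,b_2\in\xi_\varphi^\perp$; no normality is required) preserving the vector state $\langle\cdot\,\xi,\xi\rangle$ and such that: (1) $\langle XY\xi,\xi\rangle=\langle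 E_\varphi(X)E_\varphi(Y)\xi,\xi\rangle$ for all finite disjoint $I,K\subset J$, all $X\in\big(\bigvee_{i\in I}\iota_i(\mathfrak{A})\big)\bigvee\xi_\varphi^\perp$ and all $Y\in\big(\bigvee_{k\in K}\iota_k(\mathfrak{A})\big)\bigvee\xi_\varphi^\perp$; (2) $E_\varphi(\iota_i(a))=E_\varphi(\iota_k(a))$ for all $i,k\in J$ and $a\in\mathfrak{A}$. *)

(* Defs.v *)
From HB Require Import structures.
From mathcomp Require Import all_boot all_order all_algebra.
From mathcomp Require Import finmap.
From mathcomp Require Import complex.
From mathcomp Require Import all_classical all_reals all_analysis.
From mathcomp Require Import ring lra.

Set Implicit Arguments.
Unset Strict Implicit.
Unset Printing Implicit Defensive.

Import Order.TTheory GRing.Theory Num.Theory.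
Import numFieldNormedType.Exports.

Local Open Scope classical_set_scope.
Local Open Scope ring_scope.
Local Open Scope complex_scope.

Definition ipnorm (R : realType) (V : lmodType R[i])
  (ip : V -> V -> R[i]) (x : V) : R := Num.sqrt (complex.Re (ip x x)).

(* The inner product is linear in its first argument. *)
Record hilbert (R : realType) := Hilbert {
  hsort :> lmodType R[i] ;
  ip : {dot hsort for @conjc R} ;
  hilbert_complete : forall u : nat -> hsort,
    (forall e : R, 0 < e -> exists N, forall m n, (N <= m)%N -> (N <= n)%N ->
       ipnorm ip (u m - u n) <= e) ->
    exists l, forall e : R, 0 < e -> exists N, forall n, (N <= n)%N ->
       ipnorm ip (u n - l) <= e }.

Definition hnorm (R : realType) (H : hilbert R) (x : H) : R := ipnorm (ip H) x.

Section L2.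
Context {R : realType} {T : countType}.
Implicit Types (F G : T -> R) (f g : T -> R[i]) (A : {fset T}).

Definition sqn (z : R[i]) : R := complex.Re z ^+ 2 + complex.Im z ^+ 2.

(* f is square summable: its finite partial sums of |f|^2 are bounded *)
Definition l2_fun f : Prop :=
  exists M : R, forall A, \sum_(t <- A) sqn (f t) <= M.

Definition l2_pred : {pred T -> R[i]} := fun f => `[< l2_fun f >].

Lemma sqn0 : sqn 0 = 0.
Proof. by rewrite /sqn /= expr0n addr0. Qed.

Lemma sqn_ge0 z : 0 <= sqn z.
Proof. by rewrite addr_ge0 // sqr_ge0. Qed.

Lemma sqnD z w : sqn (z + w) <= 2 * sqn z + 2 * sqn w.
Proof.
case: z w => [a b] [c d]; rewrite /sqn /=.
by have := sqr_ge0 (a - c); have := sqr_ge0 (b - d); nra. Qed.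

Lemma sqnN z : sqn (- z) = sqn z.
Proof. by case: z => a b; rewrite /sqn /=; ring. Qed.

Lemma sqnM z w : sqn (z * w) = sqn z * sqn w.
Proof. by case: z w => [a b] [c d]; rewrite /sqn /=; ring. Qed.

Lemma l2_submod : submod_closed l2_pred.
Proof.
split; first by apply/asboolP; exists 0 => A; rewrite big1 // => t _; exact: sqn0.
move=> c f g /asboolP[M hM] /asboolP[N hN]; apply/asboolP.
exists (2 * (sqn c * M) + 2 * N) => A.
apply: (@le_trans _ _ (\sum_(t <- A) (2 * (sqn c * sqn (f t)) + 2 * sqn (g t)))).
  by apply: ler_sum => t _; rewrite -sqnM; exact: sqnD.
rewrite big_split /= -!mulr_sumr lerD // ler_pM2l ?ltr0n //.
by rewrite ler_wpM2l ?sqn_ge0.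
Qed.

HB.instance Definition _ := GRing.isSubmodClosed.Build _ _ l2_pred l2_submod.

Definition l2 : Type := {f : T -> R[i] | l2_pred f}.
HB.instance Definition _ := [isSub of l2 for @sval _ l2_pred].
HB.instance Definition _ := [Choice of l2 by <:].
HB.instance Definition _ := [SubChoice_isSubLmodule of l2 by <:].

(* Sum of an absolutely summable family, along the enumeration of T *)
Definition enum_sum F : R := limn (series (fun k => oapp F 0 (pickle_inv k))).

Definition abs_summable F : Prop :=
  exists M : R, forall A, \sum_(t <- A) `|F t| <= M.

Definition upto n : {fset T} := [fset t in pmap (@pickle_inv T) (iota 0 n)]%fset.

Lemma mem_upto n t : (t \in upto n) = (choice.pickle t < n)%N.
Proof.
rewrite inE /= mem_pmap; apply/mapP/idP => [[k]|tn].
  rewrite mem_iota /= add0n => kn kt.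
  by have := @pickle_invK T k; rewrite -kt /= => ->.
by exists (choice.pickle t); rewrite ?mem_iota ?add0n // pickleK_inv.
Qed.

Lemma series_upto F n :
  series (fun k => oapp F 0 (pickle_inv k)) n = \sum_(t <- upto n) F t.
Proof.
rewrite seriesEnat /= /index_iota subn0 -big_pmap; apply: perm_big.
apply: uniq_perm; rewrite ?fset_uniq //; last by move=> t; rewrite inE.
by apply: (pmap_uniq (@pickle_invK T)); exact: iota_uniq.
Qed.

Lemma upto_sub A : exists n, forall m, (n <= m)%N -> (A `<=` upto m)%fset.
Proof.
exists (\max_(t <- A) (choice.pickle t).+1)%N => m nm; apply/fsubsetP => t tA.
rewrite mem_upto (leq_trans _ nm) //.
exact: (@leq_bigmax_seq _ _ xpredT (fun t => (choice.pickle t).+1)%N).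
Qed.

Lemma ler_sum_fsub F A B : (forall t, 0 <= F t) -> (A `<=` B)%fset ->
  \sum_(t <- A) F t <= \sum_(t <- B) F t.
Proof.
move=> F0 AB; rewrite (big_fsetID _ [in A] B) /=.
have -> : [fset x | x in B & x \in A]%fset = A.
  apply/fsetP => t; rewrite !inE /= andbC.
  by case tA : (t \in A) => //=; rewrite (fsubsetP AB).
by rewrite lerDl sumr_ge0.
Qed.

Lemma enum_cvg F : abs_summable F ->
  cvgn (series (fun k => oapp F 0 (pickle_inv k))).
Proof.
move=> [M hM]; apply: normed_cvg; apply: nondecreasing_is_cvgn.
  by apply: (@nondecreasing_series _ _ xpredT 0) => k _ _ /=; exact: normr_ge0.
exists M => _ [n _ <-].
have -> : [normed series (fun k => oapp F 0 (pickle_inv k))] n =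
          series (fun k => oapp (fun t => `|F t|) 0 (pickle_inv k)) n.
  rewrite /normed_series_of /series /=; apply: eq_bigr => k _.
  by case: (pickle_inv k) => [t|] //=; rewrite normr0.
by rewrite series_upto.
Qed.

Lemma enum_sum_lim F : abs_summable F ->
  (fun n => \sum_(t <- upto n) F t) @ \oo --> enum_sum F.
Proof.
move=> /enum_cvg; rewrite /enum_sum.
by rewrite (_ : series _ = (fun n => \sum_(t <- upto n) F t)) //;
  apply/funext => n; rewrite series_upto.
Qed.

Lemma enum_sumP F x : 
  (fun n => \sum_(t <- upto n) F t) @ \oo --> x -> enum_sum F = x.
Proof.
rewrite /enum_sum (_ : series _ = (fun n => \sum_(t <- upto n) F t)).
  by move/cvg_lim; apply.
by apply/funext => n; rewrite series_upto.
Qed.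

Lemma enum_sumD F G : abs_summable F -> abs_summable G ->
  enum_sum (fun t => F t + G t) = enum_sum F + enum_sum G.
Proof.
move=> /enum_sum_lim cF /enum_sum_lim cG; apply: enum_sumP.
rewrite (_ : (fun _ => _) =
  (fun n => \sum_(t <- upto n) F t + \sum_(t <- upto n) G t)); first exact: cvgD.
by apply/funext => n; rewrite big_split.
Qed.

Lemma enum_sumZ c F : abs_summable F ->
  enum_sum (fun t => c * F t) = c * enum_sum F.
Proof.
move=> /enum_sum_lim cF; apply: enum_sumP.
rewrite (_ : (fun _ => _) = (fun n => c * \sum_(t <- upto n) F t)).
  by apply: cvgM => //; exact: cvg_cst.
by apply/funext => n; rewrite mulr_sumr.
Qed.

Lemma enum_sum_ge F A : abs_summable F -> (forall t, 0 <= F t) ->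
  \sum_(t <- A) F t <= enum_sum F.
Proof.
move=> sF F0; have cF := enum_sum_lim sF; have [n hn] := upto_sub A.
apply: (closed_cvg (fun x => _ <= x) _ _ _ cF); first exact: closed_ge.
exists n => // m /= nm.
by apply: ler_sum_fsub => //; exact: hn.
Qed.

Lemma enum_sum_le F M : abs_summable F ->
  (forall A, \sum_(t <- A) F t <= M) -> enum_sum F <= M.
Proof.
move=> /enum_sum_lim cF FM.
apply: (closed_cvg (fun x => x <= M) _ _ _ cF); first exact: closed_le.
by exists 0%N => // m _ /=; exact: FM.
Qed.

Lemma abs_summableD F G : abs_summable F -> abs_summable G ->
  abs_summable (fun t => F t + G t).
Proof.
move=> [M hM] [N hN]; exists (M + N) => A.
apply: (@le_trans _ _ (\sum_(t <- A) (`|F t| + `|G t|))).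
  by apply: ler_sum => t _; exact: ler_normD.
by rewrite big_split lerD.
Qed.

Lemma abs_summableZ c F : abs_summable F -> abs_summable (fun t => c * F t).
Proof.
move=> [M hM]; exists (`|c| * M) => A.
rewrite (eq_bigr (fun t => `|c| * `|F t|)) => [|t _]; last by rewrite normrM.
by rewrite -mulr_sumr ler_wpM2l.
Qed.

Lemma l2P (f : l2) : l2_fun (val f).
Proof. exact/asboolP/(valP f). Qed.

Lemma ReM_le (z w : R[i]) : `|complex.Re (z * conjc w)| <= sqn z + sqn w.
Proof.
case: z w => [a b] [c d]; rewrite /sqn /= ler_norml.
have := sqr_ge0 (a + c); have := sqr_ge0 (b + d).
have := sqr_ge0 (a - c); have := sqr_ge0 (b - d).
have := sqr_ge0 a; have := sqr_ge0 b; have := sqr_ge0 c; have := sqr_ge0 d.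
by move=> *; apply/andP; split; nra.
Qed.

Lemma ImM_le (z w : R[i]) : `|complex.Im (z * conjc w)| <= sqn z + sqn w.
Proof.
case: z w => [a b] [c d]; rewrite /sqn /= ler_norml.
have := sqr_ge0 (a + d); have := sqr_ge0 (b + c).
have := sqr_ge0 (a - d); have := sqr_ge0 (b - c).
have := sqr_ge0 a; have := sqr_ge0 b; have := sqr_ge0 c; have := sqr_ge0 d.
by move=> *; apply/andP; split; nra.
Qed.

Lemma ReMJ (z : R[i]) : complex.Re (z * conjc z) = sqn z.
Proof. by case: z => a b; rewrite /sqn /=; ring. Qed.

Lemma ImMJ (z : R[i]) : complex.Im (z * conjc z) = 0.
Proof. by case: z => a b /=; ring. Qed.

Lemma l2_summable_Re (f g : l2) :
  abs_summable (fun t => complex.Re (val f t * conjc (val g t))).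
Proof.
have [[M hM] [N hN]] := (l2P f, l2P g); exists (M + N) => A.
apply: (@le_trans _ _ (\sum_(t <- A) (sqn (val f t) + sqn (val g t)))).
  by apply: ler_sum => t _; exact: ReM_le.
by rewrite big_split lerD.
Qed.

Lemma l2_summable_Im (f g : l2) :
  abs_summable (fun t => complex.Im (val f t * conjc (val g t))).
Proof.
have [[M hM] [N hN]] := (l2P f, l2P g); exists (M + N) => A.
apply: (@le_trans _ _ (\sum_(t <- A) (sqn (val f t) + sqn (val g t)))).
  by apply: ler_sum => t _; exact: ImM_le.
by rewrite big_split lerD.
Qed.

(* <f, g> = \sum_t f t * conj (g t) *)
Definition l2_ip (f g : l2) : R[i] :=
  enum_sum (fun t => complex.Re (val f t * conjc (val g t))) +i*
  enum_sum (fun t => complex.Im (val f t * conjc (val g t))).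

Lemma l2_ipC (f g : l2) : l2_ip f g = conjc (l2_ip g f).
Proof.
rewrite /l2_ip /=; congr (_ +i* _).
  by congr enum_sum; apply/funext => t;
    case: (val f t) (val g t) => [a b] [c d] /=; ring.
rewrite -mulN1r -enum_sumZ; last exact: l2_summable_Im.
by congr enum_sum; apply/funext => t;
  case: (val f t) (val g t) => [a b] [c d] /=; ring.
Qed.

Lemma l2_ip_linearl (h : l2) : linear_for *%R (l2_ip^~ h).
Proof.
move=> [a b] f g; rewrite /l2_ip /=.
have sR := l2_summable_Re; have sI := l2_summable_Im.
rewrite [RHS](_ : _ = (a * enum_sum (fun t => complex.Re (val f t * conjc (val h t)))
   + (- b) * enum_sum (fun t => complex.Im (val f t * conjc (val h t)))
   + enum_sum (fun t => complex.Re (val g t * conjc (val h t)))) +i*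
  (a * enum_sum (fun t => complex.Im (val f t * conjc (val h t)))
   + b * enum_sum (fun t => complex.Re (val f t * conjc (val h t)))
   + enum_sum (fun t => complex.Im (val g t * conjc (val h t))))); last first.
  by rewrite mulNr.
rewrite -!enum_sumZ // -!enum_sumD //; try by
  [exact: abs_summableZ | apply: abs_summableD; exact: abs_summableZ].
by congr (_ +i* _); congr enum_sum; apply/funext => t;
  rewrite (_ : ((a +i* b) *: sval f + sval g) t = (a +i* b) * val f t + val g t) //;
  rewrite -?[sval h]/(val h); case: (val f t) (val g t) (val h t) => [? ?] [? ?] [? ?] /=; ring.
Qed.

Lemma l2_ip_bilinear :
  bilinear_for ( *%R : GRing.Scale.law _ _) (@conjc R \; *%R : GRing.Scale.law _ _) l2_ip.
Proof.
split; first exact: l2_ip_linearl.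
move=> h c f g; rewrite /= (l2_ipC h) l2_ip_linearl (l2_ipC h f) (l2_ipC h g).
by rewrite rmorphD rmorphM.
Qed.

HB.instance Definition _ := bilinear_isBilinear.Build _ _ _ _ _ _ l2_ip l2_ip_bilinear.

Lemma l2_ip_hermitian (f g : l2) : l2_ip f g = (-1) ^+ false * conjc (l2_ip g f).
Proof. by rewrite expr0 mul1r -l2_ipC. Qed.

HB.instance Definition _ :=
  @isHermitianSesquilinear.Build _ _ false (@conjc R) l2_ip l2_ip_hermitian.

Lemma l2_ipff (f : l2) : l2_ip f f = (enum_sum (fun t => sqn (val f t)))%:C.
Proof.
rewrite /l2_ip; congr (_ +i* _); first by congr enum_sum; apply/funext => t; exact: ReMJ.
apply: enum_sumP; rewrite (_ : (fun _ => _) = cst 0); first exact: cvg_cst.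
by apply/funext => n; rewrite big1 // => t _; exact: ImMJ.
Qed.

Lemma l2_summable_sqn (f : l2) : abs_summable (fun t => sqn (val f t)).
Proof.
by have := l2_summable_Re f f; under eq_fun do rewrite ReMJ.
Qed.

Lemma l2_ip_ge (f : l2) A : \sum_(t <- A) sqn (val f t) <= complex.Re (l2_ip f f).
Proof.
rewrite l2_ipff; apply: enum_sum_ge; first exact: l2_summable_sqn.
by move=> t; exact: sqn_ge0.
Qed.

Lemma l2_ip_le (f : l2) M : (forall A, \sum_(t <- A) sqn (val f t) <= M) ->
  complex.Re (l2_ip f f) <= M.
Proof. by rewrite l2_ipff; apply: enum_sum_le; exact: l2_summable_sqn. Qed.

Lemma sqn_eq0 z : sqn z = 0 -> z = 0.
Proof.
case: z => a b /eqP; rewrite /sqn paddr_eq0 ?sqr_ge0 //= !sqrf_eq0.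
by move=> /andP[/eqP-> /eqP->].
Qed.

Lemma l2_ip_gt0 (f : l2) : f != 0 -> 0 < l2_ip f f.
Proof.
move=> /eqP f0; rewrite l2_ipff ltcR.
have [t ft] : exists t, val f t <> 0.
  apply: contrapT => /forallNP h; apply: f0; apply/val_inj/funext => t.
  by apply: contrapT; exact: h.
apply: (@lt_le_trans _ _ (sqn (val f t))).
  by rewrite lt_neqAle sqn_ge0 andbT eq_sym; apply/eqP => /sqn_eq0.
have := @l2_ip_ge f [fset t]%fset.
by rewrite l2_ipff big_seq_fset1.
Qed.

HB.instance Definition _ := isDotProduct.Build _ _ l2_ip l2_ip_gt0.


Lemma l2_norm_le (f : l2) (e : R) : 0 <= e ->
  (ipnorm l2_ip f <= e) = (complex.Re (l2_ip f f) <= e ^+ 2).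
Proof.
by move=> e0; rewrite /ipnorm -{1}(ger0_norm e0) -sqrtr_sqr ler_sqrt ?sqr_ge0.
Qed.

Lemma cauchy_seq_cvg (a : nat -> R) :
  (forall e : R, 0 < e -> exists N, forall m n, (N <= m)%N -> (N <= n)%N ->
     `|a m - a n| <= e) -> a @ \oo --> limn a.
Proof.
move=> ca; suff : cvgn a by [].
apply: cauchy_cvg; apply: cauchy_exP => e e0.
have [N hN] := ca (e / 2) (divr_gt0 e0 (ltr0n _ 2)).
exists (a N); exists N => // n /= Nn.
by rewrite /ball /=; have := hN N n (leqnn _) Nn; lra.
Qed.

Lemma sqn_le_norm (z : R[i]) (e : R) : 0 <= e -> sqn z <= e ^+ 2 ->
  `|complex.Re z| <= e /\ `|complex.Im z| <= e.
Proof.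
case: z => a b; rewrite /sqn /= => e0 h; split.
- rewrite -(ger0_norm e0) -ler_sqr ?nnegrE // !real_normK ?num_real //.
  by have := sqr_ge0 b; lra.
- rewrite -(ger0_norm e0) -ler_sqr ?nnegrE // !real_normK ?num_real //.
  by have := sqr_ge0 a; lra.
Qed.

Lemma l2_complete (u : nat -> l2) :
  (forall e : R, 0 < e -> exists N, forall m n, (N <= m)%N -> (N <= n)%N ->
     ipnorm l2_ip (u m - u n) <= e) ->
  exists l, forall e : R, 0 < e -> exists N, forall n, (N <= n)%N ->
     ipnorm l2_ip (u n - l) <= e.
Proof.
move=> cu.
have cA e : 0 < e -> exists N, forall m n, (N <= m)%N -> (N <= n)%N ->
    forall A, \sum_(t <- A) sqn (val (u m) t - val (u n) t) <= e ^+ 2.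
  move=> e0; have [N hN] := cu e e0; exists N => m n Nm Nn A.
  have := hN m n Nm Nn; rewrite (l2_norm_le _ (ltW e0)).
  by move=> h; exact: (le_trans (l2_ip_ge (u m - u n) A) h).
have ct t e : 0 < e -> exists N, forall m n, (N <= m)%N -> (N <= n)%N ->
    sqn (val (u m) t - val (u n) t) <= e ^+ 2.
  move=> e0; have [N hN] := cA e e0; exists N => m n Nm Nn.
  by have := hN m n Nm Nn [fset t]%fset; rewrite big_seq_fset1.
have cRe t : (fun n => complex.Re (val (u n) t)) @ \oo -->
    limn (fun n => complex.Re (val (u n) t)).
  apply: cauchy_seq_cvg => e e0; have [N hN] := ct t e e0; exists N => m n Nm Nn.
  by have [+ _] := sqn_le_norm (ltW e0) (hN m n Nm Nn); rewrite raddfB.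
have cIm t : (fun n => complex.Im (val (u n) t)) @ \oo -->
    limn (fun n => complex.Im (val (u n) t)).
  apply: cauchy_seq_cvg => e e0; have [N hN] := ct t e e0; exists N => m n Nm Nn.
  by have [_ +] := sqn_le_norm (ltW e0) (hN m n Nm Nn); rewrite raddfB.
pose l t := limn (fun n => complex.Re (val (u n) t)) +i*
            limn (fun n => complex.Im (val (u n) t)).
have lim_le e : 0 < e -> exists N, forall m, (N <= m)%N ->
    forall A, \sum_(t <- A) sqn (val (u m) t - l t) <= e ^+ 2.
  move=> e0; have [N hN] := cA e e0; exists N => m Nm A.
  have cS : (fun n => \sum_(t <- A) sqn (val (u m) t - val (u n) t)) @ \oo -->
      \sum_(t <- A) sqn (val (u m) t - l t).
    apply: cvg_big => [|t _]; first exact: add_continuous.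
    rewrite /sqn !raddfB /=.
    rewrite (_ : (fun _ => _) = (fun n =>
       (complex.Re (val (u m) t) - complex.Re (val (u n) t)) ^+ 2
     + (complex.Im (val (u m) t) - complex.Im (val (u n) t)) ^+ 2)); last first.
      by apply/funext => n; rewrite !raddfB.
    by apply: cvgD; apply: cvgM; apply: cvgB => //; exact: cvg_cst.
  apply: (closed_cvg (fun x => x <= e ^+ 2) _ _ _ cS); first exact: closed_le.
  by exists N => // n Nn /=; exact: hN.
have l_l2 : l2_pred l.
  apply/asboolP; have [N hN] := lim_le 1 ltr01; have [M hM] := l2P (u N).
  exists (2 * M + 2) => A.
  apply: (@le_trans _ _
    (\sum_(t <- A) (2 * sqn (val (u N) t) + 2 * sqn (val (u N) t - l t)))).
    apply: ler_sum => t _; rewrite -(sqnN (_ - l t)); apply: le_trans (sqnD _ _).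
    by rewrite opprB addrC subrK.
  rewrite big_split /= -!mulr_sumr lerD // ?ler_pM2l //.
  by have := hN N (leqnn N) A; rewrite expr1n; lra.
exists (Sub l l_l2) => e e0; have [N hN] := lim_le e e0.
exists N => n Nn; rewrite (l2_norm_le _ (ltW e0)).
by apply: l2_ip_le => A; exact: hN.
Qed.
End L2.

Definition l2_hilbert (R : realType) (T : countType) : hilbert R :=
  @Hilbert R (l2 (R := R) (T := T)) (@l2_ip R T) (@l2_complete R T).

Section Operators.
Context {R : realType} {H : hilbert R}.
Implicit Types (S T : H -> H) (A G : set (H -> H)).

Definition bounded_op T : Prop :=
  linear T /\ exists k : R, forall x, hnorm (T x) <= k * hnorm x.

(* S is the adjoint of T *)
Definition adjoint_of T S : Prop :=
  forall x y, ip H (T x) y = ip H x (S y).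

Definition positive_op T : Prop :=
  bounded_op T /\ forall x, 0 <= ip H (T x) x.

Record star_alg A : Prop := StarAlg {
  star_alg_bounded : forall T, A T -> bounded_op T ;
  star_alg_id : A id ;
  star_alg_linear : forall c S T, A S -> A T -> A (c \*: S \+ T) ;
  star_alg_comp : forall S T, A S -> A T -> A (S \o T) ;
  star_alg_adjoint : forall S T, A S -> adjoint_of S T -> A T }.

Definition norm_closed A : Prop :=
  forall T, bounded_op T ->
    (forall e : R, 0 < e ->
       exists2 S, A S & forall x, hnorm (T x - S x) <= e * hnorm x) -> A T.

Definition star_gen G : set (H -> H) :=
  \bigcap_(A in [set A | star_alg A /\ G `<=` A]) A.

Definition cstar_gen G : set (H -> H) :=
  \bigcap_(A in [set A | [/\ star_alg A, norm_closed A & G `<=` A]]) A.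

Definition commutant G : set (H -> H) :=
  [set T | bounded_op T /\ forall S, G S -> T \o S = S \o T].

Definition bicommutant G : set (H -> H) := commutant (commutant G).

Definition vN_alg A : Prop := star_alg A /\ bicommutant A = A.

Definition vN_gen G : set (H -> H) :=
  \bigcap_(A in [set A | vN_alg A /\ G `<=` A]) A.

(* States on, and linear maps between, operator algebras are represented by
   total functions; only their values on the algebra matter. *)
Record is_state A (phi : (H -> H) -> R[i]) : Prop := IsState {
  state_linear : forall c S T, A S -> A T ->
    phi (c \*: S \+ T) = c * phi S + phi T ;
  state_positive : forall S T, A S -> adjoint_of S T -> 0 <= phi (T \o S) ;
  state_id : phi id = 1 }.

Record is_cond_exp A B (E : (H -> H) -> (H -> H)) : Prop := IsCondExp {
  cond_exp_range : forall S, A S -> B (E S) ;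
  cond_exp_linear : forall c S T, A S -> A T ->
    E (c \*: S \+ T) = c \*: E S \+ E T ;
  cond_exp_positive : forall S, A S -> positive_op S -> positive_op (E S) ;
  cond_exp_id : forall S, B S -> E S = S ;
  cond_exp_bimodule : forall S1 S2 T, B S1 -> B S2 -> A T ->
    E (S1 \o T \o S2) = S1 \o E T \o S2 }.
End Operators.

Record is_GNS (R : realType) (F H : hilbert R) (A : set (F -> F))
    (phi : (F -> F) -> R[i]) (pi : (F -> F) -> (H -> H)) (xi : H) : Prop :=
  IsGNS {
  GNS_bounded : forall S, A S -> bounded_op (pi S) ;
  GNS_linear : forall c S T, A S -> A T ->
    pi (c \*: S \+ T) = c \*: pi S \+ pi T ;
  GNS_comp : forall S T, A S -> A T -> pi (S \o T) = pi S \o pi T ;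
  GNS_id : pi id = id ;
  GNS_adjoint : forall S T, A S -> adjoint_of S T -> adjoint_of (pi S) (pi T) ;
  GNS_cyclic : forall (x : H) (e : R), 0 < e ->
    exists2 S, A S & hnorm (x - pi S xi) <= e ;
  GNS_state : forall S, A S -> phi S = ip H (pi S xi) xi }.

Section Process.
Context {R : realType} {H : hilbert R} {J : choiceType} {A : Type}.
Variable iota : J -> A -> (H -> H).

Definition local_alg (K : set J) : set (H -> H) :=
  vN_gen (\bigcup_(j in K) range (iota j)).

Definition tail_alg : set (H -> H) :=
  \bigcap_(I in [set: {fset J}])
    bicommutant (\bigcup_(K in [set K : {fset J} | [disjoint K & I]%fset])
      local_alg [set` K]).

Definition cond_iid (xi : H) : Prop :=
  exists E : (H -> H) -> (H -> H),
  [/\ is_cond_exp (local_alg setT) tail_alg E,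
      forall X, local_alg setT X -> ip H (E X xi) xi = ip H (X xi) xi,
      forall I K : {fset J}, [disjoint I & K]%fset ->
        forall X Y, vN_gen (local_alg [set` I] `|` tail_alg) X ->
                    vN_gen (local_alg [set` K] `|` tail_alg) Y ->
        ip H ((X \o Y) xi) xi = ip H ((E X \o E Y) xi) xi
    & forall (i k : J) (a : A), E (iota i a) = E (iota k a)].
End Process.

(* the disjoint union of the I_k, k >= 0; the vacuum is indexed by [::] *)
Definition mono_index : Type := {s : seq int | sorted <%R s}.
HB.instance Definition _ := Countable.on mono_index.

Definition fock (R : realType) : hilbert R := l2_hilbert R mono_index.

(* (i_1, .., i_k) |-> (i, i_1, .., i_k), defined when i < i_1 *)
Definition push (i : int) (s : mono_index) : option mono_index :=
  insub (i :: val s).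

(* (i, i_2, .., i_k) |-> (i_2, .., i_k) *)
Definition pop (i : int) (s : mono_index) : option mono_index :=
  if val s is j :: t then if j == i then insub t else None else None.

Lemma pushP i s t : push i s = Some t <-> val t = i :: val s.
Proof.
rewrite /push; split=> [|ts].
  by case: insubP => //= u _ uE [<-].
by case: insubP => [u _ us|]; [congr Some; apply/val_inj; rewrite us|rewrite -ts (valP t)].
Qed.

Lemma popP i s t : pop i t = Some s <-> val t = i :: val s.
Proof.
rewrite /pop; split=> [|ts].
  by case: (val t) => // j r; case: eqP => // ->; case: insubP => //= u _ uE [<-]; rewrite uE.
rewrite ts eqxx; case: insubP => [u _ us|]; first by congr Some; apply/val_inj.
by rewrite (valP s).
Qed.

Lemma push_inj i x x' y : push i x = Some y -> push i x' = Some y -> x = x'.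
Proof. by move=> /pushP yx /pushP; rewrite yx => -[] /val_inj. Qed.

Lemma pop_inj i x x' y : pop i x = Some y -> pop i x' = Some y -> x = x'.
Proof. by move=> /popP xy /popP; rewrite -xy => /val_inj. Qed.

Lemma reindex_le (R : realType) (T : countType) (h : T -> option T) (F : T -> R) :
  (forall x x' y, h x = Some y -> h x' = Some y -> x = x') ->
  abs_summable F -> (forall t, 0 <= F t) ->
  forall A : {fset T}, \sum_(t <- A) oapp F 0 (h t) <= enum_sum F.
Proof.
move=> hI sF F0 A.
have u : uniq (pmap h A).
  elim: (enum_fset A) (fset_uniq A) => //= t r IH /andP[tr /IH ur].
  case ht : (h t) => [y|] //=; rewrite ur andbT mem_pmap.
  by apply/negP => /mapP[x xr /esym hx]; rewrite (hI _ _ _ ht hx) xr in tr.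
rewrite -big_pmap (_ : \sum_(t <- pmap h A) _ =
  \sum_(t <- [fset t in pmap h A]%fset) F t); first exact: enum_sum_ge.
by apply: perm_big; apply: uniq_perm; rewrite ?fset_uniq // => t; rewrite inE.
Qed.

Lemma reindex_l2 (R : realType) (T : countType) (h : T -> option T)
    (f : l2 (R := R) (T := T)) :
  (forall x x' y, h x = Some y -> h x' = Some y -> x = x') ->
  forall A : {fset T},
    \sum_(t <- A) sqn (oapp (val f) 0 (h t)) <= complex.Re (l2_ip f f).
Proof.
move=> hI A.
rewrite (eq_bigr (fun t => oapp (fun t => sqn (val f t)) 0 (h t))); last first.
  by move=> t _; case: (h t) => //=; exact: sqn0.
rewrite l2_ipff; apply: reindex_le => //; first exact: l2_summable_sqn.
by move=> t; exact: sqn_ge0.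
Qed.

Lemma reindex_ge0 (R : realType) (F : mono_index -> R) i :
  abs_summable F -> (forall t, 0 <= F t) ->
  (forall t, push i t = None -> F t = 0) ->
  abs_summable (fun t => oapp F 0 (pop i t)) /\
  enum_sum (fun t => oapp F 0 (pop i t)) = enum_sum F.
Proof.
move=> sF F0 FN.
have le1 := reindex_le (pop_inj (i := i)) sF F0.
have G0 t : 0 <= oapp F 0 (pop i t) by case: (pop i t) => /=.
have sG : abs_summable (fun t => oapp F 0 (pop i t)).
  exists (enum_sum F) => A; rewrite (eq_bigr (fun t => oapp F 0 (pop i t))) //.
  by move=> t _; rewrite ger0_norm.
split=> //; apply/eqP; rewrite eq_le enum_sum_le //=.
apply: enum_sum_le => // A.
rewrite (eq_bigr (fun t => oapp (fun s => oapp F 0 (pop i s)) 0 (push i t))).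
  exact: (reindex_le (push_inj (i := i)) sG G0).
move=> t _; case pt : (push i t) => [s|] /=; last exact: FN.
by have /pushP/popP -> := pt.
Qed.

Lemma reindex_sum (R : realType) (F : mono_index -> R) i :
  abs_summable F -> (forall t, push i t = None -> F t = 0) ->
  enum_sum (fun t => oapp F 0 (pop i t)) = enum_sum F.
Proof.
move=> sF FN.
have sN : abs_summable (fun t => `|F t|).
  by have [M hM] := sF; exists M => A; under eq_bigr do rewrite normr_id.
have sP := abs_summableD sF sN.
have P0 t : 0 <= F t + `|F t| by have := ler_norm (- F t); rewrite normrN; lra.
have PN t : push i t = None -> F t + `|F t| = 0.
  by move=> /FN ->; rewrite normr0 addr0.
have NN t : push i t = None -> `|F t| = 0 by move=> /FN ->; rewrite normr0.
have [sP1 eP] := reindex_ge0 sP P0 PN.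
have [sN1 eN] := reindex_ge0 sN (fun t => normr_ge0 (F t)) NN.
have : enum_sum F = enum_sum (fun t => F t + `|F t|) + -1 * enum_sum (fun t => `|F t|).
  rewrite -enum_sumZ // -enum_sumD //; last exact: abs_summableZ.
  by congr enum_sum; apply/funext => t; ring.
rewrite -eP -eN => ->; rewrite -enum_sumZ // -enum_sumD //; last exact: abs_summableZ.
congr enum_sum; apply/funext => t.
by case: (pop i t) => [s|] /=; ring.
Qed.

Section Monotone.
Context {R : realType}.
Local Notation F := (fock R).
Local Notation fockfun := (l2 (R := R) (T := mono_index)).

Lemma create_l2 i (f : fockfun) :
  l2_pred (fun s => oapp (val f) 0 (pop i s)).
Proof.
by apply/asboolP; exists (complex.Re (l2_ip f f)); exact: reindex_l2 (@pop_inj i).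
Qed.

Lemma annih_l2 i (f : fockfun) :
  l2_pred (fun s => oapp (val f) 0 (push i s)).
Proof.
by apply/asboolP; exists (complex.Re (l2_ip f f)); exact: reindex_l2 (@push_inj i).
Qed.

Definition create (i : int) : F -> F :=
  fun f => exist _ (fun s => oapp (sval f) 0 (pop i s)) (create_l2 i f).

Definition annih (i : int) : F -> F :=
  fun f => exist _ (fun s => oapp (sval f) 0 (push i s)) (annih_l2 i f).

Lemma basis_l2 s : l2_pred (fun t : mono_index => (t == s)%:R : R[i]).
Proof.
apply/asboolP; exists 1 => A; case sA : (s \in A).
  rewrite (big_fsetD1 s) //= eqxx big_seq big1 ?addr0 /sqn /=.
    by rewrite expr1n expr0n addr0.
  by move=> t; rewrite !inE => /andP[/negPf-> _]; exact: sqn0.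
rewrite big_seq big1 // => t tA; rewrite (_ : (t == s) = false) ?sqn0 //.
by apply/negP => /eqP ts; rewrite -ts tA in sA.
Qed.

(* the canonical orthonormal basis; [basis [::]] is the vacuum *)
Definition basis (s : mono_index) : F :=
  exist _ (fun t => (t == s)%:R) (basis_l2 s).

Lemma create_basis i s : create i (basis s) = oapp basis 0 (push i s).
Proof.
apply/val_inj/funext => t /=; case pt : (pop i t) => [r|] /=.
  have /popP/pushP pr := pt.
  case: eqP => [<-|rs]; first by rewrite pr /= eqxx.
  case ps : (push i s) => [q|] //=; case: eqP => // tq; case: rs.
  by apply: (push_inj pr); rewrite tq.
case ps : (push i s) => [q|] //=; case: eqP => // tq; subst q.
by have /pushP/popP := ps; rewrite pt.
Qed.

Lemma annih_basis i s : annih i (basis s) = oapp basis 0 (pop i s).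
Proof.
apply/val_inj/funext => t /=; case pt : (push i t) => [r|] /=.
  have /pushP/popP pr := pt.
  case: eqP => [<-|rs]; first by rewrite pr /= eqxx.
  case ps : (pop i s) => [q|] //=; case: eqP => // tq; case: rs.
  by apply: (pop_inj pr); rewrite tq.
case ps : (pop i s) => [q|] //=; case: eqP => // tq; subst q.
by have /popP/pushP := ps; rewrite pt.
Qed.

Lemma lin_fctE (T : Type) (c : R[i]) (f g : T -> R[i]) t :
  (c *: f + g) t = c * f t + g t.
Proof. by []. Qed.

Lemma create_bounded i : bounded_op (create i).
Proof.
split=> [c f g|].
  apply/val_inj/funext => s /=; rewrite lin_fctE.
  by case: (pop i s) => [t|] /=; rewrite ?lin_fctE // mulr0 addr0.
exists 1 => f; rewrite mul1r /hnorm /ipnorm ler_wsqrtr //.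
by apply: l2_ip_le => A; exact: (@reindex_l2 _ _ (pop i) f (@pop_inj i)).
Qed.

Lemma annih_bounded i : bounded_op (annih i).
Proof.
split=> [c f g|].
  apply/val_inj/funext => s /=; rewrite lin_fctE.
  by case: (push i s) => [t|] /=; rewrite ?lin_fctE // mulr0 addr0.
exists 1 => f; rewrite mul1r /hnorm /ipnorm ler_wsqrtr //.
by apply: l2_ip_le => A; exact: (@reindex_l2 _ _ (push i) f (@push_inj i)).
Qed.

Lemma annih_adjoint i : adjoint_of (create i) (annih i).
Proof.
move=> f g; change (l2_ip (create i f) g = l2_ip f (annih i g)).
have z0 (z : R[i]) : z * conjc 0 = 0 by rewrite rmorph0 mulr0.
rewrite /l2_ip -(reindex_sum (i := i) (l2_summable_Re f (annih i g)));
  last by move=> t /= ->; rewrite /= z0.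
rewrite -(reindex_sum (i := i) (l2_summable_Im f (annih i g)));
  last by move=> t /= ->; rewrite /= z0.
by congr (_ +i* _); congr enum_sum; apply/funext => t /=;
  case pt : (pop i t) => [s|] /=; rewrite ?mul0r //;
  have /popP/pushP -> := pt.
Qed.

Definition monotone_alg : set (F -> F) := cstar_gen (range annih).

Definition monotone_alg0 : set (F -> F) := star_gen (range annih).

Definition incr_seq (l : {fset int}) : seq int := sort <=%R (enum_fset l).

Definition op_prod (s : seq (F -> F)) : F -> F := foldr comp id s.

(* a_(i_1)^* ... a_(i_m)^* a_(j_1) ... a_(j_n), for l1 = {i_1 < ... < i_m} and
   l2 = {j_n < ... < j_1}, except that it is a_i a_i^* when l1 = l2 = {i} *)
Definition mono_word (l1 l2 : {fset int}) : F -> F :=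
  let w := op_prod [seq create i | i <- incr_seq l1] \o
           op_prod [seq annih j | j <- rev (incr_seq l2)] in
  if incr_seq l1 is [:: i] then
    if l1 == l2 then annih i \o create i else w
  else w.

Definition fin_perm (sigma : int -> int) : Prop :=
  bijective sigma /\ finite_set [set i | sigma i != i].

Definition incr_on (sigma : int -> int) (l : {fset int}) : Prop :=
  {in l &, {homo sigma : i j / i < j}}.

Record is_T (sigma : int -> int) (T : (F -> F) -> (F -> F)) : Prop := IsT {
  T_linear : forall c X Y, monotone_alg0 X -> monotone_alg0 Y ->
    T (c \*: X \+ Y) = c \*: T X \+ T Y ;
  T_incr : forall l1 l2, incr_on sigma l1 -> incr_on sigma l2 ->
    T (mono_word l1 l2) = mono_word (sigma @` l1)%fset (sigma @` l2)%fset ;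
  T_not_incr : forall l1 l2, ~ (incr_on sigma l1 /\ incr_on sigma l2) ->
    T (mono_word l1 l2) = fun=> 0 }.

(* Since the mono_word's form a Hamel basis of monotone_alg0, is_T determines
   T_ sigma on monotone_alg0; its values elsewhere are irrelevant. *)
Definition T_ (sigma : int -> int) : (F -> F) -> (F -> F) :=
  @xget ((F -> F) -> (F -> F)) (fun X => X) [set T | is_T sigma T].

Definition symmetric_state (phi : (F -> F) -> R[i]) : Prop :=
  forall X sigma, monotone_alg0 X -> fin_perm sigma ->
    phi (T_ sigma X) = phi X.

(* the strong sum of create k \o annih k over k < j, see below_strong_sum *)
Definition below (j : int) : F -> F :=
  id \- (annih j \o create j) \- (create j \o annih j).

Lemma create_annihE k (f : F) s :
  sval (create k (annih k f)) s = if ohead (val s) == Some k then sval f s else 0.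
Proof.
rewrite /=; case ps : (pop k s) => [t|] /=.
  by have st := (popP k t s).1 ps; rewrite st /= eqxx ((pushP k t s).2 st).
case: eqP => // hs; case sE : (val s) hs => [|i r] //= [ik]; subst i.
have sr : sorted <%R r by have := valP s; rewrite sE => /path_sorted.
by have /popP : val s = k :: val (Sub r sr : mono_index) by []; rewrite ps.
Qed.

Lemma annih_createE k (f : F) s :
  sval (annih k (create k f)) s =
  if ohead (val s) is Some i then (if k < i then sval f s else 0) else sval f s.
Proof.
rewrite /=; case ps : (push k s) => [t|] /=.
  have ts := (pushP k s t).1 ps; rewrite ((popP k s t).2 ts) /=.
  have := valP t; rewrite ts /=; case: (val s) => //= i r /andP[-> _].
  by [].
have : ~~ sorted <%R (k :: sval s).
  by move: ps; rewrite /push; case: insubP.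
have : sorted <%R (sval s) := valP s.
by case: (sval s) => [|i r] //= ->; case: ltP.
Qed.

Lemma belowE j (f : F) s :
  sval (below j f) s =
  if ohead (val s) is Some i then (if i < j then sval f s else 0) else 0.
Proof.
have -> : sval (below j f) s = sval f s - sval (annih j (create j f)) s
  - sval (create j (annih j f)) s by [].
rewrite annih_createE create_annihE.
case: (val s) => [|i r] /=; first by rewrite subrr subr0.
by rewrite (inj_eq Some_inj); case: ltgtP; rewrite ?subrr ?subr0 ?subrr.
Qed.

Lemma below_strong_sum j (f : F) (e : R) : 0 < e ->
  exists2 K0 : {fset int}, (forall k, k \in K0 -> k < j) &
  forall K : {fset int}, (K0 `<=` K)%fset -> (forall k, k \in K -> k < j) ->
    hnorm (\sum_(k <- K) create k (annih k f) - below j f) <= e.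
Proof.
move=> e0; pose N := complex.Re (l2_ip f f).
have [A0 hA0] : exists A0 : {fset mono_index},
    N - e ^+ 2 <= \sum_(s <- A0) sqn (sval f s).
  apply: contrapT => /forallNP h.
  have : N <= N - e ^+ 2.
    by apply: l2_ip_le => A; have /negP := h A; rewrite -ltNge => /ltW.
  by have := exprn_gt0 2 e0; lra.
exists [fset k in pmap (fun s : mono_index => ohead (val s)) A0 | k < j]%fset.
  by move=> k; rewrite !inE => /andP[].
move=> K K0K Kj; rewrite /hnorm (l2_norm_le _ (ltW e0)).
have DE s : sval (\sum_(k <- K) create k (annih k f) - below j f) s =
    if ohead (val s) is Some i then
      (if (i < j) && (i \notin K) then - sval f s else 0) else 0.
  have -> : sval (\sum_(k <- K) create k (annih k f) - below j f) s =
      \sum_(k <- K) sval (create k (annih k f)) s - sval (below j f) s.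
    have sumE (r : seq int) : sval (\sum_(k <- r) create k (annih k f)) s =
        \sum_(k <- r) sval (create k (annih k f)) s.
      by elim: r => [|k r IH]; rewrite ?big_nil // !big_cons -IH.
    by rewrite -sumE.
  rewrite belowE; under eq_bigr do rewrite create_annihE.
  case: (ohead (val s)) => [i|]; last by rewrite big1 ?subr0.
  under eq_bigr do rewrite (inj_eq Some_inj).
  have [iK|iK] := boolP (i \in K).
    rewrite (Kj _ iK) /= (big_fsetD1 i) //= eqxx big_seq big1 ?addr0 ?subrr //.
    by move=> k; rewrite !inE eq_sym => /andP[/negPf->].
  rewrite andbT big_seq big1 ?sub0r; first by case: ifP; rewrite ?oppr0.
  by move=> k kK; case: eqP => // ik; rewrite ik kK in iK.
apply: l2_ip_le => A.
have D0 s : s \in A0 -> sval (\sum_(k <- K) create k (annih k f) - below j f) s = 0.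
  move=> sA; rewrite DE; case hs : (ohead (val s)) => [i|] //.
  case: ifP => // /andP[ij /negP[]]; apply: (fsubsetP K0K).
  by rewrite !inE ij andbT mem_pmap; apply/mapP; exists s.
have Dle s : sqn (sval (\sum_(k <- K) create k (annih k f) - below j f) s)
    <= sqn (sval f s).
  rewrite DE; case: (ohead (val s)) => [i|]; last by rewrite sqn0 sqn_ge0.
  by case: ifP; rewrite ?sqnN // sqn0 sqn_ge0.
apply: (@le_trans _ _ (\sum_(s <- (A `\` A0)%fset) sqn (sval f s))).
  rewrite (big_fsetID _ [in A0]) /= big_seq big1 ?add0r; last first.
    move=> s; rewrite !inE => /andP[_ /D0 D0s].
    by transitivity (sqn (0 : R[i])); [congr sqn; exact: D0s|exact: sqn0].
  rewrite (_ : [fset x | x in A & x \notin A0]%fset = (A `\` A0)%fset).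
    by apply: ler_sum => s _; exact: Dle.
  by apply/fsetP => s; rewrite !inE andbC.
have := l2_ip_ge f (A0 `|` A)%fset; rewrite -/N.
rewrite (big_fsetID _ [in A0]) /=.
rewrite (_ : [fset x | x in (A0 `|` A)%fset & x \in A0]%fset = A0); last first.
  by apply/fsetP => s; rewrite !inE /= andb_orl andbb; case: (s \in A0); rewrite ?andbF.
rewrite (_ : [fset x | x in (A0 `|` A)%fset & x \notin A0]%fset = (A `\` A0)%fset).
  by move=> h; have := lerD hA0 h; lra.
by apply/fsetP => s; rewrite !inE /=; case: (s \in A0); rewrite ?andbF ?andbT.
Qed.

Definition sample_alg : Type := ('M[R[i]]_2 * R[i])%type.

Definition sample_op (j : int) (a : sample_alg) : F -> F :=
  a.1 0 0 \*: (annih j \o create j) \+ a.1 0 1 \*: annih j \+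
  a.1 1 0 \*: create j \+ a.1 1 1 \*: (create j \o annih j) \+
  a.2 \*: below j.

Definition state_process (H : hilbert R) (pi : (F -> F) -> (H -> H))
  (j : int) (a : sample_alg) : H -> H := pi (sample_op j a).

End Monotone.
Arguments monotone_alg R : clear implicits.
Arguments monotone_alg0 R : clear implicits.

(* Main.v *)
Require Import Defs.
From mathcomp Require Import all_boot all_order all_algebra.
From mathcomp Require Import finmap.
From mathcomp Require Import complex.
From mathcomp Require Import all_classical all_reals all_analysis.
From mathcomp Require Import ring lra zify.

Set Implicit Arguments.
Unset Strict Implicit.
Unset Printing Implicit Defensive.

Import Order.TTheory GRing.Theory Num.Theory.
Import numFieldNormedType.Exports.

Local Open Scope classical_set_scope.
Local Open Scope ring_scope.
Local Open Scope complex_scope.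

(** Let [P_k = a_k a_k^*] be the projection onto the span of the sequences all of
    whose entries exceed [k] ([above k] below). Everything follows from the identity
    [P_(i-1) = P_i + a_i^* a_i] ([above_pred]): the state [phi] is symmetric if and
    only if [phi (P_k)] does not depend on [k].

    If these values agree, then [phi (a_i^* a_i) = 0], so that [a_i] kills the cyclic
    vector [xi] and [phi] vanishes on all basis monomials except [I] and the [P_k]; such a
    state is symmetric ([level_symmetric]). Conversely [T_sigma] moves [P_i] to
    [P_j] for a transposition [sigma] ([symmetric_level]). This direction uses that
    [T_sigma] exists, that is, the linear independence of the monomials
    ([T_exists]), which is detected by matrix entries. An expectation as in (ii)
    preserves the state and has the same value at all [iota_k], so [phi (P_k)] is
    independent of [k], and (i) follows.

    For (i) => (ii), all [P_k xi] coincide; let [vac] be this vector and [resid] be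
    [xi - vac]. All [a_i] and [a_i^*] kill [resid], and the creation operators
    generate from [vac] a multiple of the canonical basis of the Fock space. The
    vectors [fvec u] so obtained and [resid] are orthogonal and total in the GNS space
    ([total_ind]); since the algebra is a norm closure, this requires that states
    are norm bounded ([state_le1]).

    The tail algebra consists of the operators that are scalar on each of three
    mutually orthogonal subspaces: the line of [vac], the line of [resid] and the
    span of the remaining basis vectors. It contains no others because, for large
    finite [I], partial isometries moving [fvec (t ++ v)] to [fvec (t ++ u)] commute
    with all [a_k], [k] outside [I] ([tail_intertwiner], [tail_diag]). It contains
    these because the projections onto the two lines are limits of elements of the
    process with indices outside [I] ([tail_of_diag]).

    The conditional expectation is the vector state on each line. On the third
    subspace it is a generalized limit of the vector states of [e_(-n)], a singular
    state to which every [iota_k] looks the same. Independence with respect to it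
    holds because the vectors obtained from [vac] with indices in disjoint sets
    meet only in the line of [vac] ([tail_exp_independent]). *)


(** * Hilbert space geometry *)

Section HilbertGeometry.
Context {R : realType} {H : hilbert R}.
Implicit Types (x y z : H) (c : R[i]) (T S : H -> H).
Local Notation "<| x , y |>" := (ip H x y) (at level 0, x, y at level 99).

Lemma ipDl x y z : <| x + y, z |> = <| x, z |> + <| y, z |>.
Proof. exact: (linearDl (ip H) z). Qed.

Lemma ipZl c x z : <| c *: x, z |> = c * <| x, z |>.
Proof. exact: (linearZl_LR (ip H) z). Qed.

Lemma ip0l z : <| 0, z |> = 0.
Proof. exact: (linear0l (ip H)). Qed.

Lemma ipNl x z : <| - x, z |> = - <| x, z |>.
Proof. exact: (linearNl (ip H) z). Qed.

Lemma ipBl x y z : <| x - y, z |> = <| x, z |> - <| y, z |>.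
Proof. by rewrite ipDl ipNl. Qed.

Lemma ipC x y : <| x, y |> = conjc <| y, x |>.
Proof. by rewrite (hermC (ip H)) expr0 mul1r. Qed.

Lemma ipDr x y z : <| z, x + y |> = <| z, x |> + <| z, y |>.
Proof. by rewrite ipC ipDl rmorphD /= -!ipC. Qed.

Lemma ipZr c x z : <| z, c *: x |> = conjc c * <| z, x |>.
Proof. by rewrite ipC ipZl rmorphM /= -ipC. Qed.

Lemma ip0r z : <| z, 0 |> = 0.
Proof. by rewrite ipC ip0l rmorph0. Qed.

Lemma ipNr x z : <| z, - x |> = - <| z, x |>.
Proof. by rewrite ipC ipNl rmorphN /= -ipC. Qed.

Lemma ipBr x y z : <| z, x - y |> = <| z, x |> - <| z, y |>.
Proof. by rewrite ipDr ipNr. Qed.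

Lemma ip_sumr (I : Type) (r : seq I) (F : I -> H) z :
  <| z, \sum_(i <- r) F i |> = \sum_(i <- r) <| z, F i |>.
Proof. by elim: r => [|i r IH]; rewrite ?big_nil ?ip0r // !big_cons ipDr IH. Qed.

Definition nsq x : R := complex.Re <| x, x |>.

Lemma ip_ge0 x : 0 <= <| x, x |>.
Proof.
have [->|x0] := eqVneq x 0; first by rewrite ip0l.
by apply: ltW; exact: neq0_dnorm_gt0.
Qed.

Lemma ipxx x : <| x, x |> = (nsq x)%:C.
Proof.
have := ip_ge0 x; rewrite /nsq; case: <| x, x |> => a b.
by rewrite lecE /= => /andP[/eqP -> _].
Qed.

Lemma nsq_ge0 x : 0 <= nsq x.
Proof. by have := ip_ge0 x; rewrite ipxx lecR. Qed.

Lemma nsq_eq0 x : nsq x = 0 -> x = 0.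
Proof.
move=> h; apply/eqP; apply: contraT => /(@neq0_dnorm_gt0 _ _ _ (ip H)).
by rewrite ipxx h ltxx.
Qed.

Lemma nsqD x y : nsq (x + y) = nsq x + nsq y + 2 * complex.Re <| x, y |>.
Proof.
rewrite /nsq ipDl !ipDr (ipC y x) !raddfD /=.
by case: <| x, y |> => a b /=; ring.
Qed.

Lemma nsqZ c x : nsq (c *: x) = sqn c * nsq x.
Proof.
rewrite /nsq ipZl ipZr ipxx; case: c => a b; rewrite /sqn /=; ring.
Qed.

Lemma nsqN x : nsq (- x) = nsq x.
Proof. by rewrite /nsq ipNl ipNr opprK. Qed.

Lemma nsqB x y : nsq (x - y) = nsq x + nsq y - 2 * complex.Re <| x, y |>.
Proof. by rewrite nsqD nsqN ipNr raddfN /= mulrN. Qed.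

Lemma nsq0 : nsq 0 = 0.
Proof. by rewrite /nsq ip0l. Qed.

(** The modulus as an element of [R]; the norm [`|c|] lives in [R[i]]. *)
Definition cabs c : R := Num.sqrt (sqn c).

Lemma cauchy_schwarz x y : sqn <| x, y |> <= nsq x * nsq y.
Proof.
have [y0|y0] := eqVneq (nsq y) 0.
  by rewrite (nsq_eq0 y0) ip0r sqn0 nsq0 mulr0.
have yp : 0 < nsq y by rewrite lt_def y0 nsq_ge0.
have := nsq_ge0 ((nsq y)%:C *: x - <| x, y |> *: y).
rewrite nsqB !nsqZ ipZl ipZr.
set d := <| x, y |>; case: d => a b; rewrite /sqn /= => h.
have : 0 <= nsq y * (nsq x * nsq y - (a ^+ 2 + b ^+ 2)).
  by apply: le_trans h _; rewrite le_eqVlt; apply/orP; left; apply/eqP; ring.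
by rewrite pmulr_rge0 // subr_ge0.
Qed.

Lemma hnormE x : hnorm x ^+ 2 = nsq x.
Proof. by rewrite sqr_sqrtr // nsq_ge0. Qed.

Lemma hnorm_ge0 x : 0 <= hnorm x.
Proof. exact: sqrtr_ge0. Qed.

Lemma hnorm_le x (e : R) : 0 <= e -> (hnorm x <= e) = (nsq x <= e ^+ 2).
Proof. by move=> e0; rewrite -hnormE ler_sqr ?nnegrE ?hnorm_ge0. Qed.

Lemma cabs_ge0 c : 0 <= cabs c.
Proof. exact: sqrtr_ge0. Qed.

Lemma cabsE c : cabs c ^+ 2 = sqn c.
Proof. by rewrite sqr_sqrtr // sqn_ge0. Qed.

Lemma cabs_ip x y : cabs <| x, y |> <= hnorm x * hnorm y.
Proof.
rewrite -ler_sqr ?nnegrE ?mulr_ge0 ?hnorm_ge0 ?cabs_ge0 //.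
by rewrite exprMn !hnormE cabsE cauchy_schwarz.
Qed.

Lemma Re_le_cabs c : complex.Re c <= cabs c.
Proof.
apply: le_trans (ler_norm _) _; rewrite -sqrtr_sqr ler_wsqrtr //.
by rewrite /sqn lerDl sqr_ge0.
Qed.

Lemma hnormD x y : hnorm (x + y) <= hnorm x + hnorm y.
Proof.
rewrite hnorm_le ?addr_ge0 ?hnorm_ge0 // nsqD sqrrD !hnormE.
by have := le_trans (Re_le_cabs _) (cabs_ip x y); lra.
Qed.

Lemma hnormZ c x : hnorm (c *: x) = cabs c * hnorm x.
Proof. by rewrite {1}/hnorm /ipnorm -/(nsq _) nsqZ sqrtrM ?sqn_ge0. Qed.

Lemma hnormN x : hnorm (- x) = hnorm x.
Proof. by rewrite /hnorm /ipnorm -!/(nsq _) nsqN. Qed.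

Lemma hnorm0 : hnorm (0 : H) = 0.
Proof. by rewrite /hnorm /ipnorm ip0l sqrtr0. Qed.

Lemma hnormB x y : hnorm (x - y) <= hnorm x + hnorm y.
Proof. by rewrite -(hnormN y) hnormD. Qed.

Lemma hnorm_distC x y : hnorm (x - y) = hnorm (y - x).
Proof. by rewrite -hnormN opprB. Qed.

Lemma hnorm_small x : (forall e : R, 0 < e -> hnorm x <= e) -> x = 0.
Proof.
move=> h; apply: nsq_eq0; rewrite -hnormE; apply/eqP.
rewrite sqrf_eq0 eq_le hnorm_ge0 andbT; apply/ler_addgt0Pr => e /h.
by rewrite add0r.
Qed.

Lemma ip_inj x y : (forall z, <| x, z |> = <| y, z |>) -> x = y.
Proof.
move=> h; apply/eqP; rewrite -subr_eq0; apply/eqP/nsq_eq0.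
by rewrite /nsq ipBl h subrr.
Qed.

End HilbertGeometry.

Section LinearMaps.
Context {R : realType} {H K : hilbert R}.
Implicit Types (T : H -> K).

Lemma linmapD T x y : linear T -> T (x + y) = T x + T y.
Proof. by move=> l; have := l 1 x y; rewrite !scale1r. Qed.

Lemma linmap0 T : linear T -> T 0 = 0.
Proof.
move=> l; have := l 1 0 0; rewrite !scale1r addr0 => /esym/eqP.
by rewrite -subr_eq0 addrK => /eqP.
Qed.

Lemma linmapZ T c x : linear T -> T (c *: x) = c *: T x.
Proof. by move=> l; have := l c x 0; rewrite linmap0 // !addr0. Qed.

Lemma linmapN T x : linear T -> T (- x) = - T x.
Proof. by move=> l; rewrite -scaleN1r linmapZ // scaleN1r. Qed.

Lemma linmapB T x y : linear T -> T (x - y) = T x - T y.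
Proof. by move=> l; rewrite linmapD // linmapN. Qed.
End LinearMaps.

(** * Bounded operators and commutants *)

Section BoundedOperators.
Context {R : realType} {H : hilbert R}.
Implicit Types (x y z : H) (c : R[i]) (T S : H -> H) (G : set (H -> H)).
Local Notation "<| x , y |>" := (ip H x y) (at level 0, x, y at level 99).

Lemma bounded_pos T : bounded_op T ->
  exists2 k : R, 0 < k & forall x, hnorm (T x) <= k * hnorm x.
Proof.
move=> [_ [k kT]]; exists (Num.max k 0 + 1).
  by rewrite ltr_wpDl // le_max lexx orbT.
move=> x; apply: le_trans (kT x) _; rewrite ler_wpM2r ?hnorm_ge0 //.
by apply: le_trans (_ : _ <= Num.max k 0) _; rewrite ?le_max ?lexx // lerDl.
Qed.

Lemma bounded_id : bounded_op (id : H -> H).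
Proof. by split=> //; exists 1 => x; rewrite mul1r. Qed.

Lemma bounded_comp S T : bounded_op S -> bounded_op T -> bounded_op (S \o T).
Proof.
move=> bS bT; split=> [c x y /=|]; first by rewrite bT.1 bS.1.
have [[k k0 kS] [l l0 lT]] := (bounded_pos bS, bounded_pos bT).
exists (k * l) => x /=; apply: le_trans (kS _) _.
by rewrite -mulrA ler_pM2l.
Qed.

Lemma bounded_lin c S T : bounded_op S -> bounded_op T ->
  bounded_op (c \*: S \+ T).
Proof.
move=> bS bT; split=> [d x y /=|].
  by rewrite bT.1 bS.1 scalerDr !scalerA mulrC scalerDr scalerA addrACA.
have [[k k0 kS] [l l0 lT]] := (bounded_pos bS, bounded_pos bT).
exists (cabs c * k + l) => x /=; apply: le_trans (hnormD _ _) _.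
rewrite mulrDl lerD // hnormZ -mulrA ler_wpM2l //; exact: sqrtr_ge0.
Qed.

Lemma bounded_zero : bounded_op ((fun=> 0) : H -> H).
Proof.
by split=> [c x y|]; [rewrite scaler0 addr0|exists 0 => x; rewrite mul0r hnorm0].
Qed.

Lemma adjoint_sym T S : adjoint_of T S -> adjoint_of S T.
Proof. by move=> h x y; rewrite ipC -h -ipC. Qed.

Lemma adjoint_inj T S S' : adjoint_of T S -> adjoint_of T S' -> S = S'.
Proof.
move=> h h'; apply/funext => y; apply: ip_inj => z.
by rewrite ipC -h h' -ipC.
Qed.

Lemma adjoint_comp S S' T T' : adjoint_of S S' -> adjoint_of T T' ->
  adjoint_of (S \o T) (T' \o S').
Proof. by move=> h h' x y /=; rewrite h h'. Qed.

Lemma adjoint_lin c S S' T T' : adjoint_of S S' -> adjoint_of T T' ->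
  adjoint_of (c \*: S \+ T) (conjc c \*: S' \+ T').
Proof. by move=> h h' x y /=; rewrite ipDl ipZl ipDr ipZr h h' conjcK. Qed.

Lemma adjoint_linear T S : adjoint_of T S -> linear S.
Proof.
move=> h c x y; apply: ip_inj => z.
by rewrite ipDl ipZl !(ipC _ z) -!h ipDr ipZr rmorphD rmorphM /= conjcK.
Qed.

Lemma adjoint_bound T S (k : R) : 0 <= k -> (forall x, hnorm (T x) <= k * hnorm x) ->
  adjoint_of T S -> forall x, hnorm (S x) <= k * hnorm x.
Proof.
move=> k0 kT h x; have [->|S0] := eqVneq (hnorm (S x)) 0.
  by rewrite mulr_ge0 ?hnorm_ge0.
have Sp : 0 < hnorm (S x) by rewrite lt_def S0 hnorm_ge0.
rewrite -(ler_pM2l Sp); rewrite -expr2 hnormE /nsq -h.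
apply: le_trans (Re_le_cabs _) _; apply: le_trans (cabs_ip _ _) _.
by rewrite mulrA (mulrC (hnorm (S x))) ler_wpM2r ?hnorm_ge0.
Qed.

Lemma adjoint_bounded T S : bounded_op T -> adjoint_of T S -> bounded_op S.
Proof.
move=> bT h; split; first exact: adjoint_linear h.
have [k k0 kT] := bounded_pos bT; exists k.
exact: adjoint_bound (ltW k0) kT h.
Qed.

Definition commute T S : Prop := T \o S = S \o T.

Lemma commuteE T S x : commute T S -> T (S x) = S (T x).
Proof. exact: (congr1 (fun f => f x)). Qed.

(** A commutant is equal to its own bicommutant. Commutants of self-adjoint sets
    are the von Neumann algebras by which generated ones get bounded from above. *)
Lemma vN_commutant G :
  (forall S, G S -> bounded_op S) ->
  (forall S, G S -> exists2 S', G S' & adjoint_of S S') ->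
  vN_alg (commutant G).
Proof.
move=> bG aG; split; first split.
- by move=> T [].
- by split; first exact: bounded_id.
- move=> c S T [bS hS] [bT hT]; split; first exact: bounded_lin.
  move=> U GU; apply/funext => x /=; have lU := (bG _ GU).1.
  by rewrite lU (commuteE x (hS _ GU)) (commuteE x (hT _ GU)).
- move=> S T [bS hS] [bT hT]; split; first exact: bounded_comp.
  move=> U GU; apply/funext => x /=.
  by rewrite (commuteE x (hT _ GU)) (commuteE (T x) (hS _ GU)).
- move=> S T [bS hS] ST; split; first exact: adjoint_bounded ST.
  move=> U GU; have [U' GU' UU'] := aG _ GU.
  apply: (@adjoint_inj (S \o U')).
    by rewrite (hS _ GU'); apply: adjoint_comp => //; exact: adjoint_sym.
  exact: adjoint_comp ST (adjoint_sym UU').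
- apply/seteqP; split=> T [bT hT]; split=> // S.
    move=> GS; apply: hT; split; first exact: bG.
    by move=> U [_ hU]; rewrite hU.
  by move=> [_ hS]; rewrite hS //; split.
Qed.

Lemma vN_gen_sub G S : G S -> vN_gen G S.
Proof. by move=> GS A [_]; apply. Qed.

Lemma vN_gen_min G A : vN_alg A -> G `<=` A -> vN_gen G `<=` A.
Proof. by move=> vA GA T; apply. Qed.

(** Commutation with [T] passes from generators to the von Neumann algebra they
    generate as soon as it holds for the adjoint of [T] as well. *)
Lemma vN_gen_commute G T T' X : bounded_op T -> adjoint_of T T' ->
  (forall S, G S -> [/\ bounded_op S, commute T S & commute T' S]) ->
  vN_gen G X -> [/\ bounded_op X, commute T X & commute T' X].
Proof.
move=> bT TT' GT gX.
have vA : vN_alg (commutant [set S | S = T \/ S = T']).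
  apply: vN_commutant => S.
    by move=> [->|->] //; exact: adjoint_bounded TT'.
  move=> [->|->]; first by exists T' => //; right.
  by exists T; [left|exact: adjoint_sym].
have [bX cX] : commutant [set S | S = T \/ S = T'] X.
  apply: (vN_gen_min vA) gX => S /GT[bS cS cS']; split=> //.
  by move=> U [->|->].
by split=> //; apply/esym/cX; [left|right].
Qed.

End BoundedOperators.

(** * Limits of operators and boundedness of states *)

Section OperatorLimits.
Context {R : realType} {H : hilbert R}.
Implicit Types (x y : H) (c : R[i]) (S T : H -> H) (A G : set (H -> H)).

Lemma normC_cabs c : `|c| = (cabs c)%:C.
Proof. by case: c => a b; rewrite normc_def. Qed.

Lemma cabsD c d : cabs (c + d) <= cabs c + cabs d.
Proof. by rewrite -lecR rmorphD /= -!normC_cabs ler_normD. Qed.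

Lemma cabsN c : cabs (- c) = cabs c.
Proof. by rewrite /cabs sqnN. Qed.

Lemma cabs_small c : (forall e : R, 0 < e -> cabs c <= e) -> c = 0.
Proof.
move=> h; apply: sqn_eq0; rewrite -cabsE; apply/eqP.
rewrite sqrf_eq0 eq_le cabs_ge0 andbT; apply/ler_addgt0Pr => e /h.
by rewrite add0r.
Qed.

Lemma half_small (C e : R) : 0 <= C -> 0 < e ->
  exists N, forall n, (N <= n)%N -> C * 2^-1 ^+ n <= e.
Proof.
move=> C0 e0; exists (Num.bound (C / e)) => n Nn.
have n2 : (n%:R : R) <= 2 ^+ n by rewrite -natrX ler_nat ltnW // ltn_expl.
rewrite exprVn ler_pdivrMr ?exprn_gt0 //.
rewrite mulrC -ler_pdivrMr //; apply: le_trans n2.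
apply: le_trans (ltW (archi_boundP _)) _; first by rewrite divr_ge0 // ltW.
by rewrite ler_nat.
Qed.

(** Geometric speed is what both norm approximations at scale [2^-n] and the
    contraction used for square roots provide. *)
Lemma op_limit (B : nat -> H -> H) (k : R) : 0 <= k ->
  (forall n, linear (B n)) ->
  (forall n x, hnorm (B n.+1 x - B n x) <= k * 2^-1 ^+ n * hnorm x) ->
  exists L : H -> H, linear L /\
    forall n x, hnorm (L x - B n x) <= 2 * k * 2^-1 ^+ n * hnorm x.
Proof.
move=> k0 linB dB.
have h0 n : 0 <= (2^-1 : R) ^+ n by rewrite exprn_ge0.
have dBm n m x : hnorm (B (n + m)%N x - B n x) <=
    2 * k * 2^-1 ^+ n * (1 - 2^-1 ^+ m) * hnorm x.
  elim: m => [|m IH]; first by rewrite addn0 subrr hnorm0 expr0 subrr mulr0 mul0r.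
  rewrite addnS -(subrKA (B (n + m)%N x)).
  apply: le_trans (hnormD _ _) _; apply: le_trans (lerD (dB _ _) IH) _.
  by rewrite exprD exprS le_eqVlt; apply/orP; left; apply/eqP; field.
have dBm' n m x : (n <= m)%N -> hnorm (B m x - B n x) <=
    2 * k * 2^-1 ^+ n * hnorm x.
  move=> nm; rewrite -(subnKC nm); apply: le_trans (dBm _ _ _) _.
  rewrite ler_wpM2r ?hnorm_ge0 // -[leRHS]mulr1 ler_wpM2l ?mulr_ge0 ?gerBl //.
have lim x : exists l, forall n, hnorm (l - B n x) <= 2 * k * 2^-1 ^+ n * hnorm x.
  have Cx : 0 <= 4 * k * hnorm x by rewrite !mulr_ge0 ?hnorm_ge0.
  have [e e0|l hl] := @hilbert_complete R H (fun n => B n x).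
    have [N hN] := half_small Cx e0; exists N => p q Np Nq.
    rewrite -/(hnorm _) -(subrKA (B N x)); apply: le_trans (hnormD _ _) _.
    rewrite (hnorm_distC (B N x)).
    apply: le_trans (lerD (dBm' _ _ _ Np) (dBm' _ _ _ Nq)) _.
    by apply: le_trans (hN N (leqnn _)); lra.
  exists l => n; apply/ler_addgt0Pr => e e0; have [N hN] := hl e e0.
  rewrite -(subrKA (B (maxn n N) x)); apply: le_trans (hnormD _ _) _.
  rewrite addrC lerD // ?dBm' ?leq_maxl // hnorm_distC.
  by apply: hN; rewrite leq_maxr.
have [L hL] := choice lim; exists L; split=> // c x y.
apply/eqP; rewrite -subr_eq0; apply/eqP/hnorm_small => e e0.
pose C := 2 * k * (hnorm (c *: x + y) + cabs c * hnorm x + hnorm y).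
have C0 : 0 <= C by rewrite !mulr_ge0 // !addr_ge0 ?mulr_ge0 ?hnorm_ge0 ?cabs_ge0.
have [n hn] := half_small C0 e0; apply: le_trans (hn n (leqnn _)).
have -> : L (c *: x + y) - (c *: L x + L y) =
    (L (c *: x + y) - B n (c *: x + y)) - (c *: (L x - B n x) + (L y - B n y)).
  by rewrite linB scalerBr addrACA -opprD opprB subrKA.
apply: le_trans (hnormB _ _) _.
apply: le_trans (lerD (hL _ n) (hnormD _ _)) _; rewrite hnormZ.
have := ler_wpM2l (cabs_ge0 c) (hL x n); have := hL y n.
rewrite /C; move: (hnorm (L y - _)) (cabs c * hnorm (_ - _)) => u v.
move: (2^-1 ^+ n) => d hu hv.
apply: le_trans (lerD (lexx _) (lerD hv hu)) _.
by rewrite le_eqVlt; apply/orP; left; apply/eqP; ring.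
Qed.

Lemma adjoint_limit T L :
  (forall e : R, 0 < e -> exists S S', [/\ adjoint_of S S',
     forall x, hnorm (T x - S x) <= e * hnorm x &
     forall x, hnorm (L x - S' x) <= e * hnorm x]) ->
  adjoint_of T L.
Proof.
move=> h x y; apply/eqP; rewrite -subr_eq0; apply/eqP/cabs_small => e e0.
pose C := 2 * (hnorm x * hnorm y) + 1.
have C0 : 0 < C by rewrite ltr_wpDl // !mulr_ge0 ?hnorm_ge0.
have [S [S' [SS' hT hL]]] := h _ (divr_gt0 e0 C0).
have -> : ip H (T x) y - ip H x (L y) = ip H (T x - S x) y - ip H x (L y - S' y).
  by rewrite ipBl ipBr SS' opprB addrA subrK.
apply: le_trans (cabsD _ _) _; rewrite cabsN.
apply: le_trans (lerD (cabs_ip _ _) (cabs_ip _ _)) _.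
have h1 := ler_wpM2r (hnorm_ge0 y) (hT x).
have h2 := ler_wpM2l (hnorm_ge0 x) (hL y).
apply: le_trans (lerD h1 h2) _.
have -> : e / C * hnorm x * hnorm y + hnorm x * (e / C * hnorm y) =
   (e / C) * (C - 1) by rewrite /C; ring.
have : (e / C) * (C - 1) <= (e / C) * C.
  by rewrite ler_wpM2l ?(divr_ge0 (ltW e0) (ltW C0)) // gerBl.
by rewrite mulfVK // gt_eqF.
Qed.

Definition adjointable : set (H -> H) :=
  [set T | bounded_op T /\ exists S, adjoint_of T S].

Lemma star_alg_adjointable : star_alg adjointable.
Proof.
split; first by move=> T [].
- by split; [exact: bounded_id|exists id].
- move=> c S T [bS [S' hS]] [bT [T' hT]]; split; first exact: bounded_lin.
  by eexists; exact: adjoint_lin hS hT.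
- move=> S T [bS [S' hS]] [bT [T' hT]]; split; first exact: bounded_comp.
  by eexists; exact: adjoint_comp hS hT.
- move=> S T [bS _] ST; split; first exact: adjoint_bounded ST.
  by exists S; exact: adjoint_sym.
Qed.

(** Since the norm of an adjoint is controlled by the norm of the operator, the
    adjoints of a norm convergent sequence converge. Elements of a generated
    C*-algebra therefore have adjoints, without appeal to the Riesz theorem. *)
Lemma norm_closed_adjointable : norm_closed adjointable.
Proof.
move=> T bT hT; split=> //.
have /choice[S hS] n : exists S, adjointable S /\
    forall x, hnorm (T x - S x) <= 2^-1 ^+ n * hnorm x.
  by have [|S aS hS] := hT (2^-1 ^+ n); [rewrite exprn_gt0|exists S].
have /choice[S' hS'] n : exists S', adjoint_of (S n) S' by case: (hS n) => [[]].
have dS n x : hnorm (S' n.+1 x - S' n x) <= 2 * 2^-1 ^+ n * hnorm x.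
  apply: (@adjoint_bound _ _ (fun x => S n.+1 x - S n x)
    (fun x => S' n.+1 x - S' n x)).
  - by rewrite mulr_ge0 ?exprn_ge0.
  - move=> y; rewrite -(subrKA (T y)); apply: le_trans (hnormD _ _) _.
    rewrite hnorm_distC.
    apply: le_trans (lerD ((hS n.+1).2 y) ((hS n).2 y)) _.
    rewrite -mulrDl ler_wpM2r ?hnorm_ge0 // exprS.
    by have : (0 : R) <= 2^-1 ^+ n; [rewrite exprn_ge0|lra].
  - by move=> u v; rewrite ipBl ipBr !hS'.
have [L [_ hL]] := op_limit (ler0n R 2) (fun n => adjoint_linear (hS' n)) dS.
exists L; apply: adjoint_limit => e e0.
have [N hN] := half_small (ler0n R 4) e0; exists (S N), (S' N); split=> // x.
  apply: le_trans ((hS N).2 x) _; rewrite ler_wpM2r ?hnorm_ge0 //.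
  apply: le_trans (hN N (leqnn _)).
  by have : (0 : R) <= 2^-1 ^+ N; [rewrite exprn_ge0|lra].
apply: le_trans (hL N x) _; rewrite ler_wpM2r ?hnorm_ge0 //.
by apply: le_trans (hN N (leqnn _)); rewrite -natrM.
Qed.

Lemma star_alg_star_gen G : G `<=` adjointable -> star_alg (star_gen G).
Proof.
move=> Ga; split.
- move=> T hT; have [] // : adjointable T.
  by apply: hT; split=> //; exact: star_alg_adjointable.
- by move=> A [sA _]; exact: star_alg_id.
- by move=> c S T hS hT A AG; exact: (star_alg_linear AG.1 _ (hS _ AG) (hT _ AG)).
- by move=> S T hS hT A AG; exact: (star_alg_comp AG.1 (hS _ AG) (hT _ AG)).
- by move=> S T hS ST A AG; exact: (star_alg_adjoint AG.1 (hS _ AG) ST).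
Qed.

Lemma star_alg_cstar_gen G : G `<=` adjointable -> star_alg (cstar_gen G).
Proof.
move=> Ga; split.
- move=> T hT; have [] // : adjointable T.
  apply: hT; split=> //; first exact: star_alg_adjointable.
  exact: norm_closed_adjointable.
- by move=> A [sA _ _]; exact: star_alg_id.
- by move=> c S T hS hT A AG; have [sA _ _] := AG;
    exact: (star_alg_linear sA _ (hS _ AG) (hT _ AG)).
- by move=> S T hS hT A AG; have [sA _ _] := AG;
    exact: (star_alg_comp sA (hS _ AG) (hT _ AG)).
- by move=> S T hS ST A AG; have [sA _ _] := AG; exact: (star_alg_adjoint sA (hS _ AG) ST).
Qed.

Lemma norm_closed_cstar_gen G : norm_closed (cstar_gen G).
Proof.
move=> T bT hT A [sA nA AG]; apply: (nA) => // e /hT[S gS hS].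
by exists S; [exact: (gS A (And3 sA nA AG))|exact: hS].
Qed.

Lemma star_gen_cstar G S : star_gen G S -> cstar_gen G S.
Proof. by move=> hS A [sA _ GA]; apply: hS; split. Qed.

Lemma star_gen_adjoint G S : G `<=` adjointable -> star_gen G S ->
  exists2 S', star_gen G S' & adjoint_of S S'.
Proof.
move=> Ga gS; have sA := star_alg_star_gen Ga.
have [_ [S' hS']] : adjointable S.
  by apply: gS; split=> //; exact: star_alg_adjointable.
by exists S' => //; exact: star_alg_adjoint gS hS'.
Qed.

Lemma cstar_gen_adjoint G S : G `<=` adjointable -> cstar_gen G S ->
  exists2 S', cstar_gen G S' & adjoint_of S S'.
Proof.
move=> Ga gS; have sA := star_alg_cstar_gen Ga.
have [_ [S' hS']] : adjointable S.
  by apply: gS; split=> //; [exact: star_alg_adjointable|exact: norm_closed_adjointable].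
by exists S' => //; exact: star_alg_adjoint gS hS'.
Qed.

Definition norm_closure A : set (H -> H) :=
  [set T | bounded_op T /\ forall e : R, 0 < e ->
     exists2 S, A S & forall x, hnorm (T x - S x) <= e * hnorm x].

(** The norm closure of a *-algebra is a C*-algebra, so nothing is lost by
    approximating elements of the generated C*-algebra by polynomials. *)
Lemma cstar_gen_closure G : G `<=` adjointable ->
  cstar_gen G `<=` norm_closure (star_gen G).
Proof.
move=> Ga; have sA := star_alg_star_gen Ga.
have cA T : norm_closure (star_gen G) T -> adjointable T.
  move=> [bT hT]; apply: norm_closed_adjointable => // e /hT[S gS hS].
  by exists S => //; apply: gS; split=> //; exact: star_alg_adjointable.
move=> T; apply; split; first split.
- by move=> S [].
- split; first exact: bounded_id.
  move=> e e0; exists id; first exact: star_alg_id.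
  by move=> x; rewrite subrr hnorm0 mulr_ge0 ?hnorm_ge0 // ltW.
- move=> c S U [bS hS] [bU hU]; split; first exact: bounded_lin.
  move=> e e0; pose d := e / (cabs c + 1).
  have c1 : 0 < cabs c + 1 by rewrite ltr_wpDl ?cabs_ge0.
  have d0 : 0 < d by rewrite divr_gt0.
  have [S0 gS0 hS0] := hS d d0; have [U0 gU0 hU0] := hU d d0.
  exists (c \*: S0 \+ U0); first exact: (star_alg_linear sA).
  move=> x /=; rewrite opprD addrACA -scalerBr.
  apply: le_trans (hnormD _ _) _; rewrite hnormZ.
  apply: le_trans (lerD (ler_wpM2l (cabs_ge0 c) (hS0 x)) (hU0 x)) _.
  rewrite [leRHS](_ : _ = (cabs c + 1) * d * hnorm x); last first.
    by rewrite /d mulrCA mulfV ?mulr1 // gt_eqF.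
  by rewrite le_eqVlt; apply/orP; left; apply/eqP; ring.
- move=> S U [bS hS] [bU hU]; split; first exact: bounded_comp.
  move=> e e0; have [k k0 kS] := bounded_pos bS.
  have [U0 gU0 hU0] := hU (e / 2 / k) (divr_gt0 (divr_gt0 e0 (ltr0n _ 2)) k0).
  (* the precision required of [S0] depends on the bound of [U0] *)
  have [l l0 lU0] := bounded_pos (star_alg_bounded sA gU0).
  have [S0 gS0 hS0] := hS (e / 2 / l) (divr_gt0 (divr_gt0 e0 (ltr0n _ 2)) l0).
  exists (S0 \o U0); first exact: (star_alg_comp sA).
  move=> x /=; rewrite -(subrKA (S (U0 x))) -(linmapB _ _ bS.1).
  apply: le_trans (hnormD _ _) _.
  have h1 : hnorm (S (U x - U0 x)) <= e / 2 * hnorm x.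
    apply: le_trans (kS _) _; rewrite mulrC -ler_pdivlMr //.
    by rewrite mulrAC; exact: hU0.
  have h2 : hnorm (S (U0 x) - S0 (U0 x)) <= e / 2 * hnorm x.
    apply: le_trans (hS0 _) _; rewrite mulrAC ler_pdivrMr // -[leRHS]mulrA.
    by rewrite ler_wpM2l ?(divr_ge0 (ltW e0)) // mulrC lU0.
  by apply: le_trans (lerD h1 h2) _; rewrite -mulrDl -splitr.
- move=> S S' [bS hS] SS'; split; first exact: adjoint_bounded SS'.
  move=> e e0; have [S0 gS0 hS0] := hS e e0.
  have [S0' gS0' h0] := star_gen_adjoint Ga gS0.
  exists S0' => // ; apply: (@adjoint_bound _ _ (fun x => S x - S0 x)
    (fun x => S' x - S0' x)) => //.
    exact: ltW.
  by move=> u v; rewrite ipBl ipBr SS' h0.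
- move=> S bS hS; split=> // e e0.
  have [S1 [bS1 hS1] h1] := hS (e / 2) (divr_gt0 e0 (ltr0n _ 2)).
  have [S2 gS2 h2] := hS1 (e / 2) (divr_gt0 e0 (ltr0n _ 2)).
  exists S2 => // x; rewrite -(subrKA (S1 x)); apply: le_trans (hnormD _ _) _.
  by apply: le_trans (lerD (h1 x) (h2 x)) _; rewrite -mulrDl -splitr.
- move=> S GS; split; first by have [] := Ga _ GS.
  move=> e e0; exists S; first by move=> B [_]; apply.
  by move=> x; rewrite subrr hnorm0 mulr_ge0 ?hnorm_ge0 // ltW.
Qed.

(** The square root of [1 - S] is [1 - B] where [B = (S + B^2) / 2]; for small
    [S] this fixed-point equation is solved by a contraction, which avoids any
    functional calculus. *)
Lemma one_minus_square A S : star_alg A -> norm_closed A -> A S ->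
  adjoint_of S S -> (forall x, hnorm (S x) <= 4^-1 * hnorm x) ->
  exists2 C, A C & adjoint_of C C /\ id \- S = C \o C.
Proof.
move=> sA nA AS SS hS.
have A0 : A (fun=> 0).
  have := star_alg_linear sA (-1) AS AS; congr A.
  by apply/funext => x /=; rewrite scaleN1r addNr.
pose step B : H -> H := (2^-1)%:C \*: (S \+ (B \o B)).
pose B n := iter n step (fun=> 0).
have AB n : A (B n).
  elim: n => //= n IH; have A1 : A (S \+ (B n \o B n)).
    have := star_alg_linear sA 1 AS (star_alg_comp sA IH IH); congr A.
    by apply/funext => x /=; rewrite scale1r.
  have := star_alg_linear sA (2^-1)%:C A1 A0; congr A.
  by apply/funext => x /=; rewrite addr0.
have linB n : linear (B n) := (star_alg_bounded sA (AB n)).1.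
have aB n : adjoint_of (B n) (B n).
  elim: n => [|n IH] x y /=; first by rewrite ip0l ip0r.
  rewrite ipZl ipZr !ipDl !ipDr SS !IH; congr (_ * _).
  by rewrite conjc_real.
have ch : cabs ((2^-1)%:C : R[i]) = 2^-1.
  by rewrite /cabs /sqn /= expr0n addr0 sqrtr_sqr ger0_norm.
have bB n x : hnorm (B n x) <= 2^-1 * hnorm x.
  elim: n x => [|n IH] x /=; first by rewrite hnorm0 mulr_ge0 ?hnorm_ge0.
  rewrite hnormZ ch ler_wpM2l //; apply: le_trans (hnormD _ _) _.
  have h1 := hS x; have h2 := IH (B n x); have h3 := IH x.
  have := hnorm_ge0 x; lra.
have dB n x : hnorm (B n.+1 x - B n x) <= 1 * 2^-1 ^+ n * hnorm x.
  rewrite mul1r; elim: n x => [|n IH] x.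
    have -> : B 1%N x - B 0%N x = (2^-1)%:C *: S x.
      by rewrite /B /step /= subr0 addr0.
    rewrite expr0 mul1r hnormZ ch.
    by have := hS x; have := hnorm_ge0 x; have := hnorm_ge0 (S x); lra.
  have -> : B n.+2 x - B n.+1 x = (2^-1)%:C *:
      (B n.+1 (B n.+1 x - B n x) + (B n.+1 (B n x) - B n (B n x))).
    rewrite (linmapB _ _ (linB n.+1)) subrKA.
    have -> : B n.+2 x = (2^-1)%:C *: (S x + B n.+1 (B n.+1 x)) by [].
    have -> : B n.+1 x = (2^-1)%:C *: (S x + B n (B n x)) by [].
    by rewrite -scalerBr opprD addrACA subrr add0r.
  rewrite hnormZ ch exprS -mulrA ler_wpM2l //; apply: le_trans (hnormD _ _) _.
  have h1 := bB n.+1 (B n.+1 x - B n x); have h2 := IH x.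
  have h3 := IH (B n x); have h4 := ler_wpM2l _ (bB n x).
  have := h4 (2^-1 ^+ n) (exprn_ge0 _ _); rewrite invr_ge0 => /(_ (ler0n _ 2)).
  lra.
have [L [linL hL]] := op_limit ler01 linB dB.
have hL' e : 0 < e -> exists n, forall x, hnorm (L x - B n x) <= e * hnorm x.
  move=> e0; have [n hn] := half_small (ler0n R 2) e0; exists n => x.
  apply: le_trans (hL n x) _; rewrite mulr1 ler_wpM2r ?hnorm_ge0 //.
  exact: hn.
have bL : bounded_op L.
  split=> //; exists (1 + 2^-1) => x; have [n hn] := hL' 1 ltr01.
  rewrite -(subrK (B n x) (L x)); apply: le_trans (hnormD _ _) _.
  by rewrite mulrDl lerD.
have AL : A L.
  by apply: nA => // e /hL'[n hn]; exists (B n).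
have aL : adjoint_of L L.
  by apply: adjoint_limit => e /hL'[n hn]; exists (B n), (B n).
have fix_L x : L x = (2^-1)%:C *: (S x + L (L x)).
  have [k k0 kL] := bounded_pos bL.
  apply/eqP; rewrite -subr_eq0; apply/eqP/hnorm_small => e e0.
  pose K := (4 + 2 * k) * hnorm x.
  have K0 : 0 <= K by rewrite mulr_ge0 ?hnorm_ge0 // addr_ge0 // mulr_ge0 // ltW.
  have [n hn] := half_small K0 e0; apply: le_trans (hn n (leqnn _)).
  have -> : L x - (2^-1)%:C *: (S x + L (L x)) = (L x - B n.+1 x) -
      (2^-1)%:C *: (L (L x - B n x) + (L (B n x) - B n (B n x))).
    rewrite (linmapB _ _ linL) subrKA.
    have -> : B n.+1 x = (2^-1)%:C *: (S x + B n (B n x)) by [].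
    rewrite -[RHS]addrA -opprD -scalerDr -(addrA (S x)).
    by rewrite (addrC (B n (B n x))) subrK.
  apply: le_trans (hnormB _ _) _; rewrite hnormZ ch.
  have h1 := hL n.+1 x; have h2 := hL n x; have h3 := hL n (B n x).
  have h4 := kL (L x - B n x).
  have h5 := hnormD (L (L x - B n x)) (L (B n x) - B n (B n x)).
  have h6 := ler_wpM2l (ltW k0) h2.
  have d0 : (0 : R) <= 2^-1 ^+ n by rewrite exprn_ge0.
  have h7 := ler_wpM2l d0 (bB n x); rewrite [leRHS]mulrCA in h7.
  have h8 : 0 <= 2^-1 ^+ n * hnorm x by rewrite mulr_ge0 ?hnorm_ge0.
  rewrite exprS in h1; rewrite /K.
  apply: le_trans (lerD h1 (ler_wpM2l _ h5)) _ => //.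
  have : k * (2 * 1 * 2^-1 ^+ n * hnorm x) = 2 * (k * (2^-1 ^+ n * hnorm x)) by ring.
  have : (4 + 2 * k) * hnorm x * 2^-1 ^+ n =
     4 * (2^-1 ^+ n * hnorm x) + 2 * (k * (2^-1 ^+ n * hnorm x)) by ring.
  move=> -> e6; rewrite {}e6 in h6.
  have k8 : 0 <= k * (2^-1 ^+ n * hnorm x) by rewrite mulr_ge0 // ltW.
  move: h6 h7 h8 k8 h3 h4; rewrite !mulr1 -!mulrA.
  move: (2^-1 ^+ n * hnorm x) => q; lra.
exists (id \- L); last split.
- have := star_alg_linear sA (-1) AL (star_alg_id sA); congr A.
  by apply/funext => x /=; rewrite scaleN1r addrC.
- by move=> x y /=; rewrite ipBl ipBr aL.
- apply/funext => x /=; rewrite (linmapB _ _ linL).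
  have e2 : L x + L x = S x + L (L x).
    have := congr1 (fun y => 2 *: y) (fix_L x); rewrite scalerA.
    have -> : 2 * (2^-1)%:C = 1 :> R[i].
      by rewrite -[2]/(2%:R) -(rmorph_nat (real_complex R)) -rmorphM /= mulfV.
    by rewrite scale1r scaler_nat mulr2n.
  have -> : S x = L x + L x - L (L x) by rewrite e2 addrK.
  by rewrite -(addrA (L x)) opprD addrA.
Qed.

(** [1 - D^* D] is the square of a self-adjoint element, on which a state is
    nonnegative. The factor [1/2] makes the square root iteration contract. *)
Lemma state_le1 A phi D D' : star_alg A -> norm_closed A -> is_state A phi ->
  A D -> adjoint_of D D' -> (forall x, hnorm (D x) <= 2^-1 * hnorm x) ->
  phi (D' \o D) <= 1.
Proof.
move=> sA nA sphi AD DD' hD.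
have AD' : A D' := star_alg_adjoint sA AD DD'.
have AS := star_alg_comp sA AD' AD.
have hS x : hnorm ((D' \o D) x) <= 4^-1 * hnorm x.
  have hD' : hnorm (D' (D x)) <= 2^-1 * hnorm (D x).
    exact: (@adjoint_bound _ _ D D' 2^-1).
  by apply: le_trans hD' _; have := hD x; lra.
have aS : adjoint_of (D' \o D) (D' \o D).
  exact: (adjoint_comp (adjoint_sym DD') DD').
have [C AC [aC CC]] := one_minus_square sA nA AS aS hS.
have := state_positive sphi AC aC; rewrite -CC.
have -> : id \- (D' \o D) = (-1) \*: (D' \o D) \+ id.
  by apply/funext => x /=; rewrite scaleN1r addrC.
rewrite (state_linear sphi) //; last exact: star_alg_id.
by rewrite (state_id sphi) mulN1r addrC subr_ge0.
Qed.
End OperatorLimits.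

Section GNSDensity.
Context {R : realType} {F H : hilbert R} (G : set (F -> F)).
Context (phi : (F -> F) -> R[i]) (pi : (F -> F) -> (H -> H)) (xi : H).
Hypothesis Ga : G `<=` adjointable.
Hypothesis sphi : is_state (cstar_gen G) phi.
Hypothesis gns : is_GNS (cstar_gen G) phi pi xi.

Lemma GNS_nsq S S' : cstar_gen G S -> adjoint_of S S' ->
  (nsq (pi S xi))%:C = phi (S' \o S).
Proof.
move=> AS SS'; have sA := star_alg_cstar_gen Ga.
have AS' := star_alg_adjoint sA AS SS'.
rewrite (GNS_state gns); last exact: (star_alg_comp sA).
rewrite (GNS_comp gns) //= -ipxx.
by rewrite (GNS_adjoint gns AS' (adjoint_sym SS')).
Qed.

(** States of a C*-algebra are norm bounded, so the polynomials in the
    generators already have a dense orbit. *)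
Lemma GNS_dense (x : H) (e : R) : 0 < e ->
  exists2 S, star_gen G S & hnorm (x - pi S xi) <= e.
Proof.
move=> e0; have sA := star_alg_cstar_gen Ga.
have e20 : 0 < e / 2 by rewrite divr_gt0.
have e40 : 0 < e / 4 by rewrite divr_gt0.
have [S AS hS] := GNS_cyclic gns x e20.
have [_ /(_ _ e40)[S0 gS0 hS0]] := cstar_gen_closure Ga AS.
exists S0 => //; rewrite -(subrKA (pi S xi)); apply: le_trans (hnormD _ _) _.
suff : hnorm (pi S xi - pi S0 xi) <= e / 2 by have := hS; lra.
have AS0 := star_gen_cstar gS0.
(* rescaled to have norm at most 1/2, as [state_le1] requires *)
pose D := (2 / e)%:C \*: ((-1) \*: S0 \+ S).
have AD1 : cstar_gen G ((-1) \*: S0 \+ S) by exact: (star_alg_linear sA).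
have A0 : cstar_gen G (fun=> 0).
  have := star_alg_linear sA (-1) AS AS; congr (cstar_gen G).
  by apply/funext => y /=; rewrite scaleN1r addNr.
have DE : D = (2 / e)%:C \*: ((-1) \*: S0 \+ S) \+ (fun=> 0).
  by apply/funext => y /=; rewrite addr0.
have AD : cstar_gen G D by rewrite DE; exact: (star_alg_linear sA).
have piD : pi D xi = (2 / e)%:C *: (pi S xi - pi S0 xi).
  have pi0 : pi (fun=> 0) = fun=> 0.
    have -> : (fun=> 0) = (-1) \*: S \+ S.
      by apply/funext => y /=; rewrite scaleN1r addNr.
    by rewrite (GNS_linear gns) //; apply/funext => y /=; rewrite scaleN1r addNr.
  rewrite DE (GNS_linear gns) // pi0 (GNS_linear gns) //= addr0.
  by rewrite scaleN1r addrC.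
have [D' AD' DD'] := cstar_gen_adjoint Ga AD.
have hD y : hnorm (D y) <= 2^-1 * hnorm y.
  rewrite /D /= hnormZ scaleN1r addrC.
  have -> : cabs ((2 / e)%:C : R[i]) = 2 / e.
    by rewrite /cabs /sqn /= expr0n addr0 sqrtr_sqr ger0_norm // divr_ge0 // ltW.
  apply: le_trans (ler_wpM2l _ (hS0 y)) _; first by rewrite divr_ge0 // ltW.
  rewrite le_eqVlt; apply/orP; left; apply/eqP; field.
  by rewrite gt_eqF.
have := state_le1 sA (@norm_closed_cstar_gen _ _ G) sphi AD DD' hD.
rewrite -(GNS_nsq AD DD') piD nsqZ lecR.
have -> : sqn ((2 / e)%:C : R[i]) = (2 / e) ^+ 2 by rewrite /sqn /= expr0n addr0.
rewrite -hnormE -exprMn => h.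
have : 2 / e * hnorm (pi S xi - pi S0 xi) <= 1.
  rewrite -ler_sqr ?nnegrE ?mulr_ge0 ?hnorm_ge0 ?invr_ge0 ?(ltW e0) //.
  by rewrite expr1n.
rewrite mulrC mulrA ler_pdivrMr // mul1r; lra.
Qed.
End GNSDensity.

(** * Generalized limits of bounded sequences *)

Section GeneralizedLimit.
Context {R : realType}.
Implicit Types (z : nat -> R[i]).

Definition bounded_seq z : Prop := exists k : R, forall n, cabs (z n) <= k.

Lemma ultra_real_cvg (G : set_system nat) (x : nat -> R) (k : R) :
  UltraFilter G -> (forall n, `|x n| <= k) -> cvg (x @ G).
Proof.
move=> UG xk; have PG : ProperFilter G by exact: ultra_proper.
have PF : ProperFilter (x @ G) by exact: fmap_proper_filter.
have [p [_ cl]] : `[- k, k]%classic `&` cluster (x @ G) !=set0.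
  apply: (@segment_compact R (- k) k) => //=.
  apply: (@filterS _ _ _ setT); last exact: filterT.
  by move=> n _ /=; rewrite in_itv /= -ler_norml.
apply/cvg_ex; exists p => V Vp.
have [//|nV] := in_ultra_setVsetC (x @^-1` V) UG.
have := cl (~` V) V nV Vp; by case=> y [].
Qed.

(** Ultrafilter limits supply a state on bounded sequences that extends the
    limit; it will average an operator over basis vectors escaping to infinity. *)
Lemma generalized_limit : exists L : (nat -> R[i]) -> R[i],
  [/\ forall c z z', bounded_seq z -> bounded_seq z' ->
        L (fun n => c * z n + z' n) = c * L z + L z',
      forall z, bounded_seq z -> (forall n, 0 <= z n) -> 0 <= L z
    & forall z c, (exists N, forall n, (N <= n)%N -> z n = c) -> L z = c].
Proof.
have [G [UG oG]] := ultraFilterLemma (@eventually_filter).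
have PG : ProperFilter G by exact: ultra_proper.
pose re z n := complex.Re (z n : R[i]).
pose im z n := complex.Im (z n : R[i]).
pose L z : R[i] := lim (re z @ G) +i* lim (im z @ G).
have cRe z : bounded_seq z -> cvg (re z @ G).
  move=> [k zk]; apply: (@ultra_real_cvg _ _ k) => // n /=; apply: le_trans (zk n).
  by rewrite -sqrtr_sqr ler_wsqrtr // /sqn lerDl sqr_ge0.
have cIm z : bounded_seq z -> cvg (im z @ G).
  move=> [k zk]; apply: (@ultra_real_cvg _ _ k) => // n /=; apply: le_trans (zk n).
  by rewrite -sqrtr_sqr ler_wsqrtr // /sqn lerDr sqr_ge0.
have lE (x : nat -> R) l : x @ G --> l -> lim (x @ G) = l by move/cvg_lim; apply.
exists L; split.
- move=> [a b] z z' bz bz'.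
  have [r r'] := (cRe _ bz, cRe _ bz'); have [i i'] := (cIm _ bz, cIm _ bz').
  rewrite /L; apply/eqP; rewrite eq_complex /=; apply/andP; split; apply/eqP.
    have -> : re (fun n => (a +i* b) * z n + z' n) =
       (fun n => a * re z n - b * im z n + re z' n).
      by apply/funext => n; rewrite /re /im; case: (z n) (z' n) => [? ?] [? ?] /=; ring.
    by apply: lE; apply: cvgD r'; apply: cvgB; apply: cvgM => //; exact: cvg_cst.
  have -> : im (fun n => (a +i* b) * z n + z' n) =
     (fun n => a * im z n + b * re z n + im z' n).
    by apply/funext => n; rewrite /re /im; case: (z n) (z' n) => [? ?] [? ?] /=; ring.
  by apply: lE; apply: cvgD i'; apply: cvgD; apply: cvgM => //; exact: cvg_cst.
- move=> z bz z0; rewrite /L.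
  have zE n : 0 <= complex.Re (z n) /\ complex.Im (z n) = 0.
    by have := z0 n; case: (z n) => a b; rewrite lecE /= => /andP[/eqP -> ->].
  rewrite lecE /=; apply/andP; split.
    apply/eqP/lE; rewrite (_ : im z = cst 0); first exact: cvg_cst.
    by apply/funext => n; exact: (zE n).2.
  apply: limr_ge; first exact: cRe.
  by apply: nearW => n; exact: (zE n).1.
- move=> z c [N hN]; rewrite /L; case: c hN => a b hN.
  have GN : G [set n | (N <= n)%N] by apply: oG; exists N.
  congr (_ +i* _); apply: lE.
    apply: (@cvg_trans _ ((cst a : nat -> R) @ G)); last exact: cvg_cst.
    by apply: near_eq_cvg; apply: filterS GN => n /= Nn; rewrite /re /im hN.
  apply: (@cvg_trans _ ((cst b : nat -> R) @ G)); last exact: cvg_cst.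
  by apply: near_eq_cvg; apply: filterS GN => n /= Nn; rewrite /re /im hN.
Qed.
End GeneralizedLimit.

(** * Monomials as partial bijections of the canonical basis *)

Section PartialMaps.
Context {R : realType}.
Local Notation F := (fock R).
Implicit Types (X Y Z : F -> F) (P Q : mono_index -> mono_index -> Prop).
Implicit Types (s t r : mono_index) (i j k : int) (u v : seq int).

Lemma annih_adjointable : range (@annih R) `<=` adjointable.
Proof.
move=> _ [i _ <-]; split; first exact: annih_bounded.
by exists (create i); apply: adjoint_sym; exact: annih_adjoint.
Qed.

Lemma star_alg_M0 : star_alg (monotone_alg0 R).
Proof. exact: star_alg_star_gen annih_adjointable. Qed.

Lemma star_alg_M : star_alg (monotone_alg R).
Proof. exact: star_alg_cstar_gen annih_adjointable. Qed.

Lemma M0_sub_M X : monotone_alg0 R X -> monotone_alg R X.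
Proof. exact: star_gen_cstar. Qed.

Lemma M0_annih i : monotone_alg0 R (annih i).
Proof. by move=> A [_]; apply; exists i. Qed.

Lemma M0_create i : monotone_alg0 R (create i).
Proof.
apply: (star_alg_adjoint star_alg_M0 (M0_annih i)).
by apply: adjoint_sym; exact: annih_adjoint.
Qed.

(** [X] sends the basis vector of [t] to the one of [s] when [P s t], and to [0]
    when no such [s] exists: it is a partial bijection of the canonical basis.
    Identities between monomials thereby become identities between relations
    on increasing sequences. *)
Definition acts X P : Prop :=
  exists h : mono_index -> option mono_index,
    (forall f s, sval (X f) s = oapp (sval f) 0 (h s)) /\
    (forall s t, h s = Some t <-> P s t).

Lemma acts_iff X P Q : (forall s t, P s t <-> Q s t) -> acts X P -> acts X Q.
Proof. by move=> PQ [h [hX hP]]; exists h; split=> // s t; rewrite hP PQ. Qed.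

Lemma option_ext (T : Type) (a b : option T) :
  (forall x : T, a = Some x <-> b = Some x) -> a = b.
Proof.
case: a b => [a|] [b|] // h; first by apply/esym/(h a).1.
  by have /(_ erefl) := (h a).1.
by have /(_ erefl) := (h b).2.
Qed.

Lemma acts_inj X Y P : acts X P -> acts Y P -> X = Y.
Proof.
move=> [h [hX hP]] [g [gY gP]]; apply/funext => f; apply/val_inj/funext => s.
rewrite /= hX gY; congr oapp; apply: option_ext => t.
by rewrite hP gP.
Qed.

Lemma acts_zero P : (forall s t, ~ P s t) -> acts (fun=> 0 : F) P.
Proof.
by move=> nP; exists (fun=> None); split=> // s t; split=> // /nP.
Qed.

Lemma acts_id : acts id (fun s t => s = t).
Proof. by exists Some; split=> // s t; split=> [[]|->]. Qed.

Lemma acts_create i : acts (create i) (fun s t => val s = i :: val t).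
Proof. by exists (pop i); split=> // s t; rewrite popP. Qed.

Lemma acts_annih i : acts (annih i) (fun s t => val t = i :: val s).
Proof. by exists (push i); split=> // s t; rewrite pushP. Qed.

Lemma acts_comp X Y P Q : acts X P -> acts Y Q ->
  acts (X \o Y) (fun s t => exists r, P s r /\ Q r t).
Proof.
move=> [h [hX hP]] [g [gY gQ]]; exists (fun s => obind g (h s)); split.
  by move=> f s /=; rewrite hX; case: (h s) => //= r; rewrite gY.
move=> s t; case hs : (h s) => [r|] /=.
  rewrite gQ; split; first by move=> Qrt; exists r; rewrite -hP.
  by move=> [r' [/hP]]; rewrite hs => -[<-].
by split=> // -[r [/hP]]; rewrite hs.
Qed.

Lemma acts_add X Y Z P Q Q' : acts X P -> acts Y Q -> acts Z Q' ->
  (forall s t, P s t <-> Q s t \/ Q' s t) ->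
  (forall s t t', Q s t -> Q' s t' -> False) -> X = Y \+ Z.
Proof.
move=> [h [hX hP]] [g [gY gQ]] [g' [gZ gQ']] PQ QQ.
apply/funext => f; apply/val_inj/funext => s /=.
rewrite hX; transitivity (sval (Y f) s + sval (Z f) s); last by [].
rewrite gY gZ; case es : (g s) => [t|]; case es' : (g' s) => [t'|] /=.
- by exfalso; apply: (QQ s t t'); [rewrite -gQ|rewrite -gQ'].
- rewrite addr0; have -> // : h s = Some t by apply/hP/PQ; left; apply/gQ.
- rewrite add0r; have -> // : h s = Some t' by apply/hP/PQ; right; apply/gQ'.
- rewrite addr0; case hs : (h s) => [t|] //.
  by have /PQ[/gQ|/gQ'] := (hP s t).1 hs; rewrite ?es ?es'.
Qed.

Definition create_seq u : F -> F := op_prod [seq create i | i <- u].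
Definition annih_seq v : F -> F := op_prod [seq annih j | j <- rev v].

(** The monomial sending [e_(v ++ r)] to [e_(u ++ r)] *)
Definition word u v : F -> F := create_seq u \o annih_seq v.

(** The projection onto the sequences all of whose entries exceed [k] *)
Definition above k : F -> F := annih k \o create k.

(** The restriction of [word u v] to the tails [r] whose entries exceed [k] *)
Definition cut_word u v k : F -> F := create_seq u \o above k \o annih_seq v.

Lemma op_prod_rcons (l : seq (F -> F)) Z : op_prod (rcons l Z) = op_prod l \o Z.
Proof. by elim: l => //= A l ->. Qed.

Lemma annih_seq_cons j v : annih_seq (j :: v) = annih_seq v \o annih j.
Proof. by rewrite /annih_seq rev_cons map_rcons op_prod_rcons. Qed.

Lemma mono_tail u v s : val s = u ++ v -> sorted <%R v.
Proof. by move=> e; have := valP s; rewrite e => /cat_sorted2[]. Qed.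

Lemma acts_create_seq u : acts (create_seq u) (fun s t => val s = u ++ val t).
Proof.
elim: u => [|i u IH].
  by apply: acts_iff acts_id => s t; split=> [->//|]; exact: val_inj.
apply: acts_iff (acts_comp (acts_create i) IH) => s t; split.
  by move=> [r [-> ->]].
move=> e; have h : sorted <%R (u ++ val t).
  by apply: (@mono_tail [:: i] _ s); rewrite e.
by exists (Sub (u ++ val t) h).
Qed.

Lemma acts_annih_seq v : acts (annih_seq v) (fun s t => val t = v ++ val s).
Proof.
elim: v => [|j v IH].
  by apply: acts_iff acts_id => s t; split=> [->//|/val_inj].
rewrite annih_seq_cons.
apply: acts_iff (acts_comp IH (acts_annih j)) => s t; split.
  by move=> [r [-> ->]].
move=> e; have h : sorted <%R (v ++ val s).
  by apply: (@mono_tail [:: j] _ t); rewrite e.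
by exists (Sub (v ++ val s) h).
Qed.

Lemma acts_word u v :
  acts (word u v) (fun s t => exists r : seq int, val s = u ++ r /\ val t = v ++ r).
Proof.
apply: acts_iff (acts_comp (acts_create_seq u) (acts_annih_seq v)) => s t; split.
  by move=> [r [-> ->]]; exists (val r).
by move=> [r [sr tr]]; exists (Sub r (mono_tail sr)).
Qed.

Lemma acts_above k : acts (above k) (fun s t => s = t /\ sorted <%R (k :: val s)).
Proof.
apply: acts_iff (acts_comp (acts_annih k) (acts_create k)) => s t; split.
  move=> [r [rs rt]]; split; last by rewrite -rs; exact: valP.
  by apply/val_inj; move: rt; rewrite rs => -[].
by move=> [<- h]; exists (Sub (k :: val s) h).
Qed.

Lemma acts_cut_word u v k : acts (cut_word u v k)
  (fun s t => exists r : seq int, [/\ val s = u ++ r, val t = v ++ r & sorted <%R (k :: r)]).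
Proof.
apply: acts_iff (acts_comp (acts_comp (acts_create_seq u) (acts_above k))
  (acts_annih_seq v)) => s t; split.
  by move=> [_ [[r [-> [<- kr]]] ->]]; exists (val r).
move=> [r [sr tr kr]]; exists (Sub r (mono_tail sr)); split=> //.
by exists (Sub r (mono_tail sr)).
Qed.

Lemma word_cons i u v : create i \o word u v = word (i :: u) v.
Proof. by []. Qed.

Lemma sorted_cons2 i j u :
  sorted <%R [:: i, j & u] = (i < j) && sorted <%R (j :: u).
Proof. by []. Qed.

Lemma sorted_pred k u : sorted <%R u ->
  sorted <%R (k :: u) -> sorted <%R (k + 1 :: u) \/ exists r : seq int, u = k + 1 :: r.
Proof.
case: u => [|j u]; first by left.
rewrite !sorted_cons2 => -> /andP[kj _]; rewrite andbT.
have [->|nj] := eqVneq j (k + 1); first by right; exists u.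
by left; move: kj nj; lia.
Qed.

(** A tail with entries above [k] either begins with [k + 1] or stays above it. *)
Lemma cut_word_step u v k :
  cut_word u v k = cut_word u v (k + 1) \+ word (rcons u (k + 1)) (rcons v (k + 1)).
Proof.
apply: acts_add (acts_cut_word u v k) (acts_cut_word u v (k + 1)) (acts_word _ _) _ _.
- move=> s t; split.
    move=> [r [sr tr kr]]; have rs : sorted <%R r := mono_tail sr.
    have [h|[r' e]] := sorted_pred rs kr; [by left; exists r|right].
    by exists r'; rewrite !cat_rcons -e.
  move=> [[r [sr tr kr]]|[r [sr tr]]].
    exists r; split=> //; case: r kr {sr tr} => // j r.
    by rewrite !sorted_cons2 => /andP[kj ->]; rewrite andbT; move: kj; lia.
  exists (k + 1 :: r); rewrite sr tr !cat_rcons; split=> //.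
  have : sorted <%R (k + 1 :: r) by apply: (@mono_tail u _ s); rewrite sr cat_rcons.
  by rewrite sorted_cons2 => ->; rewrite ltrDl.
- move=> s t t' [r [sr _ kr]] [r' [sr' _]].
  have e : r = k + 1 :: r'.
    by move: sr; rewrite sr' cat_rcons => /eqP; rewrite eqseq_cat // eqxx => /eqP.
  by move: kr; rewrite e sorted_cons2 ltxx.
Qed.

(** A tail following an entry [i] automatically exceeds it, so a cut at or below
    [i] is no restriction. *)
Lemma cut_word_low u v k i : (i \in u) || (i \in v) -> k <= i ->
  cut_word u v k = word u v.
Proof.
move=> iuv ki; apply: acts_inj (acts_word u v).
apply: acts_iff (acts_cut_word u v k) => s t; split.
  by move=> [r [sr tr _]]; exists r.
move=> [r [sr tr]]; exists r; split=> //.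
case: r sr tr => // j r sr tr; rewrite sorted_cons2.
rewrite (mono_tail sr) andbT.
apply: le_lt_trans ki _.
have aux w (s' : mono_index) : i \in w -> val s' = w ++ j :: r -> i < j.
  move=> iw e; have := valP s'; rewrite e /= (sorted_pairwise lt_trans).
  rewrite pairwise_cat => /andP[/allrelP h _].
  by apply: h => //; rewrite inE eqxx.
by case/orP: iuv => iw; [apply: aux iw sr|apply: aux iw tr].
Qed.

Lemma annih_word_nil i v : annih i \o word [::] v = word [::] (rcons v i).
Proof.
apply: acts_inj (acts_word _ _).
apply: acts_iff (acts_comp (acts_annih i) (acts_word [::] v)) => s t; split.
  by move=> [q [qs [r [/= qr tr]]]]; exists (val s); rewrite tr -qr qs cat_rcons.
move=> [r [/= sr tr]]; rewrite cat_rcons in tr.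
by exists (Sub (i :: r) (mono_tail tr)) => /=; rewrite -sr; split=> //; exists (i :: r); rewrite sr.
Qed.

Lemma annih_word_neq i j u v : i != j -> annih i \o word (j :: u) v = fun=> 0.
Proof.
move=> ij; apply: acts_inj (acts_comp (acts_annih i) (acts_word (j :: u) v)) _.
apply: acts_zero => s t [q [qs [r [qr _]]]].
by move: qr; rewrite qs => -[/eqP]; rewrite (negPf ij).
Qed.

Lemma annih_word_lt i j u v : i < j ->
  annih i \o word [:: i, j & u] v = word (j :: u) v.
Proof.
move=> ij; rewrite -(@cut_word_low [:: j & u] v i j) ?inE ?eqxx //; last exact: ltW.
apply: acts_inj (acts_cut_word _ _ _).
apply: acts_iff (acts_comp (acts_annih i) (acts_word [:: i, j & u] v)) => s t; split.
  move=> [q [qs [r [/= qr tr]]]]; exists r; split=> //.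
    by move: qr; rewrite qs => -[].
  case: r qr tr => // k r qr tr.
  change (sorted <%R [:: i, k & r]).
  rewrite sorted_cons2 (@mono_tail [:: i, j & u] _ q) // andbT.
  have := valP q; rewrite /= qr /= (path_sortedE lt_trans).
  move=> /and3P[_ /allP h _]; apply: lt_trans ij _.
  by apply: h; rewrite mem_cat inE eqxx orbT.
move=> [r [sr tr ir]].
have h : sorted <%R (i :: val s) by rewrite sr cat_cons sorted_cons2 ij -cat_cons -sr; exact: valP.
by exists (Sub (i :: val s) h); split=> //; exists r; rewrite /= sr.
Qed.

Lemma annih_word_ge i j u v : j <= i ->
  annih i \o word [:: i, j & u] v = fun=> 0.
Proof.
move=> ji; apply: acts_inj (acts_comp (acts_annih i) (acts_word [:: i, j & u] v)) _.
apply: acts_zero => s t [q [qs [r [qr _]]]].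
by have := valP q; rewrite qr /= ltNge ji.
Qed.

Lemma annih_above_lt i k : k < i -> annih i \o above k = annih i.
Proof.
move=> ki; apply: acts_inj (acts_annih i).
apply: acts_iff (acts_comp (acts_annih i) (acts_above k)) => s t; split.
  by move=> [r [rs [<- _]]].
by move=> ts; exists t; rewrite ts sorted_cons2 ki -ts; split=> //; split=> //; exact: valP.
Qed.

Lemma annih_above_ge i k : i <= k -> annih i \o above k = fun=> 0.
Proof.
move=> ik; apply: acts_inj (acts_comp (acts_annih i) (acts_above k)) _.
apply: acts_zero => s t [r [rs [_]]].
by rewrite rs sorted_cons2 ltNge ik.
Qed.

(** The nested projections [above k] decrease at [i] by the projection onto the
    sequences beginning with [i]; this identity drives the whole argument. *)
Lemma above_pred i : above (i - 1) = above i \+ (create i \o annih i).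
Proof.
have := cut_word_step [::] [::] (i - 1).
by rewrite subrK.
Qed.

Lemma create_above_le i k : k <= i -> create i \o above k = create i.
Proof.
move=> ki; apply: acts_inj (acts_create i).
apply: acts_iff (acts_comp (acts_create i) (acts_above k)) => s t; split.
  by move=> [r [rs [<- _]]].
move=> st; exists t; split=> //; split=> //.
have := valP s; rewrite st /=; case: (val t) => // j u /=.
by move=> /andP[ij ->]; rewrite (le_lt_trans ki).
Qed.

Lemma annih_create_neq i j : i != j -> annih i \o create j = fun=> (0 : F).
Proof. exact: (@annih_word_neq i j [::] [::]). Qed.

Lemma create_create_ge i j : j <= i -> create i \o create j = fun=> (0 : F).
Proof.
move=> ji; apply: acts_inj (acts_comp (acts_create i) (acts_create j)) _.
apply: acts_zero => s t [r [rs rt]].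
by have := valP s; rewrite rs rt /= ltNge ji.
Qed.

Lemma above_create_lt k j : k < j -> above k \o create j = create j.
Proof.
move=> kj; apply: acts_inj (acts_create j).
apply: acts_iff (acts_comp (acts_above k) (acts_create j)) => s t; split.
  by move=> [r [[<- _]]].
move=> st; exists s; split=> //; split=> //.
by rewrite st sorted_cons2 kj -st; exact: valP.
Qed.

Lemma above_above j k : j <= k -> above j \o above k = above k.
Proof.
move=> jk; apply: acts_inj (acts_above k).
apply: acts_iff (acts_comp (acts_above j) (acts_above k)) => s t; split.
  by move=> [r [[<- _]]].
move=> [<- ks]; exists s; split=> //; split=> //.
by case: (val s) ks => // i u; rewrite !sorted_cons2 => /andP[ki ->]; rewrite (le_lt_trans jk).
Qed.

Lemma adjoint_above k : adjoint_of (above k) (above k).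
Proof.
apply: adjoint_comp; last exact: annih_adjoint.
by apply: adjoint_sym; exact: annih_adjoint.
Qed.

Lemma M0_above k : monotone_alg0 R (above k).
Proof. exact: (star_alg_comp star_alg_M0 (M0_annih k) (M0_create k)). Qed.

End PartialMaps.

(** * The monomial basis and the maps [T_sigma] *)

Section HamelBasis.
Context {R : realType}.
Local Notation F := (fock R).
Local Notation label := ({fset int} * {fset int})%type.
Implicit Types (X Y Z : F -> F) (s t r : mono_index) (i j k : int) (u v : seq int).
Implicit Types (l : {fset int}) (p q : label) (L : seq (R[i] * label)).

Lemma incr_sorted l : sorted <%R (incr_seq l).
Proof. by rewrite lt_sorted_uniq_le sort_uniq fset_uniq sort_le_sorted. Qed.

Lemma mem_incr l i : (i \in incr_seq l) = (i \in l).
Proof. by rewrite mem_sort. Qed.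

Lemma incr_inj : injective incr_seq.
Proof. by move=> l l' e; apply/fsetP => i; rewrite -!mem_incr e. Qed.

Lemma incr_fset u : sorted <%R u -> incr_seq [fset i in u]%fset = u.
Proof.
move=> su; apply: lt_sorted_eq => //; first exact: incr_sorted.
by move=> i; rewrite mem_incr inE.
Qed.

Lemma incr_fset1 i : incr_seq [fset i]%fset = [:: i].
Proof.
rewrite -[RHS](@incr_fset [:: i]) //; congr incr_seq.
by apply/fsetP => j; rewrite in_fset1 in_fset /= inE.
Qed.

Definition mono p : F -> F := mono_word p.1 p.2.

(** The labels of the exceptional basis elements [a_i a_i^*] *)
Definition diag1 p : bool := (p.1 == p.2) && (size (incr_seq p.1) == 1%N).

Lemma mono_above i : mono ([fset i], [fset i])%fset = above i.
Proof. by rewrite /mono /mono_word incr_fset1 eqxx. Qed.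

Lemma mono_diag1 p : diag1 p ->
  exists i, p = ([fset i], [fset i])%fset.
Proof.
case: p => l l' /andP[/eqP /= <-]; case e : (incr_seq l) => [|i [|]] // _.
by exists i; congr pair; apply: incr_inj; rewrite e incr_fset1.
Qed.

Lemma diag1_fset1 i : diag1 ([fset i], [fset i])%fset.
Proof. by rewrite /diag1 /= eqxx incr_fset1. Qed.

Lemma mono_offdiag p : ~~ diag1 p -> mono p = word (incr_seq p.1) (incr_seq p.2).
Proof.
case: p => l l'; rewrite /diag1 /mono /mono_word /=.
by case: (incr_seq l) => [|i [|j u]] //=; rewrite andbT => /negPf ->.
Qed.

(** Formal linear combinations of labels, evaluated through an arbitrary
    assignment [tau] so that [mono] can be replaced by another one. *)
Fixpoint lincomb (tau : label -> F -> F) L : F -> F :=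
  if L is cp :: L' then cp.1 \*: tau cp.2 \+ lincomb tau L' else fun=> 0.

Lemma lincomb_cat tau L L' : lincomb tau (L ++ L') = lincomb tau L \+ lincomb tau L'.
Proof.
apply/funext => f; elim: L => [|cp L IH] /=; first by rewrite add0r.
by rewrite -addrA; congr (_ + _); exact: IH.
Qed.

Lemma lincomb_scale tau c L :
  lincomb tau [seq (c * cp.1, cp.2) | cp <- L] = fun f => c *: lincomb tau L f.
Proof.
apply/funext => f; elim: L => [|cp L IH] /=; first by rewrite scaler0.
by rewrite scalerDr scalerA; congr (_ + _); exact: IH.
Qed.

Definition mono_span X : Prop := exists L, X = lincomb mono L.

Lemma span_mono p : mono_span (mono p).
Proof. by exists [:: (1, p)]; apply/funext => f /=; rewrite scale1r addr0. Qed.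

Lemma span_zero : mono_span (fun=> 0).
Proof. by exists [::]. Qed.

Lemma span_lin c X Y : mono_span X -> mono_span Y -> mono_span (c \*: X \+ Y).
Proof.
move=> [L ->] [L' ->]; exists ([seq (c * cp.1, cp.2) | cp <- L] ++ L').
by rewrite lincomb_cat lincomb_scale.
Qed.

Lemma span_addK X Y Z : X = Y \+ Z -> mono_span X -> mono_span Z -> mono_span Y.
Proof.
move=> e sX sZ; have := span_lin (-1) sZ sX; congr mono_span.
by apply/funext => f /=; rewrite e /= scaleN1r addrC addrK.
Qed.

Lemma span_above i : mono_span (above i).
Proof. by rewrite -mono_above; exact: span_mono. Qed.

Lemma word_unsorted u v : ~~ (sorted <%R u && sorted <%R v) -> word u v = fun=> (0 : F).
Proof.
move=> h; apply: acts_inj (acts_word u v) _; apply: acts_zero => s t [r [sr tr]].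
move: h; rewrite negb_and => /orP[|]/negP; apply.
  by have := valP s; rewrite /= sr => /cat_sorted2[].
by have := valP t; rewrite /= tr => /cat_sorted2[].
Qed.

Lemma span_word u v : mono_span (word u v).
Proof.
have [/andP[su sv]|/word_unsorted ->] := boolP (sorted <%R u && sorted <%R v);
  last exact: span_zero.
pose p : label := ([fset i in u], [fset i in v])%fset.
have [|np] := boolP (diag1 p); last first.
  by have := span_mono p; rewrite mono_offdiag // !incr_fset.
rewrite /diag1 /= incr_fset // => /andP[/eqP /(congr1 incr_seq)].
rewrite !incr_fset // => <-; case: u {su p} => [|i [|]] // _.
apply: (@span_addK (above (i - 1)) _ (above i)); try exact: span_above.
by rewrite above_pred; apply/funext => f /=; rewrite addrC.
Qed.

(** Raising the cut by one splits off an uncut monomial, and low cuts do not cut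
    at all; an induction on the cut connects the two. *)
Lemma span_cut_word u v k : mono_span (cut_word u v k).
Proof.
have [|] := boolP (u ++ v == [::]).
  case: u => [|//]; case: v => [|//] _; exact: span_above.
rewrite -size_eq0 => uv0.
have [m muv] : exists m, (m \in u) || (m \in v).
  case: u uv0 => [|i u] /=; last by exists i; rewrite inE eqxx.
  by case: v => [|i v] //=; exists i; rewrite inE eqxx.
have [km|/ltW mk] := leP k m; first by rewrite (cut_word_low muv km); exact: span_word.
have [n ->] : exists n : nat, k = m + n%:Z by exists `|k - m|%N; lia.
elim: n => [|n IH]; first by rewrite addr0 (cut_word_low muv) //; exact: span_word.
have := cut_word_step (R := R) u v (m + n%:Z).
have -> : m + n.+1%:Z = m + n%:Z + 1 by lia.
by move=> e; apply: (span_addK e IH); exact: span_word.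
Qed.

Lemma span_create_mono i p : mono_span (create i \o mono p).
Proof.
have [/mono_diag1[k ->]|/mono_offdiag ->] := boolP (diag1 p).
  by rewrite mono_above; exact: (span_cut_word [:: i] [::] k).
by rewrite word_cons; exact: span_word.
Qed.

Lemma span_annih_mono i p : mono_span (annih i \o mono p).
Proof.
have [/mono_diag1[k ->]|/mono_offdiag ->] := boolP (diag1 p).
  rewrite mono_above; have [ki|ik] := ltP k i.
    by rewrite annih_above_lt //; exact: (span_word [::] [:: i]).
  by rewrite annih_above_ge //; exact: span_zero.
case: (incr_seq p.1) => [|j u]; first by rewrite annih_word_nil; exact: span_word.
have [<-|ij] := eqVneq i j; last by rewrite annih_word_neq //; exact: span_zero.
case: u => [|j' u]; first exact: (span_cut_word [::] _ i).
have [ij|ji] := ltP i j'; first by rewrite annih_word_lt //; exact: span_word.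
by rewrite annih_word_ge //; exact: span_zero.
Qed.

Definition span_stable Z : Prop :=
  linear Z /\ forall Y, mono_span Y -> mono_span (Z \o Y).

Lemma span_stable_gen Z : linear Z -> (forall p, mono_span (Z \o mono p)) ->
  span_stable Z.
Proof.
move=> lZ hZ; split=> // _ [L ->]; elim: L => [|cp L IH].
  by have := span_zero; congr mono_span; apply/funext => f /=; rewrite linmap0.
have := span_lin cp.1 (hZ cp.2) IH; congr mono_span.
by apply/funext => f /=; rewrite lZ.
Qed.

Lemma span_stable_comp Z Z' : span_stable Z -> span_stable Z' ->
  span_stable (Z \o Z').
Proof.
move=> [lZ hZ] [lZ' hZ']; split; first by move=> c x y /=; rewrite lZ' lZ.
by move=> Y /hZ' /hZ.
Qed.

Lemma span_stable_create i : span_stable (create i).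
Proof. by apply: span_stable_gen (@span_create_mono i); have [] := @create_bounded R i. Qed.

Lemma span_stable_annih i : span_stable (annih i).
Proof. by apply: span_stable_gen (@span_annih_mono i); have [] := @annih_bounded R i. Qed.

Lemma op_prod_ind (P : (F -> F) -> Prop) (a : int -> F -> F) :
  P id -> (forall X Y, P X -> P Y -> P (X \o Y)) -> (forall i, P (a i)) ->
  forall u, P (op_prod [seq a i | i <- u]).
Proof. by move=> P1 PM Pa; elim=> //= i u IH; apply: (PM _ _ (Pa i)). Qed.

Lemma mono_ind (P : (F -> F) -> Prop) :
  P id -> (forall X Y, P X -> P Y -> P (X \o Y)) ->
  (forall i, P (create i)) -> (forall i, P (annih i)) -> forall p, P (mono p).
Proof.
move=> P1 PM Pc Pa p.
have [/mono_diag1[k ->]|/mono_offdiag ->] := boolP (diag1 p).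
  by rewrite mono_above; apply: (PM _ _ (Pa k) (Pc k)).
by apply: (PM); apply: op_prod_ind.
Qed.

Lemma span_stable_mono p : span_stable (mono p).
Proof.
apply: mono_ind; [by []|exact: span_stable_comp|exact: span_stable_create|].
exact: span_stable_annih.
Qed.

Lemma op_prod_adjoint (a a' : int -> F -> F) u :
  (forall i, adjoint_of (a i) (a' i)) ->
  adjoint_of (op_prod [seq a i | i <- u]) (op_prod [seq a' i | i <- rev u]).
Proof.
move=> h; elim: u => [|i u IH] //=.
rewrite rev_cons map_rcons op_prod_rcons; exact: adjoint_comp.
Qed.

Lemma adjoint_word u v : adjoint_of (word u v : F -> F) (word v u).
Proof.
apply: adjoint_comp.
  by apply: op_prod_adjoint => i; exact: annih_adjoint.
rewrite -[X in create_seq X](revK v); apply: op_prod_adjoint => i.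
by apply: adjoint_sym; exact: annih_adjoint.
Qed.

Lemma adjoint_mono p : adjoint_of (mono p) (mono (p.2, p.1)).
Proof.
have [/mono_diag1[k ->]|np] := boolP (diag1 p).
  by rewrite mono_above; exact: adjoint_above.
rewrite !mono_offdiag //; first exact: adjoint_word.
apply: contra np; rewrite /diag1 /= => /andP[/eqP -> ->].
by rewrite eqxx.
Qed.

Lemma M0_mono p : monotone_alg0 R (mono p).
Proof.
apply: mono_ind; last exact: M0_annih.
- exact: (star_alg_id star_alg_M0).
- exact: (star_alg_comp star_alg_M0).
- exact: M0_create.
Qed.

Lemma M0_zero : monotone_alg0 R (fun=> 0).
Proof.
have h := star_alg_id (@star_alg_M0 R).
have := star_alg_linear star_alg_M0 (-1) h h; congr (monotone_alg0 R).
by apply/funext => f /=; rewrite scaleN1r addNr.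
Qed.

Lemma M0_span X : mono_span X -> monotone_alg0 R X.
Proof.
move=> [L ->]; elim: L => [|cp L IH] /=; first exact: M0_zero.
by apply: (star_alg_linear star_alg_M0) => //; exact: M0_mono.
Qed.

Lemma span_adjoint X : mono_span X -> exists2 S, mono_span S & adjoint_of X S.
Proof.
move=> [L ->]; elim: L => [|cp L [S sS hS]] /=.
  by exists (fun=> 0); [exact: span_zero|move=> x y; rewrite (ip0l y) (ip0r x)].
exists (conjc cp.1 \*: mono (cp.2.2, cp.2.1) \+ S).
  by apply: span_lin => //; exact: span_mono.
by apply: adjoint_lin => //; exact: adjoint_mono.
Qed.

Lemma span_M0 X : monotone_alg0 R X -> mono_span X.
Proof.
apply; split; last first.
  by move=> _ [i _ <-]; exact: (span_word [::] [:: i]).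
split.
- by move=> Y /M0_span; exact: (star_alg_bounded star_alg_M0).
- exact: (span_word [::] [::]).
- exact: span_lin.
- move=> S T [L ->] sT; elim: L => [|cp L IH] /=; first exact: span_zero.
  by apply: span_lin => //; have [_] := span_stable_mono cp.2; apply.
- by move=> S T /span_adjoint[S' sS' SS'] ST; rewrite (adjoint_inj ST SS').
Qed.

(** Linear independence of the monomials is detected by matrix entries. *)
Definition entry X s t : R[i] := sval (X (Defs.basis t)) s.

Lemma entry_acts X P s t : acts X P -> P s t -> entry X s t = 1.
Proof.
by move=> [h [hX hP]] /hP hs; rewrite /entry hX hs /= eqxx.
Qed.

Lemma entry_acts0 X P s t : acts X P -> ~ P s t -> entry X s t = 0.
Proof.
move=> [h [hX hP]] nP; rewrite /entry hX; case hs : (h s) => [r|] //=.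
by case: eqP => // rt; case: nP; apply/hP; rewrite hs rt.
Qed.

Definition functional (kappa : (F -> F) -> R[i]) : Prop :=
  kappa (fun=> 0) = 0 /\
  forall c X Y, kappa (c \*: X \+ Y) = c * kappa X + kappa Y.

Lemma functional_entry s t : functional (fun X => entry X s t).
Proof. by split. Qed.

Lemma functional_sub (k1 k2 : (F -> F) -> R[i]) : functional k1 -> functional k2 ->
  functional (fun X => k1 X - k2 X).
Proof.
move=> [z1 h1] [z2 h2]; split; first by rewrite z1 z2 subrr.
by move=> c X Y; rewrite h1 h2; ring.
Qed.

Definition single i : mono_index := Sub [:: i] (erefl true).

Lemma entry_word_single u v k : entry (word u v) (single k) (single k) =
  (((u == [::]) && (v == [::])) || ((u == [:: k]) && (v == [:: k])))%:R.
Proof.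
have h := @acts_word R u v.
have [e|ne] := boolP (_ || _).
  apply: (entry_acts h); case/orP: e => /andP[/eqP -> /eqP ->].
    by exists [:: k].
  by exists [::].
apply: (entry_acts0 h) => -[r [/= ur vr]]; case/negP: ne.
case: u ur {h} => [|a u] /= ur.
  by rewrite -ur in vr *; case: v vr => [|b [|c v]].
case: ur => <-; case: u => // ; case: r vr => // vr _.
by rewrite -[v]cats0 -vr !eqxx /= ?orbT.
Qed.

Lemma entry_above_single i k :
  entry (above i) (single k) (single k) = (i < k)%R%:R.
Proof.
have h := @acts_above R i; have [ik|ki] := boolP (i < k).
  by apply: (entry_acts h); rewrite /= ik.
by apply: (entry_acts0 h) => -[_]; rewrite /= andbT (negPf ki).
Qed.

Definition sub_fset l : mono_index := Sub (incr_seq l) (incr_sorted l).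

(** Consecutive diagonal entries agree for all monomials except the projection
    [above i]: it kills [e_(i)] and fixes [e_(i + 1)]. *)
Lemma coef_diag1 i : exists2 kappa, functional kappa &
  forall q, kappa (mono q) = (q == ([fset i], [fset i])%fset)%:R.
Proof.
exists (fun X => entry X (single (i + 1)) (single (i + 1))
               - entry X (single i) (single i)).
  by apply: functional_sub; exact: functional_entry.
move=> q; have [/mono_diag1[k ->]|nq] := boolP (diag1 q).
  rewrite mono_above !entry_above_single xpair_eqE andbb.
  rewrite (inj_eq (@fset1_inj _)).
  by have [->|ki] := eqVneq k i; [rewrite ltrDl ltr01 ltxx subr0|
    rewrite (_ : (k < i + 1) = (k < i)) ?subrr //; lia].
rewrite mono_offdiag // !entry_word_single.
have -> : (q == ([fset i], [fset i])%fset) = false.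
  by apply/negP => /eqP e; rewrite e diag1_fset1 in nq.
have nd k : (incr_seq q.1 == [:: k]) && (incr_seq q.2 == [:: k]) = false.
  apply/negP => /andP[/eqP e1 /eqP e2]; case/negP: nq.
  by rewrite /diag1 -(inj_eq incr_inj) e1 e2 eqxx.
by rewrite !nd subrr.
Qed.

Lemma diag1_lower_bound (Q : seq label) :
  exists m, forall i, ([fset i], [fset i])%fset \in Q -> m <= i.
Proof.
elim: Q => [|q Q [m hm]]; first by exists 0.
have [/mono_diag1[k ->]|nq] := boolP (diag1 q).
  exists (Num.min m k) => i; rewrite inE xpair_eqE andbb (inj_eq (@fset1_inj _)).
  by rewrite ge_min => /orP[/eqP -> |/hm ->//]; rewrite lexx orbT.
exists m => i; rewrite inE => /orP[/eqP e|/hm//].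
by rewrite -e diag1_fset1 in nq.
Qed.

Lemma incr_fset0 : incr_seq fset0 = [::].
Proof. by rewrite -[RHS](@incr_fset [::]) //; congr incr_seq; apply/fsetP => i; rewrite !inE. Qed.

(** At [e_(m)] the projections [above i] with [m <= i] vanish, so that only the
    identity is seen. As the identity is the limit of these projections, no [m]
    serves all labels at once, and [Q] has to be finite. *)
Lemma coef_empty (Q : seq label) : exists2 kappa, functional kappa &
  {in Q, forall q, kappa (mono q) = (q == (fset0, fset0))%:R}.
Proof.
have [m hm] := diag1_lower_bound Q.
exists (fun X => entry X (single m) (single m)); first exact: functional_entry.
move=> q qQ; have [dq|nq] := boolP (diag1 q).
  have [i e] := mono_diag1 dq; rewrite e mono_above entry_above_single.
  rewrite e in qQ; rewrite ltNge (hm _ qQ) /=.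
  case: eqP => // -[] /(congr1 incr_seq).
  by rewrite incr_fset1 incr_fset0.
rewrite mono_offdiag // entry_word_single.
have -> : (incr_seq q.1 == [:: m]) && (incr_seq q.2 == [:: m]) = false.
  apply/negP => /andP[/eqP e1 /eqP e2]; case/negP: nq.
  by rewrite /diag1 -(inj_eq incr_inj) e1 e2 eqxx.
rewrite orbF -incr_fset0 !(inj_eq incr_inj).
by case: q {qQ nq}.
Qed.

Lemma entry_mono_nil q s t : ~~ diag1 q ->
  entry (mono q) s t =
  (`[< exists r : seq int, val s = incr_seq q.1 ++ r /\ val t = incr_seq q.2 ++ r >])%:R.
Proof.
move=> nq; rewrite mono_offdiag //.
have h := @acts_word R (incr_seq q.1) (incr_seq q.2).
case: asboolP => e; [exact: (entry_acts h)|exact: (entry_acts0 h)].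
Qed.

Lemma entry_above i s t : entry (above i) s t =
  ((s == t) && sorted <%R (i :: val s))%:R.
Proof.
have h := @acts_above R i; case: andP => [[/eqP e e']|e].
  exact: (entry_acts h).
by apply: (entry_acts0 h) => -[e1 e2]; apply: e; rewrite e1 eqxx -e1.
Qed.

(** The matrix entry of a label whose two sequences end with the same integer
    also sees all monomials obtained by dropping common final segments; the
    entry with that last integer removed sees exactly the same ones, except for
    the monomial of the label itself. *)
Lemma coef_offdiag p : ~~ diag1 p -> p != (fset0, fset0) ->
  exists2 kappa, functional kappa & forall q, kappa (mono q) = (q == p)%:R.
Proof.
move=> np p0.
have eq_p q : ~~ diag1 q -> incr_seq p.1 = incr_seq q.1 ->
    incr_seq p.2 = incr_seq q.2 -> q == p.
  by case: p q {np p0} => [l l'] [m m'] _ /= /incr_inj -> /incr_inj ->.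
have neq_p q : diag1 q -> (q == p) = false.
  by move=> dq; apply/negP => /eqP e; rewrite e (negPf np) in dq.
have [[u [v [k [e1 e2]]]]|nlast] := pselect (exists u v k,
    incr_seq p.1 = rcons u k /\ incr_seq p.2 = rcons v k).
  have su : sorted <%R u.
    by have := incr_sorted p.1; rewrite e1 -cats1 => /cat_sorted2[].
  have sv : sorted <%R v.
    by have := incr_sorted p.2; rewrite e2 -cats1 => /cat_sorted2[].
  exists (fun X => entry X (sub_fset p.1) (sub_fset p.2) -
                   entry X (Sub u su) (Sub v sv)).
    by apply: functional_sub; exact: functional_entry.
  move=> q; have [dq|nq] := boolP (diag1 q).
    rewrite neq_p //; have [i ->] := mono_diag1 dq.
    rewrite mono_above !entry_above -!val_eqE /=.
    rewrite e1 e2 eqseq_rcons eqxx andbT.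
    have [uv|uv] := eqVneq u v; last by rewrite subrr.
    have u0 : u <> [::].
      move=> u0; case/negP: np; rewrite /diag1 -(inj_eq incr_inj) e1 e2.
      by rewrite -uv u0 eqxx.
    have -> : path <%R i (rcons u k) = path <%R i u.
      have := incr_sorted p.1; rewrite e1; case: (u) u0 su => //= a w _ su.
      by move=> ->; rewrite su.
    by rewrite subrr.
  rewrite !entry_mono_nil //=.
  have [/eqP qp|qp] := boolP (q == p).
    rewrite qp; case: asboolP => h1; last by case: h1; exists [::]; rewrite !cats0.
    case: asboolP => h2; last by rewrite subr0.
    case: h2 => r [/(congr1 size)]; rewrite e1 size_cat size_rcons; lia.
  case: asboolP => h1; case: asboolP => h2; rewrite ?subrr //.
    case: h2; case: h1 => r; rewrite e1 e2; case/lastP: r => [|r a].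
      rewrite !cats0 -e1 -e2 => -[h1 h2].
      by rewrite eq_p in qp.
    rewrite -!rcons_cat => -[/rcons_inj[eu _] /rcons_inj[ev _]].
    by exists r; rewrite -eu -ev.
  case: h1; case: h2 => r [hu hv]; exists (rcons r k).
  by rewrite e1 e2 -!rcons_cat -hu -hv.
exists (fun X => entry X (sub_fset p.1) (sub_fset p.2)); first exact: functional_entry.
move=> q; have [dq|nq] := boolP (diag1 q).
  rewrite neq_p //; have [i ->] := mono_diag1 dq.
  rewrite mono_above !entry_above -!val_eqE /=.
  case: eqP => //= e; exfalso.
  case/lastP es : (incr_seq p.1) => [|w a]; last first.
    by apply: nlast; exists w, w, a; rewrite -e es.
  case/negP: p0; rewrite -[fset0](incr_inj (etrans es (esym incr_fset0))).
  by case: (p) e => l l' /= /incr_inj ->.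
rewrite entry_mono_nil //=; case: asboolP => [[r [h1 h2]]|h].
  case/lastP: r h1 h2 => [|r a] h1 h2.
    by rewrite !cats0 in h1 h2; rewrite eq_p.
  case: nlast; rewrite -rcons_cat in h1; rewrite -rcons_cat in h2.
  by exists (incr_seq q.1 ++ r), (incr_seq q.2 ++ r), a.
case: eqP => // qp; case: h; exists [::]; rewrite qp !cats0 //.
Qed.

Lemma coef (Q : seq label) p : exists2 kappa, functional kappa &
  {in Q, forall q, kappa (mono q) = (q == p)%:R}.
Proof.
have [/mono_diag1[i ->]|np] := boolP (diag1 p).
  by have [kappa ? h] := coef_diag1 i; exists kappa => // q _.
have [->|p0] := eqVneq p (fset0, fset0); first exact: coef_empty.
by have [kappa ? h] := coef_offdiag np p0; exists kappa => // q _.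
Qed.

Definition coefficient L p : R[i] := \sum_(cp <- L | cp.2 == p) cp.1.

Lemma functional_lincomb kappa L p : functional kappa ->
  (forall q, q \in [seq cp.2 | cp <- L] -> kappa (mono q) = (q == p)%:R) ->
  kappa (lincomb mono L) = coefficient L p.
Proof.
move=> [k0 klin]; rewrite /coefficient; elim: L => [|cp L IH] h /=.
  by rewrite k0 big_nil.
rewrite klin big_cons IH; last by move=> q qL; apply: h; rewrite inE qL orbT.
rewrite h ?inE ?eqxx //; case: ifP => _; first by rewrite mulr1.
by rewrite mulr0 add0r.
Qed.

Lemma lincombE tau L (Q : seq label) f : uniq Q ->
  {subset [seq cp.2 | cp <- L] <= Q} ->
  lincomb tau L f = \sum_(p <- Q) coefficient L p *: tau p f.
Proof.
move=> uQ; elim: L => [|cp L IH] LQ /=.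
  by rewrite big1 // => p _; rewrite /coefficient big_nil scale0r.
rewrite -/(lincomb tau L) IH; last by move=> q qL; apply: LQ; rewrite inE qL orbT.
rewrite [RHS](eq_bigr (fun p => (if cp.2 == p then cp.1 else 0) *: tau p f
                           + coefficient L p *: tau p f)); last first.
  move=> p _; rewrite /coefficient big_cons -scalerDl.
  by case: ifP => _; rewrite ?add0r.
rewrite big_split /=; congr (_ + _).
rewrite (bigD1_seq cp.2) ?LQ ?inE ?eqxx //= big1 ?addr0 // => p.
by rewrite eq_sym => /negPf ->; rewrite scale0r.
Qed.

(** The monomials being linearly independent, any assignment of operators to
    them extends linearly. *)
Lemma lincomb_transfer tau L L' : lincomb mono L = lincomb mono L' ->
  lincomb tau L = lincomb tau L'.
Proof.
move=> e; apply/funext => f.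
pose Q := undup [seq cp.2 | cp <- L ++ L'].
have QL : {subset [seq cp.2 | cp <- L] <= Q}.
  by move=> q qL; rewrite mem_undup map_cat mem_cat qL.
have QL' : {subset [seq cp.2 | cp <- L'] <= Q}.
  by move=> q qL; rewrite mem_undup map_cat mem_cat qL orbT.
rewrite !(@lincombE tau _ Q) ?undup_uniq //; apply: eq_bigr => p _; congr (_ *: _).
have [kappa fk hk] := coef Q p.
rewrite -(functional_lincomb fk (fun q qL => hk q (QL q qL))) e.
exact: (functional_lincomb fk (fun q qL => hk q (QL' q qL))).
Qed.

Definition T_mono (sigma : int -> int) p : F -> F :=
  if `[< incr_on sigma p.1 /\ incr_on sigma p.2 >]
  then mono (sigma @` p.1, sigma @` p.2)%fset else fun=> 0.

(** [T_ sigma] is a choice among the maps satisfying [is_T sigma]; its defining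
    properties become available only once such a map has been constructed. *)
Lemma T_exists (sigma : int -> int) : is_T (R := R) sigma (T_ sigma).
Proof.
apply: (@xgetPex _ _ [set T | is_T sigma T]).
have [T hT] : exists T : (F -> F) -> (F -> F), forall L,
    T (lincomb mono L) = lincomb (T_mono sigma) L.
  have /choice[T hT] : forall X, exists Y, forall L,
      X = lincomb mono L -> Y = lincomb (T_mono sigma) L.
    move=> X; have [[L ->]|nX] := pselect (mono_span X).
      by exists (lincomb (T_mono sigma) L) => L'; exact: lincomb_transfer.
    by exists (fun=> 0) => L e; case: nX; exists L.
  by exists T => L; exact: hT.
have Tmono p : T (mono p) = T_mono sigma p.
  have e tau : tau p = lincomb tau [:: (1, p)].
    by apply/funext => f /=; rewrite scale1r addr0.
  by rewrite (e mono) hT -e.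
exists T; split.
- move=> c X Y /span_M0[L ->] /span_M0[L' ->].
  rewrite -[in RHS]/(lincomb mono L) !hT.
  rewrite -(_ : lincomb mono ([seq (c * cp.1, cp.2) | cp <- L] ++ L') =
    c \*: lincomb mono L \+ lincomb mono L'); last first.
    by rewrite lincomb_cat lincomb_scale.
  by rewrite hT lincomb_cat lincomb_scale.
- move=> l1 l2 h1 h2; rewrite (Tmono (l1, l2)) /T_mono asboolT //.
- by move=> l1 l2 h; rewrite (Tmono (l1, l2)) /T_mono asboolF.
Qed.

End HamelBasis.

(** * Symmetric states *)

Section SymmetricStates.
Context {R : realType} (phi : (fock R -> fock R) -> R[i]).
Context {H : hilbert R} (pi : (fock R -> fock R) -> (H -> H)) (xi : H).
Hypothesis sphi : is_state (monotone_alg R) phi.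
Hypothesis gns : is_GNS (monotone_alg R) phi pi xi.
Local Notation F := (fock R).
Local Notation M := (monotone_alg R).
Implicit Types (X Y : F -> F) (i j k : int) (x y : H).

Lemma M_annih i : M (annih i).
Proof. exact: M0_sub_M (M0_annih i). Qed.

Lemma M_create i : M (create i).
Proof. exact: M0_sub_M (M0_create i). Qed.

Lemma M_above k : M (above k).
Proof. exact: M0_sub_M (M0_above k). Qed.

Lemma M_id : M id.
Proof. exact: (star_alg_id star_alg_M). Qed.

Lemma M_comp X Y : M X -> M Y -> M (X \o Y).
Proof. exact: (star_alg_comp star_alg_M). Qed.

Lemma M_zero : M (fun=> 0).
Proof. exact: M0_sub_M M0_zero. Qed.

Lemma pi_linear X : M X -> linear (pi X).
Proof. by move=> /(GNS_bounded gns)[]. Qed.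

Lemma pi_comp X Y x : M X -> M Y -> pi (X \o Y) x = pi X (pi Y x).
Proof. by move=> MX MY; rewrite (GNS_comp gns). Qed.

Lemma pi_zero x : pi (fun=> 0) x = 0.
Proof.
have := GNS_linear gns (-1) M_zero M_zero.
have -> : -1 \*: (fun=> 0) \+ (fun=> 0) = (fun=> 0) :> (F -> F).
  by apply/funext => f /=; rewrite scaler0 addr0.
by move=> /(congr1 (fun T => T x)) -> /=; rewrite scaleN1r addNr.
Qed.

Lemma phi_zero : phi (fun=> 0) = 0.
Proof. by rewrite (GNS_state gns M_zero) pi_zero ip0l. Qed.

Lemma pi_adjoint i x y : ip H (pi (create i) x) y = ip H x (pi (annih i) y).
Proof. by apply: (GNS_adjoint gns (M_create i)); exact: annih_adjoint. Qed.

Lemma pi_above_adjoint k x y : ip H (pi (above k) x) y = ip H x (pi (above k) y).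
Proof. by apply: (GNS_adjoint gns (M_above k)); exact: adjoint_above. Qed.

Definition level_state : Prop := forall i j, phi (above i) = phi (above j).

Definition swap i j k : int := if k == i then j else if k == j then i else k.

Lemma swap_fin_perm i j : fin_perm (swap i j).
Proof.
split.
  suff sK : cancel (swap i j) (swap i j) by exists (swap i j).
  move=> k; rewrite /swap; have [->|ki] := eqVneq k i.
    by have [->|ji] := eqVneq j i; rewrite ?eqxx.
  have [->|kj] := eqVneq k j; first by rewrite eqxx.
  by rewrite (negPf ki) (negPf kj).
apply: (@sub_finite_set _ _ [set k | k \in [:: i; j]]); last exact: finite_seq.
move=> k /=; rewrite /swap !inE.
by have [//|ki] := eqVneq k i; have [//|kj] := eqVneq k j; rewrite eqxx.
Qed.

Lemma T_mono_incr sigma p : incr_on sigma p.1 -> incr_on sigma p.2 ->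
  T_ sigma (mono p) = mono (sigma @` p.1, sigma @` p.2)%fset :> (F -> F).
Proof. exact: (T_incr (T_exists sigma)). Qed.

Lemma T_mono_not_incr sigma p : ~ (incr_on sigma p.1 /\ incr_on sigma p.2) ->
  T_ sigma (mono p) = (fun=> 0) :> (F -> F).
Proof. exact: (T_not_incr (T_exists sigma)). Qed.

(** The transposition of [i] and [j] carries [above i] to [above j]. *)
Lemma symmetric_level : symmetric_state phi -> level_state.
Proof.
move=> sym i j; have := sym (above i) (swap i j) (M0_above i) (swap_fin_perm i j).
have incr : incr_on (swap i j) [fset i]%fset.
  by move=> a b; rewrite !inE => /eqP -> /eqP ->; rewrite ltxx.
rewrite -{1}mono_above T_mono_incr // !imfset_fset1 mono_above.
by rewrite /swap eqxx.
Qed.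

(** The projection onto the sequences beginning with [i] is a difference of two
    consecutive [above], so [phi] vanishes on it. *)
Lemma level_annih : level_state -> forall i, pi (annih i) xi = 0.
Proof.
move=> lev i; apply: nsq_eq0; apply/eqP; rewrite -(inj_eq (@complexI R)) /=.
rewrite -ipxx -pi_adjoint -pi_comp; [|exact: M_create|exact: M_annih].
rewrite -(GNS_state gns); last exact: M_comp (M_create i) (M_annih i).
have := state_linear sphi 1 (M_above i) (M_comp (M_create i) (M_annih i)).
have -> : 1 \*: above i \+ (create i \o annih i) = above (i - 1) :> (F -> F).
  by rewrite above_pred; apply/funext => f /=; rewrite scale1r.
by rewrite (lev (i - 1) i) mul1r => /eqP; rewrite -subr_eq0 opprD addrA subrr sub0r oppr_eq0.
Qed.

(** Any other monomial ends with an annihilation operator, which kills [xi], or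
    begins with a creation operator, whose adjoint does. *)
Lemma level_mono : level_state -> forall p, ~~ diag1 p -> p != (fset0, fset0) ->
  phi (mono p) = 0.
Proof.
move=> /level_annih a0 p np; rewrite (GNS_state gns) ?mono_offdiag //; last first.
  by rewrite -mono_offdiag //; apply: M0_sub_M; exact: M0_mono.
have Mc u : M (create_seq u).
  by apply: op_prod_ind; [exact: M_id|exact: M_comp|exact: M_create].
have Ma u : M (annih_seq u).
  by apply: op_prod_ind; [exact: M_id|exact: M_comp|exact: M_annih].
case: p np => l l' np; rewrite xpair_eqE -!(inj_eq incr_inj) incr_fset0 /=.
case: (incr_seq l') => [|j v].
  case: (incr_seq l) => // i u _.
  have -> : word (i :: u) [::] = create i \o create_seq u :> (F -> F) by [].
  by rewrite pi_comp //; [rewrite pi_adjoint a0 ip0r|exact: M_create].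
move=> _; have -> : word (incr_seq l) (j :: v) =
    (create_seq (incr_seq l) \o annih_seq v) \o annih j :> (F -> F).
  by rewrite /word annih_seq_cons.
rewrite pi_comp; [|exact: M_comp|exact: M_annih].
by rewrite a0 linmap0 ?ip0l //; apply: pi_linear; exact: M_comp.
Qed.

(** [T_ sigma] permutes the monomials [above i] and sends those on which [phi]
    vanishes to others of the same kind or to [0]. *)
Lemma level_symmetric : level_state -> symmetric_state phi.
Proof.
move=> lev X sigma /span_M0[L ->] [sB _].
have tT := T_exists (R := R) sigma.
have sI := bij_inj sB.
have incr1 l : (size (incr_seq l) <= 1)%N -> incr_on sigma l.
  move=> l1 a b; rewrite -!mem_incr; case: (incr_seq l) l1 => [|c [|]] // _.
  by rewrite !inE => /eqP -> /eqP ->; rewrite ltxx.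
have card l : size (incr_seq l) = #|` l|%fset by rewrite size_sort.
have Tmono p : phi (T_ sigma (mono p)) = phi (mono p).
  have [dp|np] := boolP (diag1 p).
    have [i ->] := mono_diag1 dp.
    have h : incr_on sigma [fset i]%fset by apply: incr1; rewrite incr_fset1.
    rewrite T_mono_incr // !imfset_fset1 !mono_above.
    exact: lev.
  have [->|p0] := eqVneq p (fset0, fset0).
    have h : incr_on sigma fset0 by apply: incr1; rewrite incr_fset0.
    by rewrite T_mono_incr // !imfset0.
  rewrite (level_mono lev np p0).
  have [[h1 h2]|h] := pselect (incr_on sigma p.1 /\ incr_on sigma p.2); last first.
    by rewrite T_mono_not_incr // phi_zero.
  rewrite T_mono_incr // (level_mono lev) //.
    apply: contra np; rewrite /diag1 /= !card card_imfset // => /andP[/eqP e ->].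
    rewrite andbT; apply/eqP/fsetP => i.
    by have := congr1 (fun A : {fset int} => sigma i \in A) e; rewrite !mem_imfset.
  apply: contra p0; case: (p) => l l' /=; rewrite !xpair_eqE -!cardfs_eq0.
  by rewrite !card_imfset.
have MTmono p : M (T_ sigma (mono p)).
  have [[h1 h2]|h] := pselect (incr_on sigma p.1 /\ incr_on sigma p.2).
    by rewrite T_mono_incr //; apply: M0_sub_M; exact: M0_mono.
  by rewrite T_mono_not_incr //; exact: M_zero.
suff [//] : phi (T_ sigma (lincomb mono L)) = phi (lincomb mono L) /\
    M (T_ sigma (lincomb mono L)).
elim: L => [|cp L [IH MIH]] /=.
  have i0 := star_alg_id (@star_alg_M0 R).
  have -> : (fun=> 0) = (-1) \*: id \+ id :> (F -> F).
    by apply/funext => f /=; rewrite scaleN1r addNr.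
  rewrite (T_linear tT) //.
  have -> : -1 \*: T_ sigma id \+ T_ sigma id = (fun=> 0) :> (F -> F).
    by apply/funext => f /=; rewrite scaleN1r addNr.
  have -> : -1 \*: id \+ id = (fun=> 0) :> (F -> F).
    by apply/funext => f /=; rewrite scaleN1r addNr.
  by split=> //; exact: M_zero.
have M0L : monotone_alg0 R (lincomb mono L) by apply: M0_span; exists L.
rewrite (T_linear tT) //; last exact: M0_mono.
split; last exact: (star_alg_linear star_alg_M).
rewrite (state_linear sphi) // (state_linear sphi) ?Tmono ?IH //.
  apply: M0_sub_M; exact: M0_mono.
exact: M0_sub_M.
Qed.
End SymmetricStates.

(** * The GNS space of a symmetric state *)

Lemma conjc_mul (R : realType) (c : R[i]) : conjc c * c = (sqn c)%:C.
Proof.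
by case: c => a b; apply/eqP; rewrite eq_complex /=; apply/andP; split; apply/eqP;
  rewrite /sqn /=; ring.
Qed.

Section OrthogonalSums.
Context {R : realType} {H : hilbert R}.

Lemma nsq_orth_sum (I : eqType) (r : seq I) (c : I -> R[i]) (g : I -> H) :
  uniq r -> {in r &, forall i j, i != j -> ip H (g i) (g j) = 0} ->
  nsq (\sum_(i <- r) c i *: g i) = \sum_(i <- r) sqn (c i) * nsq (g i).
Proof.
elim: r => [|i r IH] /=; first by rewrite !big_nil nsq0.
move=> /andP[ir ur] orth; rewrite !big_cons nsqD nsqZ IH //; last first.
  by move=> j k jr kr; apply: orth; rewrite inE ?jr ?kr orbT.
suff -> : ip H (c i *: g i) (\sum_(j <- r) c j *: g j) = 0 by rewrite mulr0 addr0.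
rewrite ip_sumr big_seq big1 // => j jr.
rewrite ipZl ipZr orth ?mulr0 ?inE ?eqxx ?jr ?orbT //.
by apply: contraNneq ir => ->.
Qed.
End OrthogonalSums.

Section LevelStates.
Context {R : realType} (phi : (fock R -> fock R) -> R[i]).
Context {H : hilbert R} (pi : (fock R -> fock R) -> (H -> H)) (xi : H).
Hypothesis sphi : is_state (monotone_alg R) phi.
Hypothesis gns : is_GNS (monotone_alg R) phi pi xi.
Hypothesis lev : level_state phi.
Local Notation F := (fock R).
Local Notation M := (monotone_alg R).
Implicit Types (X Y : F -> F) (i j k : int) (x y : H) (u v w : mono_index).

Let annih_xi := level_annih sphi gns lev.

Lemma pi_op X Y Z x : M X -> M Y -> X \o Y = Z -> pi X (pi Y x) = pi Z x.
Proof. by move=> MX MY <-; rewrite (pi_comp gns). Qed.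

Lemma pi_op0 X Y x : M X -> M Y -> X \o Y = (fun=> 0) -> pi X (pi Y x) = 0.
Proof. by move=> MX MY e; rewrite (pi_op _ MX MY e) (pi_zero gns). Qed.

(** The vector [xi] splits into a multiple [vac] of a vacuum vector and a vector
    [resid] that all creation and annihilation operators kill. Either may be [0]. *)
Definition vac : H := pi (above 0) xi.
Definition resid : H := xi - vac.

(** [pi (above i) xi] does not change with [i], because consecutive ones differ by
    [pi (create i) (pi (annih i) xi) = 0]. *)
Lemma pi_above_xi k : pi (above k) xi = vac.
Proof.
have step i : pi (above (i - 1)) xi = pi (above i) xi.
  have := GNS_linear gns 1 (M_above i) (M_comp (M_create i) (M_annih i)).
  have -> : 1 \*: above i \+ (create i \o annih i) = above (i - 1) :> (F -> F).
    by rewrite above_pred; apply/funext => f /=; rewrite scale1r.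
  move=> -> /=; rewrite scale1r (pi_comp gns _ (M_create i) (M_annih i)).
  by rewrite annih_xi linmap0 ?addr0 //; apply: (pi_linear gns); exact: M_create.
rewrite /vac; elim/int_ind: k => // n IH; last by rewrite -IH -(step (- n%:Z)); congr (pi (above _) _); lia.
by rewrite -IH -(step n.+1); congr (pi (above _) _); lia.
Qed.

Lemma xi_split : xi = vac + resid.
Proof. by rewrite /resid addrC subrK. Qed.

Lemma annih_vac k : pi (annih k) vac = 0.
Proof.
rewrite -(pi_above_xi k); apply: pi_op0; [exact: M_annih|exact: M_above|].
exact: annih_above_ge.
Qed.

Lemma above_vac k : pi (above k) vac = vac.
Proof.
rewrite -(pi_above_xi k); apply: pi_op; [exact: M_above|exact: M_above|].
exact: above_above.
Qed.

Lemma annih_resid k : pi (annih k) resid = 0.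
Proof.
rewrite /resid linmapB ?annih_xi ?annih_vac ?subrr //.
by apply: (pi_linear gns); exact: M_annih.
Qed.

Lemma above_resid k : pi (above k) resid = 0.
Proof.
rewrite /resid linmapB ?pi_above_xi ?above_vac ?subrr //.
by apply: (pi_linear gns); exact: M_above.
Qed.

Lemma create_resid k : pi (create k) resid = 0.
Proof.
rewrite -(@create_above_le R k k) // (pi_comp gns) ?above_resid //;
  [|exact: M_create|exact: M_above].
by rewrite linmap0 //; apply: (pi_linear gns); exact: M_create.
Qed.

(** The copies of the canonical basis vectors of the Fock space in [H] *)
Definition fvec u : H := pi (create_seq (val u)) vac.

Lemma M_create_seq (s : seq int) : M (create_seq s).
Proof. by apply: op_prod_ind; [exact: M_id|exact: M_comp|exact: M_create]. Qed.

Definition nil_index : mono_index := Sub [::] (erefl true).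

Lemma fvec_nil : fvec nil_index = vac.
Proof. by rewrite /fvec /= (GNS_id gns). Qed.

Lemma fvec_cons k u w : val w = k :: val u -> fvec w = pi (create k) (fvec u).
Proof.
move=> e; rewrite /fvec e (_ : create_seq (k :: val u) = create k \o create_seq (val u)) //.
by rewrite (pi_comp gns) //; [exact: M_create|exact: M_create_seq].
Qed.

Lemma mono_index_cases u : u = nil_index \/ exists k v, val u = k :: val v.
Proof.
case e : (val u) => [|k s]; first by left; apply/val_inj.
have ss : sorted <%R s by apply: (@mono_tail [:: k] _ u); rewrite e.
by right; exists k, (Sub s ss).
Qed.

Lemma create_fvec k u : pi (create k) (fvec u) = oapp fvec 0 (push k u).
Proof.
case e : (push k u) => [w|] /=; first by apply/esym/fvec_cons/pushP.
have [eu|[j [v eu]]] := mono_index_cases u.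
  by rewrite eu /push insubT in e.
rewrite (fvec_cons eu); apply: pi_op0; [exact: M_create|exact: M_create|].
apply: create_create_ge; rewrite leNgt; apply/negP => kj.
have h : sorted <%R (k :: val u).
  by have := valP u; rewrite /= eu /= kj.
by rewrite /push insubT in e.
Qed.

Lemma above_fvec k u : sorted <%R (k :: val u) -> pi (above k) (fvec u) = fvec u.
Proof.
have [->|[j [v eu]]] := mono_index_cases u; first by rewrite fvec_nil above_vac.
rewrite eu /= => /andP[kj _]; rewrite (fvec_cons eu).
by apply: pi_op; [exact: M_above|exact: M_create|exact: above_create_lt].
Qed.

Lemma annih_fvec k u : pi (annih k) (fvec u) = oapp fvec 0 (pop k u).
Proof.
case e : (pop k u) => [w|] /=.
  have eu := (popP k w u).1 e; rewrite (fvec_cons eu).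
  rewrite -(pi_comp gns) //; [|exact: M_annih|exact: M_create].
  by apply: above_fvec; rewrite -eu; exact: valP.
have [->|[j [v eu]]] := mono_index_cases u; first by rewrite fvec_nil annih_vac.
rewrite (fvec_cons eu); apply: pi_op0; [exact: M_annih|exact: M_create|].
apply: annih_create_neq; apply/eqP => kj; subst j.
by have := (popP k v u).2 eu; rewrite e.
Qed.

(** The common squared norm of all [fvec u] *)
Definition mass : R := nsq vac.

Lemma fvec_resid u : ip H (fvec u) resid = 0.
Proof.
have [->|[j [v eu]]] := mono_index_cases u.
  by rewrite fvec_nil -(above_vac 0) (pi_above_adjoint gns) above_resid ip0r.
by rewrite (fvec_cons eu) (pi_adjoint gns) annih_resid ip0r.
Qed.

Lemma resid_fvec u : ip H resid (fvec u) = 0.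
Proof. by rewrite ipC fvec_resid rmorph0. Qed.

Lemma fvec_orth u v : ip H (fvec u) (fvec v) = if u == v then mass%:C else 0.
Proof.
have [n] := ubnP (size (val u)); elim: n u v => // n IH u v un.
have [->|[j [u' eu]]] := mono_index_cases u.
  have [->|[k [v' ev]]] := mono_index_cases v; first by rewrite eqxx fvec_nil ipxx.
  rewrite (fvec_cons ev) ipC (pi_adjoint gns) fvec_nil annih_vac ip0r rmorph0.
  by rewrite -val_eqE /= ev.
rewrite (fvec_cons eu) (pi_adjoint gns) annih_fvec.
case e : (pop j v) => [v'|] /=.
  have ev := (popP j v' v).1 e; rewrite IH; last by move: un; rewrite eu /= ltnS.
  by rewrite -!val_eqE /= eu ev eqseq_cons eqxx.
rewrite ip0r; case: eqP => // uv; subst v.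
by have := (popP j u' u).2 eu; rewrite e.
Qed.

Lemma nsq_fvec u : nsq (fvec u) = mass.
Proof. by rewrite /nsq fvec_orth eqxx. Qed.

Lemma mass0_fvec u : mass = 0 -> fvec u = 0.
Proof. by move=> m0; apply: nsq_eq0; rewrite nsq_fvec. Qed.

(** [resid] and the [fvec u] span a dense subspace: their span contains [xi] and is
    stable under creation and annihilation operators. *)
Lemma total_ind (P : H -> Prop) :
  P resid -> (forall u, P (fvec u)) ->
  (forall c x y, P x -> P y -> P (c *: x + y)) ->
  (forall x, (forall e : R, 0 < e -> exists2 z, P z & hnorm (x - z) <= e) -> P x) ->
  forall x, P x.
Proof.
move=> Pr Pf Plin Pcl.
have P0 : P 0 by have := Plin (-1) _ _ Pr Pr; rewrite scaleN1r addNr.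
pose B x := [\/ x = 0, x = resid | exists u, x = fvec u].
have PB x : B x -> P x by move=> [->|->|[u ->]].
have stab X : M X -> linear (pi X) -> B (pi X resid) -> (forall u, B (pi X (fvec u))) ->
    M X /\ forall x, B x -> B (pi X x).
  move=> MX lX hr hf; split=> // x [->|->|[u ->]] //.
  by constructor 1; rewrite linmap0.
have Boapp o : B (oapp fvec 0 o).
  by case: o => [u|]; [constructor 3; exists u|constructor 1].
have Bmono p : M (mono p) /\ forall x, B x -> B (pi (mono p) x).
  apply: (@mono_ind R (fun X => M X /\ forall x, B x -> B (pi X x))).
  - by split; [exact: M_id|move=> x Bx; rewrite (GNS_id gns)].
  - move=> X Y [MX hX] [MY hY]; split; first exact: M_comp.
    by move=> x Bx; rewrite (pi_comp gns) //; apply/hX/hY.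
  - move=> i; apply: stab; [exact: M_create|exact: (pi_linear gns (M_create i))| |].
      by constructor 1; exact: create_resid.
    by move=> u; rewrite create_fvec.
  - move=> i; apply: stab; [exact: M_annih|exact: (pi_linear gns (M_annih i))| |].
      by constructor 1; exact: annih_resid.
    by move=> u; rewrite annih_fvec.
have Pspan X : mono_span X -> M X /\ P (pi X xi).
  move=> [L ->]; elim: L => [|cp L [ML IH]] /=.
    by split; [exact: M_zero|rewrite (pi_zero gns)].
  have [Mm hm] := Bmono cp.2.
  split; first exact: (star_alg_linear star_alg_M).
  rewrite (GNS_linear gns) //=; apply: (Plin) => //.
  rewrite xi_split linmapD; last exact: (pi_linear gns).
  rewrite -[pi _ vac]scale1r; apply: (Plin); apply/PB/hm; last by constructor 2.
  by constructor 3; exists nil_index; rewrite fvec_nil.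
move=> x; apply: Pcl => e e0.
have [S gS hS] := GNS_dense (@annih_adjointable R) sphi gns x e0.
by exists (pi S xi) => //; have [] := Pspan _ (span_M0 gS).
Qed.

Lemma total_functional (g : H -> R[i]) (k : R) :
  (forall c x y, g (c *: x + y) = c * g x + g y) ->
  (forall x, cabs (g x) <= k * hnorm x) ->
  g resid = 0 -> (forall u, g (fvec u) = 0) -> forall x, g x = 0.
Proof.
move=> glin gk gr gf; apply: total_ind => //.
  by move=> c x y gx gy; rewrite glin gx gy mulr0 addr0.
move=> x hx; apply: cabs_small => e e0.
pose k' := Num.max k 0 + 1.
have k0 : 0 < k' by rewrite ltr_wpDl // le_max lexx orbT.
have [z gz hz] := hx (e / k') (divr_gt0 e0 k0).
have -> : g x = g (x - z).
  by rewrite addrC -scaleN1r glin gz mulr0 add0r.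
apply: le_trans (gk _) _; apply: (@le_trans _ _ (k' * hnorm (x - z))).
  rewrite ler_wpM2r ?hnorm_ge0 //; apply: le_trans (_ : _ <= Num.max k 0) _.
    by rewrite le_max lexx.
  by rewrite lerDl.
by rewrite mulrC -ler_pdivlMr.
Qed.

Lemma op_ext S T : bounded_op S -> bounded_op T -> S resid = T resid ->
  (forall u, S (fvec u) = T (fvec u)) -> S = T.
Proof.
move=> bS bT hr hf; apply/funext => x; apply: ip_inj => y; apply/eqP.
rewrite -subr_eq0; apply/eqP.
have bD : bounded_op ((-1) \*: T \+ S) by exact: bounded_lin.
have [k k0 kD] := bounded_pos bD.
have E z : ip H (S z) y - ip H (T z) y = ip H (((-1) \*: T \+ S) z) y.
  by rewrite -ipBl /= scaleN1r addrC.
apply: (@total_functional (fun x => ip H (S x) y - ip H (T x) y) (k * hnorm y)).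
- by move=> c z z'; rewrite !E bD.1 ipDl ipZl.
- move=> z; rewrite E; apply: le_trans (cabs_ip _ _) _.
  by rewrite mulrAC ler_wpM2r ?hnorm_ge0.
- by rewrite hr subrr.
- by move=> u; rewrite hf subrr.
Qed.

Lemma adjoint_ext S T : bounded_op S -> bounded_op T ->
  ip H (S resid) resid = ip H resid (T resid) ->
  (forall u, ip H (S resid) (fvec u) = ip H resid (T (fvec u))) ->
  (forall u, ip H (S (fvec u)) resid = ip H (fvec u) (T resid)) ->
  (forall u v, ip H (S (fvec u)) (fvec v) = ip H (fvec u) (T (fvec v))) ->
  adjoint_of S T.
Proof.
move=> bS bT hrr hrf hfr hff.
have [[k k0 kS] [l l0 lT]] := (bounded_pos bS, bounded_pos bT).
have left_ext y : ip H (S resid) y = ip H resid (T y) ->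
    (forall u, ip H (S (fvec u)) y = ip H (fvec u) (T y)) ->
    forall x, ip H (S x) y = ip H x (T y).
  move=> hr hf x; apply/eqP; rewrite -subr_eq0; apply/eqP.
  apply: (@total_functional (fun x => ip H (S x) y - ip H x (T y))
    (k * hnorm y + hnorm (T y))).
  - by move=> c z z'; rewrite bS.1 !ipDl !ipZl; ring.
  - move=> z; apply: le_trans (cabsD _ _) _; rewrite cabsN mulrDl lerD //.
      apply: le_trans (cabs_ip _ _) _.
      by rewrite mulrAC ler_wpM2r ?hnorm_ge0.
    by rewrite mulrC; exact: cabs_ip.
  - by rewrite hr subrr.
  - by move=> u; rewrite hf subrr.
have right_ext x : ip H (S x) resid = ip H x (T resid) ->
    (forall u, ip H (S x) (fvec u) = ip H x (T (fvec u))) ->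
    forall y, ip H (S x) y = ip H x (T y).
  move=> hr hf y; apply/eqP; rewrite -subr_eq0; apply/eqP.
  rewrite ipC (ipC x) -rmorphB.
  rewrite (@total_functional (fun y => ip H y (S x) - ip H (T y) x)
    (hnorm (S x) + l * hnorm x)) ?rmorph0 //.
  - by move=> c z z'; rewrite bT.1 !ipDl !ipZl; ring.
  - move=> z; apply: le_trans (cabsD _ _) _; rewrite cabsN mulrDl lerD //.
      by rewrite mulrC; exact: cabs_ip.
    apply: le_trans (cabs_ip _ _) _.
    by rewrite mulrAC ler_wpM2r ?hnorm_ge0.
  - by rewrite ipC hr (ipC (T resid)) subrr.
  - by move=> u; rewrite ipC hf (ipC (T _)) subrr.
move=> x y; apply: left_ext; first exact: right_ext.
by move=> u; apply: right_ext.
Qed.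

(** Bounded operators are prescribed on the orthogonal system [fvec] by the strong
    sums of the rank-one operators [<., fvec u> (fvec (h u)) / mass]. *)
Section BasisMaps.
Variable h : mono_index -> option mono_index.
Hypothesis h_inj : forall u v w, h u = Some w -> h v = Some w -> u = v.

Let image u : H := oapp fvec 0 (h u).

Let part (n : nat) x : H :=
  \sum_(u <- upto n) (ip H x (fvec u) / mass%:C) *: image u.

Let part_linear n : linear (part n).
Proof.
move=> c x y; rewrite /part scaler_sumr -big_split; apply: eq_bigr => u _ /=.
by rewrite scalerA -scalerDl ipDl ipZl mulrDl mulrA.
Qed.

Let image_orth u v : u != v -> ip H (image u) (image v) = 0.
Proof.
move=> uv; rewrite /image; case eu : (h u) => [u'|]; last by rewrite ip0l.
case ev : (h v) => [v'|] /=; last by rewrite ip0r.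
rewrite fvec_orth; case: eqP => // e; subst v'.
by rewrite (h_inj eu ev) eqxx in uv.
Qed.

Let nsq_image u : nsq (image u) <= mass.
Proof.
rewrite /image; case: (h u) => [v|] /=; first by rewrite nsq_fvec.
by rewrite nsq0 nsq_ge0.
Qed.

Hypothesis mass_gt0 : 0 < mass.

Let bessel (A : {fset mono_index}) x :
  \sum_(u <- A) sqn (ip H x (fvec u) / mass%:C) * mass <= nsq x.
Proof.
pose c u := ip H x (fvec u) / mass%:C.
have := nsq_ge0 (x - \sum_(u <- A) c u *: fvec u).
rewrite nsqB nsq_orth_sum ?fset_uniq //; last first.
  by move=> u v _ _ /negPf uv; rewrite fvec_orth uv.
under eq_bigr do rewrite nsq_fvec.
rewrite ip_sumr.
have -> : \sum_(u <- A) ip H x (c u *: fvec u) =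
    (\sum_(u <- A) sqn (c u) * mass)%:C.
  rewrite rmorph_sum; apply: eq_bigr => u _; rewrite ipZr.
  have -> : ip H x (fvec u) = c u * mass%:C.
    by rewrite /c divfK // (inj_eq (@complexI R)) gt_eqF.
  by rewrite mulrA conjc_mul -rmorphM.
by rewrite /=; lra.
Qed.

Let part_bound n x : hnorm (part n x) <= hnorm x.
Proof.
rewrite hnorm_le ?hnorm_ge0 // hnormE nsq_orth_sum ?fset_uniq //; last first.
  by move=> u v _ _; exact: image_orth.
apply: le_trans (bessel (upto n) x); apply: ler_sum => u _.
by rewrite ler_wpM2l ?sqn_ge0.
Qed.

Let part_fvec u : exists N, forall n, (N <= n)%N -> part n (fvec u) = image u.
Proof.
have [N hN] := upto_sub [fset u]%fset; exists N => n /hN.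
rewrite fsub1set => un; rewrite /part (big_fsetD1 u) //= fvec_orth eqxx.
rewrite divff ?(inj_eq (@complexI R)) ?gt_eqF // scale1r big_seq big1 ?addr0 //.
move=> v; rewrite !inE eq_sym => /andP[/negPf uv _].
by rewrite fvec_orth uv mul0r scale0r.
Qed.

Let part_resid n : part n resid = 0.
Proof. by rewrite /part big1 // => u _; rewrite resid_fvec mul0r scale0r. Qed.

Let part_lim x l : Prop := forall e : R, 0 < e -> exists N, forall n, (N <= n)%N ->
  hnorm (part n x - l) <= e.

(** The partial sums are contractions and are eventually constant on each vector
    of a total set; a uniformly bounded sequence that is Cauchy on a total set is
    Cauchy everywhere. *)
Let part_cvg x : exists l, part_lim x l.
Proof.
suff : forall e : R, 0 < e -> exists N, forall m n, (N <= m)%N -> (N <= n)%N ->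
    hnorm (part m x - part n x) <= e by exact: hilbert_complete.
move: x; apply: total_ind.
- by move=> e e0; exists 0%N => m n _ _; rewrite !part_resid subrr hnorm0 ltW.
- move=> u e e0; have [N hN] := part_fvec u; exists N => m n Nm Nn.
  by rewrite !hN // subrr hnorm0 ltW.
- move=> c x y hx hy e e0.
  pose k := cabs c + 1.
  have k0 : 0 < k by rewrite ltr_wpDl // cabs_ge0.
  have [N hN] := hx (e / 2 / k) (divr_gt0 (divr_gt0 e0 (ltr0n _ 2)) k0).
  have [N' hN'] := hy (e / 2) (divr_gt0 e0 (ltr0n _ 2)).
  exists (maxn N N') => m n; rewrite !geq_max => /andP[Nm N'm] /andP[Nn N'n].
  rewrite !part_linear opprD addrACA -scalerBr; apply: le_trans (hnormD _ _) _.
  rewrite hnormZ [leRHS]splitr lerD ?hN' //.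
  apply: (@le_trans _ _ (k * hnorm (part m x - part n x))).
    by rewrite ler_wpM2r ?hnorm_ge0 // lerDl.
  by rewrite mulrC -ler_pdivlMr // hN.
- move=> x hx e e0; have e30 : 0 < e / 3 by rewrite divr_gt0.
  have [z hz xz] := hx _ e30; have [N hN] := hz _ e30.
  exists N => m n Nm Nn.
  have -> : part m x - part n x =
      part m (x - z) + ((part m z - part n z) - part n (x - z)).
    by rewrite !(linmapB _ _ (part_linear _)) opprB !subrKA.
  apply: le_trans (hnormD _ _) _.
  apply: le_trans (lerD (part_bound _ _) (hnormB _ _)) _.
  by have := hN _ _ Nm Nn; have := part_bound n (x - z); lra.
Qed.

Let part_lim_unique x l l' : part_lim x l -> part_lim x l' -> l = l'.
Proof.
move=> hl hl'; apply/eqP; rewrite -subr_eq0; apply/eqP/hnorm_small => e e0.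
have e20 : 0 < e / 2 by rewrite divr_gt0.
have [[N hN] [N' hN']] := (hl _ e20, hl' _ e20).
rewrite -(subrKA (part (maxn N N') x)); apply: le_trans (hnormD _ _) _.
rewrite hnorm_distC [leRHS]splitr lerD ?hN ?hN' ?leq_maxl ?leq_maxr //.
Qed.

Let part_lim_lin c x y l l' : part_lim x l -> part_lim y l' ->
  part_lim (c *: x + y) (c *: l + l').
Proof.
move=> hl hl' e e0; pose k := cabs c + 1.
have k0 : 0 < k by rewrite ltr_wpDl // cabs_ge0.
have [N hN] := hl (e / 2 / k) (divr_gt0 (divr_gt0 e0 (ltr0n _ 2)) k0).
have [N' hN'] := hl' (e / 2) (divr_gt0 e0 (ltr0n _ 2)).
exists (maxn N N') => n; rewrite geq_max => /andP[Nn N'n].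
rewrite part_linear opprD addrACA -scalerBr; apply: le_trans (hnormD _ _) _.
rewrite hnormZ [leRHS]splitr lerD ?hN' //.
apply: (@le_trans _ _ (k * hnorm (part n x - l))).
  by rewrite ler_wpM2r ?hnorm_ge0 // lerDl.
by rewrite mulrC -ler_pdivlMr // hN.
Qed.

Lemma basis_map_gt0 : exists T, [/\ bounded_op T, T resid = 0 &
  forall u, T (fvec u) = oapp fvec 0 (h u)].
Proof.
have [T hT] := choice part_cvg; exists T; split.
- split; first by move=> c x y; exact: part_lim_unique (hT _) (part_lim_lin c (hT x) (hT y)).
  exists 1 => x; rewrite mul1r; apply/ler_addgt0Pr => e e0.
  have [N hN] := hT x e e0; rewrite -(subrK (part N x) (T x)).
  rewrite addrC; apply: le_trans (hnormD _ _) _; rewrite lerD // hnorm_distC.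
  exact: hN.
- apply: part_lim_unique (hT _) _ => e e0; exists 0%N => n _.
  by rewrite part_resid subrr hnorm0 ltW.
- move=> u; apply: part_lim_unique (hT _) _ => e e0.
  have [N hN] := part_fvec u; exists N => n Nn.
  by rewrite hN // subrr hnorm0 ltW.
Qed.
End BasisMaps.

(** The operators by which commutation is tested are all of this form. When [mass]
    is [0], every [fvec u] vanishes and [T] can be [0]. *)
Lemma basis_map (h h' : mono_index -> option mono_index) :
  (forall u v, h u = Some v <-> h' v = Some u) ->
  exists T T', [/\ bounded_op T, adjoint_of T T', T resid = 0, T' resid = 0 &
    (forall u, T (fvec u) = oapp fvec 0 (h u)) /\
    (forall u, T' (fvec u) = oapp fvec 0 (h' u))].
Proof.
move=> hh.
have h_inj u v w : h u = Some w -> h v = Some w -> u = v.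
  by move=> /hh e /hh; rewrite e => -[].
have h_inj' u v w : h' u = Some w -> h' v = Some w -> u = v.
  by move=> /hh e /hh; rewrite e => -[].
have ex (g : mono_index -> option mono_index) :
    (forall u v w, g u = Some w -> g v = Some w -> u = v) ->
    exists T, [/\ bounded_op T, T resid = 0 & forall u, T (fvec u) = oapp fvec 0 (g u)].
  move=> g_inj; have [m0|m0] := eqVneq mass 0; last first.
    by apply: basis_map_gt0 => //; rewrite lt_def m0 nsq_ge0.
  exists (fun=> 0); split=> //; first exact: bounded_zero.
  by move=> u; case: (g u) => //= v; rewrite mass0_fvec.
have [T [bT Tr Tf]] := ex _ h_inj; have [T' [bT' T'r T'f]] := ex _ h_inj'.
exists T, T'; split=> //; apply: adjoint_ext => //.
- by rewrite Tr T'r ip0l ip0r.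
- move=> u; rewrite Tr T'f ip0l; case: (h' u) => [v|] /=; last by rewrite ip0r.
  by rewrite resid_fvec.
- move=> u; rewrite T'r Tf ip0r; case: (h u) => [v|] /=; last by rewrite ip0l.
  by rewrite fvec_resid.
- move=> u v; rewrite Tf T'f.
  case eu : (h u) => [w|] /=; case ev : (h' v) => [w'|] /=; rewrite ?ip0l ?ip0r //.
  + rewrite !fvec_orth.
    have -> : (w == v) = (u == w') => //.
    apply/eqP/eqP => [wv|uw].
      by subst w; move: eu => /hh; rewrite ev => -[].
    by subst w'; move: ev => /hh; rewrite eu => -[].
  + rewrite fvec_orth; case: eqP => // wv; subst w.
    by move/hh: eu; rewrite ev.
  + rewrite fvec_orth; case: eqP => // uw; subst w'.
    by move/hh: ev; rewrite eu.
Qed.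


(** * Projections onto the lines of [vac] and [resid] *)

Let proc := state_process pi.

(** The orthogonal projection onto the line of [v]; it is [0] for [v = 0]. *)
Definition line (v : H) : H -> H := fun x => (ip H x v / ip H v v) *: v.

Lemma bounded_line (v : H) : bounded_op (line v).
Proof.
split; first by move=> c x y; rewrite /line ipDl ipZl mulrDl scalerDl -mulrA scalerA.
exists (cabs (ip H v v)^-1 * hnorm v * hnorm v) => x.
rewrite /line hnormZ /cabs sqnM sqrtrM ?sqn_ge0 // -!/(cabs _).
have := ler_wpM2l (mulr_ge0 (cabs_ge0 (ip H v v)^-1) (hnorm_ge0 v)) (cabs_ip x v).
by move=> h; apply: le_trans (le_trans _ h) _; rewrite le_eqVlt; apply/orP; left;
  apply/eqP; ring.
Qed.

Lemma adjoint_line (v : H) : adjoint_of (line v) (line v).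
Proof.
move=> x y; rewrite /line ipZl ipZr (ipC y v) rmorphM /= conjcK fmorphV /= -ipC; ring.
Qed.

Lemma line_eig (v : H) : line v v = v.
Proof.
rewrite /line; have [->|v0] := eqVneq v 0; first by rewrite scaler0.
by rewrite divff ?scale1r // gt_eqF // neq0_dnorm_gt0.
Qed.

Lemma line_orth (v x : H) : ip H x v = 0 -> line v x = 0.
Proof. by move=> e; rewrite /line e mul0r scale0r. Qed.

Lemma vac_fvec : vac = fvec nil_index.
Proof. by rewrite fvec_nil. Qed.

(** The projection onto the closed span of the [fvec u] with [u] nonempty *)
Definition mid : H -> H := id \- line vac \- line resid.

Lemma midE : mid = (-1) \*: line resid \+ ((-1) \*: line vac \+ id).
Proof. by apply/funext => x /=; rewrite !scaleN1r /mid /= addrC (addrC x). Qed.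

Lemma bounded_mid : bounded_op mid.
Proof.
rewrite midE; apply: bounded_lin; first exact: bounded_line.
by apply: bounded_lin; [exact: bounded_line|exact: bounded_id].
Qed.

Lemma adjoint_mid : adjoint_of mid mid.
Proof. by move=> x y; rewrite /mid /= !ipBl !ipBr !adjoint_line. Qed.

Lemma vac_line_fvec u : line vac (fvec u) = if u == nil_index then fvec u else 0.
Proof.
case: eqP => [->|/eqP/negPf u0]; first by rewrite -vac_fvec line_eig.
by apply: line_orth; rewrite vac_fvec fvec_orth u0.
Qed.

Lemma vac_line_resid : line vac resid = 0.
Proof. by apply: line_orth; rewrite vac_fvec resid_fvec. Qed.

Lemma resid_line_fvec u : line resid (fvec u) = 0.
Proof. by apply: line_orth; rewrite fvec_resid. Qed.

Lemma mid_fvec u : mid (fvec u) = if u == nil_index then 0 else fvec u.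
Proof.
rewrite /mid /= vac_line_fvec resid_line_fvec subr0.
by case: eqP; rewrite ?subrr ?subr0.
Qed.

Lemma mid_resid : mid resid = 0.
Proof. by rewrite /mid /= vac_line_resid line_eig subr0 subrr. Qed.

(** The operators that turn out to form the tail algebra *)
Definition diag (a b c : R[i]) : H -> H :=
  a \*: line vac \+ (b \*: mid \+ c \*: line resid).

Lemma bounded_scale c (S : H -> H) : bounded_op S -> bounded_op (c \*: S).
Proof.
move=> bS; have := bounded_lin c bS bounded_zero; congr bounded_op.
by apply/funext => x /=; rewrite addr0.
Qed.

Lemma bounded_diag a b c : bounded_op (diag a b c).
Proof.
apply: bounded_lin; first exact: bounded_line.
by apply: bounded_lin; [exact: bounded_mid|apply: bounded_scale; exact: bounded_line].
Qed.

Lemma diag_fvec a b c u :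
  diag a b c (fvec u) = (if u == nil_index then a else b) *: fvec u.
Proof.
rewrite /diag /= vac_line_fvec mid_fvec resid_line_fvec.
by case: eqP; rewrite ?scaler0 ?addr0 ?add0r.
Qed.

Lemma diag_vac a b c : diag a b c vac = a *: vac.
Proof. by rewrite vac_fvec diag_fvec eqxx. Qed.

Lemma diag_resid a b c : diag a b c resid = c *: resid.
Proof. by rewrite /diag /= vac_line_resid mid_resid line_eig !scaler0 !add0r. Qed.

Lemma adjoint_diag a b c :
  adjoint_of (diag a b c) (diag (conjc a) (conjc b) (conjc c)).
Proof.
move=> x y; rewrite /diag /= !ipDl !ipDr (ipZl a) (ipZl b) (ipZl c).
rewrite (ipZr (conjc a)) (ipZr (conjc b)) (ipZr (conjc c)) !conjcK.
by rewrite !adjoint_line adjoint_mid.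
Qed.

Lemma diag_comp a b c a' b' c' :
  diag a b c \o diag a' b' c' = diag (a * a') (b * b') (c * c').
Proof.
apply: op_ext; [|exact: bounded_diag| |].
- by apply: bounded_comp; exact: bounded_diag.
- rewrite /= !diag_resid linmapZ ?diag_resid ?scalerA 1?mulrC //.
  exact: (bounded_diag _ _ _).1.
- move=> u; rewrite /= !diag_fvec linmapZ ?diag_fvec ?scalerA; last exact: (bounded_diag _ _ _).1.
  by case: eqP => _; rewrite mulrC.
Qed.

Lemma diag_lin d a b c a' b' c' :
  diag (d * a + a') (d * b + b') (d * c + c') =
  d \*: diag a b c \+ diag a' b' c'.
Proof.
apply: op_ext; [exact: bounded_diag| | |].
- by apply: bounded_lin; exact: bounded_diag.
- by rewrite /= !diag_resid scalerDl scalerA.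
- move=> u; rewrite /= !diag_fvec scalerA -scalerDl.
  by case: eqP.
Qed.

Lemma line_pos (v x : H) : 0 <= ip H (line v x) x.
Proof.
have <- : line v (line v x) = line v x.
  have lv := (bounded_line v).1.
  have -> : line v x = (ip H x v / ip H v v) *: v by [].
  by rewrite (linmapZ _ _ lv) line_eig.
by rewrite adjoint_line ip_ge0.
Qed.

Lemma mid_idem : mid \o mid = mid.
Proof.
apply: op_ext; [|exact: bounded_mid| |].
- by apply: bounded_comp; exact: bounded_mid.
- by rewrite /= mid_resid linmap0 //; exact: bounded_mid.1.
- move=> u; rewrite /= mid_fvec; case: eqP => [_|/eqP/negPf u0].
    by rewrite linmap0 //; exact: bounded_mid.1.
  by rewrite mid_fvec u0.
Qed.

Lemma diag_pos a b c : 0 <= a -> 0 <= b -> 0 <= c -> positive_op (diag a b c).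
Proof.
move=> a0 b0 c0; split; first exact: bounded_diag.
move=> x; rewrite /diag /= !ipDl (ipZl a) (ipZl b) (ipZl c) !addr_ge0 ?mulr_ge0 ?line_pos //.
by rewrite -mid_idem /= adjoint_mid ip_ge0.
Qed.

Lemma orth_total y : ip H resid y = 0 -> (forall u, ip H (fvec u) y = 0) -> y = 0.
Proof.
move=> hr hf; apply: ip_inj => z; rewrite ip0l ipC.
rewrite (@total_functional (fun x => ip H x y) (hnorm y))
  ?rmorph0 //.
- by move=> c x x'; rewrite ipDl ipZl.
- by move=> x; rewrite mulrC; exact: cabs_ip.
Qed.

(** * The process attached to the state *)

Lemma M_add X Y : M X -> M Y -> M (X \+ Y).
Proof.
move=> MX MY; have := star_alg_linear star_alg_M 1 MX MY; congr (monotone_alg R).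
by apply/funext => f /=; rewrite scale1r.
Qed.

Lemma M_scale c X : M X -> M (c \*: X).
Proof.
move=> MX; have := star_alg_linear star_alg_M c MX M_zero; congr (monotone_alg R).
by apply/funext => f /=; rewrite addr0.
Qed.

Lemma pi_add X Y x : M X -> M Y -> pi (X \+ Y) x = pi X x + pi Y x.
Proof.
move=> MX MY; have -> : X \+ Y = 1 \*: X \+ Y.
  by apply/funext => f /=; rewrite scale1r.
by rewrite (GNS_linear gns) //= scale1r.
Qed.

Lemma pi_scale c X x : M X -> pi (c \*: X) x = c *: pi X x.
Proof.
move=> MX; have -> : c \*: X = c \*: X \+ (fun=> 0).
  by apply/funext => f /=; rewrite addr0.
by rewrite (GNS_linear gns) //= ?(pi_zero gns) ?addr0 //; exact: M_zero.
Qed.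

Let an j := pi (annih j).
Let cr j := pi (create j).

Let M_ac j : M (annih j \o create j) := M_above j.
Let M_ca j : M (create j \o annih j) := M_comp (M_create j) (M_annih j).

Lemma below_opE j : below j = (-1) \*: (create j \o annih j) \+
   ((-1) \*: (annih j \o create j) \+ id) :> (F -> F).
Proof. by apply/funext => f; rewrite /below /= !scaleN1r addrC (addrC f). Qed.

Lemma M_below j : M (below j).
Proof.
rewrite below_opE; apply: (star_alg_linear star_alg_M) => //.
by apply: (star_alg_linear star_alg_M) => //; exact: M_id.
Qed.

Lemma M_sample j a : M (sample_op j a).
Proof.
rewrite /sample_op; repeat apply: M_add; apply: M_scale => //.
- exact: M_annih.
- exact: M_create.
- exact: M_below.
Qed.

Lemma pi_below j x : pi (below j) x = x - an j (cr j x) - cr j (an j x).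
Proof.
rewrite below_opE pi_add ?pi_scale ?pi_add ?pi_scale ?(GNS_id gns) //; last first.
- by apply: M_add; [exact: M_scale|exact: M_id].
- exact: M_scale.
- exact: M_id.
- exact: M_scale.
rewrite (pi_comp gns _ (M_create j) (M_annih j)) (pi_comp gns _ (M_annih j) (M_create j)).
by rewrite !scaleN1r addrC (addrC _ x).
Qed.

Lemma processE j a x : proc j a x =
  a.1 0 0 *: an j (cr j x) + a.1 0 1 *: an j x + a.1 1 0 *: cr j x +
  a.1 1 1 *: cr j (an j x) + a.2 *: (x - an j (cr j x) - cr j (an j x)).
Proof.
have Man := M_annih (R := R) j; have Mcr := M_create (R := R) j.
have Mbe := M_below j.
have M1 := M_scale (a.1 0 0) (M_ac j); have M2 := M_scale (a.1 0 1) Man.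
have M3 := M_scale (a.1 1 0) Mcr; have M4 := M_scale (a.1 1 1) (M_ca j).
have M5 := M_scale a.2 Mbe.
have M12 := M_add M1 M2; have M123 := M_add M12 M3; have M1234 := M_add M123 M4.
rewrite /proc /state_process /sample_op.
rewrite (pi_add _ M1234 M5) (pi_add _ M123 M4) (pi_add _ M12 M3) (pi_add _ M1 M2).
rewrite !pi_scale // pi_below.
by rewrite (pi_comp gns _ (M_create j) (M_annih j)) (pi_comp gns _ (M_annih j) (M_create j)).
Qed.

Lemma process_above j x : proc j (delta_mx 0 0, 0) x = pi (above j) x.
Proof.
rewrite processE /= !mxE /= !scale0r !addr0 scale1r.
exact: esym (pi_comp gns x (M_annih j) (M_create j)).
Qed.

Lemma process_below j x : proc j (0, 1) x = pi (below j) x.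
Proof. by rewrite processE /= !mxE !scale0r !add0r scale1r pi_below. Qed.

Lemma bounded_process j a : bounded_op (proc j a).
Proof. exact: (GNS_bounded gns (M_sample j a)). Qed.

Lemma commute_process (T : H -> H) j a : linear T ->
  commute T (an j) -> commute T (cr j) -> commute T (proc j a).
Proof.
move=> lT ca cc; apply/funext => x /=; rewrite !processE.
rewrite !(linmapD _ _ lT) !(linmapZ _ _ lT) !(linmapB _ _ lT).
by rewrite !(commuteE _ ca) !(commuteE _ cc) !(commuteE _ ca).
Qed.

Lemma commute_basis (T : H -> H) (h : mono_index -> option mono_index) c j a :
  bounded_op T -> T resid = c *: resid -> (forall u, T (fvec u) = oapp fvec 0 (h u)) ->
  (forall u, obind h (pop j u) = obind (pop j) (h u)) ->
  (forall u, obind h (push j u) = obind (push j) (h u)) ->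
  commute T (proc j a).
Proof.
move=> bT Tr Tf hpop hpush; have lT := bT.1.
have ban : bounded_op (an j) := GNS_bounded gns (M_annih j).
have bcr : bounded_op (cr j) := GNS_bounded gns (M_create j).
apply: commute_process => //; (apply: op_ext; [exact: bounded_comp|exact: bounded_comp| |]).
- rewrite /= Tr linmapZ; last exact: ban.1.
  by rewrite /an annih_resid linmap0 // scaler0.
- move=> u; rewrite /= Tf /an annih_fvec.
  transitivity (oapp fvec 0 (obind h (pop j u))).
    by case: (pop j u) => [v|] /=; rewrite ?linmap0.
  rewrite hpop; case: (h u) => [v|] /=; first by rewrite annih_fvec.
  by rewrite linmap0 //; exact: ban.1.
- rewrite /= Tr linmapZ; last exact: bcr.1.
  by rewrite /cr create_resid linmap0 // scaler0.
- move=> u; rewrite /= Tf /cr create_fvec.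
  transitivity (oapp fvec 0 (obind h (push j u))).
    by case: (push j u) => [v|] /=; rewrite ?linmap0.
  rewrite hpush; case: (h u) => [v|] /=; first by rewrite create_fvec.
  by rewrite linmap0 //; exact: bcr.1.
Qed.

Lemma line_resid_commute j a : commute (line resid) (proc j a).
Proof.
apply: (@commute_basis _ (fun=> None) 1) => //.
- exact: bounded_line.
- by rewrite line_eig scale1r.
- exact: resid_line_fvec.
- by move=> u; case: (pop j u).
- by move=> u; case: (push j u).
Qed.

Lemma local_commute (K : set int) (T T' X : H -> H) : bounded_op T -> adjoint_of T T' ->
  (forall j a, K j -> commute T (proc j a) /\ commute T' (proc j a)) ->
  local_alg proc K X -> [/\ bounded_op X, commute T X & commute T' X].
Proof.
move=> bT TT' hT; apply: vN_gen_commute => // S [j Kj [a _ <-]].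
by have [] := hT j a Kj; split=> //; exact: bounded_process.
Qed.

(** The tail algebra lies in the bicommutant attached to any single finite [I]. *)
Lemma tail_commute (I : {fset int}) (T T' X : H -> H) :
  bounded_op T -> adjoint_of T T' ->
  (forall j a, j \notin I -> commute T (proc j a) /\ commute T' (proc j a)) ->
  tail_alg proc X -> commute X T.
Proof.
move=> bT TT' hT tX; have [_ cX] := tX I Logic.I; apply: cX; split=> //.
move=> S [K KI /local_commute]; case/(_ T T') => // j a jK.
by apply: hT; move/fdisjointP: KI; apply.
Qed.

(** * Elements of the tail algebra are diagonal *)

(** The partial bijection [t ++ v |-> t ++ u], where no entry of [t] lies in [I] *)
Definition tail_map (I : {fset int}) u v w : option mono_index :=
  let n := (size (val w) - size (val v))%N in
  if (drop n (val w) == val v) && all (fun k => k \notin I) (take n (val w))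
  then insub (take n (val w) ++ val u) else None.

Lemma tail_mapP I u v w w' : tail_map I u v w = Some w' <->
  exists t : seq int, [/\ all (fun k => k \notin I) t, val w = t ++ val v &
    val w' = t ++ val u].
Proof.
rewrite /tail_map; split.
  case: ifP => // /andP[/eqP ev tI]; case: insubP => // z _ ez [<-].
  exists (take (size (val w) - size (val v)) (val w)); split=> //.
  by rewrite -[X in _ = _ ++ X]ev cat_take_drop.
move=> [t [tI ew ew']].
have -> : (size (val w) - size (val v))%N = size t by rewrite ew size_cat addnK.
rewrite ew drop_size_cat // take_size_cat // eqxx tI /= -ew'.
by rewrite insubT; [exact: valP|move=> h; congr Some; exact: val_inj].
Qed.

(** Under this condition the operators indexed outside [I] do not distinguish
    [t ++ s] from [t ++ s']: they cannot remove an entry of [s] or [s'], and [k] can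
    be put in front of the one exactly when it can be put in front of the other. *)
Definition compat (I : {fset int}) (s s' : seq int) : Prop :=
  match s, s' with
  | [::], [::] => True
  | a :: _, b :: _ => [/\ a \in I, b \in I & forall k, k \notin I -> (k < a) = (k < b)]
  | _, _ => False
  end.

Lemma compat_sym I s s' : compat I s s' -> compat I s' s.
Proof.
case: s s' => [|a s] [|b s'] //= [aI bI h]; split=> // k kI.
by rewrite h.
Qed.

Lemma compat_head I k s s' t : compat I s s' -> k \notin I -> s <> k :: t.
Proof. by case: s s' => [|a s] [|b s'] //= [aI _ _] kI [e]; rewrite -e aI in kI. Qed.

Lemma compat_sorted I k (t s s' : seq int) : compat I s s' -> k \notin I ->
  sorted <%R (k :: t ++ s) -> sorted <%R (t ++ s') -> sorted <%R (k :: t ++ s').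
Proof.
case: t => [|a t]; last by rewrite /= => _ _ /andP[-> _] ->.
case: s s' => [|a s] [|b s'] //= [aI bI h] kI /andP[ka _] ->.
by rewrite -h ?ka.
Qed.

Lemma tail_map_pop I u v j w : compat I (val u) (val v) -> j \notin I ->
  obind (tail_map I u v) (pop j w) = obind (pop j) (tail_map I u v w).
Proof.
move=> uv jI; apply: option_ext => z; split.
  case e : (pop j w) => [s|] //= /tail_mapP[t [tI es ez]].
  have ew := (popP j s w).1 e.
  have h : sorted <%R (j :: val z).
    rewrite ez; apply: (compat_sorted (compat_sym uv) jI); last by rewrite -ez; exact: valP.
    by rewrite -es -ew; exact: valP.
  have -> : tail_map I u v w = Some (Sub (j :: val z) h).
    by apply/tail_mapP; exists (j :: t); rewrite /= jI tI ew es ez.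
  exact/popP.
case e : (tail_map I u v w) => [w'|] //= /popP ew'.
have [t [tI ew ewt]] := (tail_mapP _ _ _ _ _).1 e.
case: t tI ew ewt => [|k t].
  by move=> _ _ eu; case: (compat_head uv jI (etrans (esym eu) ew')).
move=> /andP[_ tI] ew ewt; move: ewt; rewrite ew' cat_cons => -[jk ez].
have h : sorted <%R (t ++ val v) by apply: (@mono_tail [:: k] _ w); rewrite ew.
have -> : pop j w = Some (Sub (t ++ val v) h) by apply/popP; rewrite ew jk.
by apply/tail_mapP; exists t.
Qed.

Lemma tail_map_push I u v j w : compat I (val u) (val v) -> j \notin I ->
  obind (tail_map I u v) (push j w) = obind (push j) (tail_map I u v w).
Proof.
move=> uv jI; apply: option_ext => z; split.
  case e : (push j w) => [s|] //= /tail_mapP[t [tI es ez]].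
  have := (pushP j w s).1 e; rewrite es; case: t tI es ez => [|k t].
    by move=> _ _ _ ev; case: (compat_head (compat_sym uv) jI ev).
  rewrite cat_cons => /andP[_ tI] es ez [kj ew]; subst k.
  have h : sorted <%R (t ++ val u) by apply: (@mono_tail [:: j] _ z); rewrite ez.
  have -> : tail_map I u v w = Some (Sub (t ++ val u) h).
    by apply/tail_mapP; exists t.
  exact/pushP.
case e : (tail_map I u v w) => [w'|] //= /pushP ez.
have [t [tI ew ewt]] := (tail_mapP _ _ _ _ _).1 e.
have h : sorted <%R (j :: val w).
  rewrite ew; apply: (compat_sorted uv jI); last by rewrite -ew; exact: valP.
  by rewrite -ewt -ez; exact: valP.
have -> : push j w = Some (Sub (j :: val w) h) by apply/pushP.
by apply/tail_mapP; exists (j :: t); rewrite /= jI tI ew ez ewt.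
Qed.

(** The vectors [fvec (t ++ u)], [t] disjoint from [I], span a subspace reducing the
    algebra of the indices outside [I]; subspaces with compatible [u] and [v] carry
    equivalent representations, hence are intertwined by a partial isometry. *)
Lemma tail_intertwiner I u v : compat I (val u) (val v) ->
  exists T T' : H -> H, [/\ forall X : H -> H, tail_alg proc X -> commute X T,
    adjoint_of T T', T' resid = 0,
    forall w, T (fvec w) = oapp fvec 0 (tail_map I u v w) &
    forall w, T' (fvec w) = oapp fvec 0 (tail_map I v u w)].
Proof.
move=> uv; have vu := compat_sym uv.
have [|T [T' [bT TT' Tr T'r [Tf T'f]]]] :=
    basis_map (h := tail_map I u v) (h' := tail_map I v u).
  by move=> w w'; rewrite !tail_mapP; split=> -[t [? ? ?]]; exists t.
exists T, T'; split=> // X; apply: (tail_commute (I := I) bT TT') => j a jI; split.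
  apply: (@commute_basis _ (tail_map I u v) 0) => //.
  - by rewrite scale0r.
  - by move=> w; exact: (tail_map_pop w uv jI).
  - by move=> w; exact: (tail_map_push w uv jI).
apply: (@commute_basis _ (tail_map I v u) 0) => //.
- exact: (adjoint_bounded bT TT').
- by rewrite scale0r.
- by move=> w; exact: (tail_map_pop w vu jI).
- by move=> w; exact: (tail_map_push w vu jI).
Qed.
(** Enlarging [I] to a symmetric interval makes all nonempty sequences in it compatible. *)
Definition box (N : nat) : {fset int} :=
  [fset k in [seq n%:Z - N%:Z | n <- iota 0 (N.*2.+1)]]%fset.

Lemma mem_box N k : (k \in box N) = (`|k|%N <= N)%N.
Proof.
rewrite in_fset -[LHS]/(k \in [seq n%:Z - N%:Z | n <- iota 0 (N.*2.+1)]).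
apply/mapP/idP => [[n]|kN].
  by rewrite mem_iota => nN ->; lia.
by exists (absz (k + N%:Z)); rewrite ?mem_iota; lia.
Qed.

Lemma box_exists (s : seq int) : exists N, all (fun k => k \in box N) s.
Proof.
exists (\max_(k <- s) `|k|%N)%N; apply/allP => k ks.
by rewrite mem_box; exact: (@leq_bigmax_seq _ _ xpredT (fun k : int => `|k|%N)).
Qed.

Lemma compat_box N (s s' : seq int) : all (fun k => k \in box N) s ->
  all (fun k => k \in box N) s' -> (s == [::]) = (s' == [::]) -> compat (box N) s s'.
Proof.
case: s s' => [|a s] [|b s'] //= /andP[aN _] /andP[bN _] _; split=> // k.
by move: aN bN; rewrite !mem_box; lia.
Qed.

Lemma tail_map_id N u : all (fun k => k \in box N) (val u) ->
  tail_map (box N) u u u = Some u.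
Proof. by move=> _; apply/tail_mapP; exists [::]. Qed.

Lemma tail_map_neq N u v : all (fun k => k \in box N) (val v) -> u != v ->
  tail_map (box N) u u v = None.
Proof.
move=> vN uv; case e : (tail_map _ _ _ _) => [w|] //.
have [t [tN ev _]] := (tail_mapP _ _ _ _ _).1 e; case: t tN ev => [|k t].
  by move=> _ ev; case/eqP: uv; apply: val_inj; exact: esym ev.
by move=> /andP[kN _] ev; move: vN; rewrite ev /= (negPf kN).
Qed.

(** For [I] containing all entries of [u] and [v], the projection onto the span of
    the [fvec (t ++ u)] commutes with [X], fixes [fvec u] and kills [fvec v]. *)
Lemma tail_eigen (X : H -> H) u : tail_alg proc X ->
  X (fvec u) = (ip H (X (fvec u)) (fvec u) / mass%:C) *: fvec u.
Proof.
move=> tX; have [m0|m0] := eqVneq mass 0.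
  have [bX _] := tX fset0 Logic.I.
  by rewrite !mass0_fvec // scaler0 linmap0 //; exact: bX.1.
set c := _ / _; apply/eqP; rewrite -subr_eq0; apply/eqP/orth_total => [|v].
  have [T [T' [cT TT' T'r Tf _]]] : exists T T' : H -> H, [/\ commute X T, adjoint_of T T',
      T' resid = 0, T (fvec u) = fvec u & True].
    have [N uN] := box_exists (val u).
    have [|T [T' [cT TT' T'r Tf T'f]]] := @tail_intertwiner (box N) u u.
      exact: compat_box.
    by exists T, T'; split=> //; [exact: cT|rewrite Tf tail_map_id].
  rewrite ipC ipBl ipZl fvec_resid mulr0 subr0.
  by rewrite -{1}Tf (commuteE _ cT) TT' T'r ip0r rmorph0.
have [<-|uv] := eqVneq u v.
  rewrite ipC ipBl ipZl fvec_orth eqxx /c divfK ?subrr ?rmorph0 //.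
  by rewrite (inj_eq (@complexI R)).
have [N] := box_exists (val u ++ val v); rewrite all_cat => /andP[uN vN].
have [|T [T' [cT TT' _ Tf T'f]]] := @tail_intertwiner (box N) u u.
  exact: compat_box.
rewrite ipC ipBl ipZl fvec_orth (negPf uv) mulr0 subr0.
have Tu : T (fvec u) = fvec u by rewrite Tf tail_map_id.
by rewrite -{1}Tu (commuteE _ (cT _ tX)) TT' T'f tail_map_neq //= ip0r rmorph0.
Qed.

(** The intertwiner of [u] and [v] commutes with [X] and maps [fvec v] to [fvec u]. *)
Lemma tail_eigen_const (X : H -> H) u v : tail_alg proc X ->
  u != nil_index -> v != nil_index ->
  ip H (X (fvec u)) (fvec u) = ip H (X (fvec v)) (fvec v).
Proof.
move=> tX u0 v0.
have [N] := box_exists (val u ++ val v); rewrite all_cat => /andP[uN vN].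
have [|T [T' [cT TT' _ Tf T'f]]] := @tail_intertwiner (box N) u v.
  apply: compat_box => //; move: u0 v0; rewrite -!val_eqE /=.
  by move=> /negPf -> /negPf ->.
have Tv : T (fvec v) = fvec u.
  rewrite Tf; have -> // : tail_map (box N) u v v = Some u.
  by apply/tail_mapP; exists [::].
have T'u : T' (fvec u) = fvec v.
  rewrite T'f; have -> // : tail_map (box N) v u u = Some v.
  by apply/tail_mapP; exists [::].
by rewrite -{1}Tv (commuteE _ (cT _ tX)) TT' T'u.
Qed.

Lemma tail_diag (X : H -> H) : tail_alg proc X -> exists a b c, X = diag a b c.
Proof.
move=> tX; have [bX _] := tX fset0 Logic.I.
have crem : commute X (line resid).
  apply: (@tail_commute fset0 _ (line resid)) => //; first exact: bounded_line.
    exact: adjoint_line.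
  by move=> j a _; split; exact: line_resid_commute.
pose cu u := ip H (X (fvec u)) (fvec u) / mass%:C.
exists (cu nil_index), (cu (single 0)), (ip H (X resid) resid / ip H resid resid).
apply: op_ext => //; first exact: bounded_diag.
- by rewrite diag_resid -{1}(line_eig resid) (commuteE _ crem).
- move=> u; rewrite (tail_eigen _ tX) diag_fvec -/(cu u); case: eqP => [->//|/eqP u0].
  by rewrite /cu (@tail_eigen_const X u (single 0)).
Qed.

(** The orthogonal system [fvec] together with [resid], which has index [None] *)
Definition total_vec (o : option mono_index) : H := oapp fvec resid o.

Lemma total_vec_orth o o' : o != o' -> ip H (total_vec o) (total_vec o') = 0.
Proof.
case: o o' => [u|] [v|] //= uv.
- by rewrite fvec_orth; case: eqP => // e; rewrite e eqxx in uv.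
- exact: (fvec_resid u).
- exact: (resid_fvec v).
Qed.

(** A rank-one projection onto a vector of the orthogonal system lies in a
    bicommutant as soon as the algebra contains self-adjoint operators that fix
    this vector and kill any prescribed other one. *)
Lemma line_commute (G : set (H -> H)) o (T : H -> H) : bounded_op T ->
  (forall S, G S -> commute T S) ->
  (forall S, G S -> adjoint_of S S /\ S (total_vec o) = total_vec o) ->
  (forall o', o' != o -> exists2 S, G S & S (total_vec o') = 0) ->
  commute (line (total_vec o)) T.
Proof.
move=> bT cT GS kill; set v := total_vec o.
have Tv o' : o' != o -> ip H (T v) (total_vec o') = 0.
  move=> /kill[S gS S0]; have [aS Sv] := GS S gS.
  by rewrite /v -{1}Sv (commuteE _ (cT _ gS)) aS S0 ip0r.
have vT o' : o' != o -> ip H (T (total_vec o')) v = 0.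
  move=> /kill[S gS S0]; have [aS Sv] := GS S gS.
  by rewrite /v -{1}Sv -aS -(commuteE _ (cT _ gS)) S0 linmap0 ?ip0l //; exact: bT.1.
have lTv : line v (T v) = T v.
  apply/eqP; rewrite eq_sym -subr_eq0; apply/eqP.
  have h o' : ip H (total_vec o') (T v - line v (T v)) = 0.
    have [->|o'o] := eqVneq o' o.
      by rewrite -/v ipBr -adjoint_line line_eig subrr.
    by rewrite ipBr /line ipZr (total_vec_orth o'o) mulr0 subr0 ipC (Tv _ o'o) rmorph0.
  by apply: orth_total => [|u]; [exact: (h None)|exact: (h (Some u))].
have main o' : line v (T (total_vec o')) = T (line v (total_vec o')).
  have [->|o'o] := eqVneq o' o; first by rewrite -/v line_eig.
  rewrite (line_orth (vT _ o'o)) (line_orth (total_vec_orth o'o)).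
  by rewrite linmap0 //; exact: bT.1.
apply: op_ext; [| |exact: (main None)|by move=> u; exact: (main (Some u))].
- by apply: bounded_comp => //; exact: bounded_line.
- by apply: bounded_comp => //; exact: bounded_line.
Qed.

Lemma above_fvec_le j u k s : val u = k :: s -> k <= j -> pi (above j) (fvec u) = 0.
Proof.
move=> eu kj; rewrite (pi_comp gns) //; [|exact: M_annih|exact: M_create].
rewrite create_fvec /push; case: insubP => [w|] /=.
  by rewrite eu /= ltNge kj.
by rewrite linmap0 //; apply: (pi_linear gns); exact: M_annih.
Qed.

Lemma below_resid j : pi (below j) resid = resid.
Proof.
rewrite pi_below /an /cr create_resid annih_resid.
by rewrite (linmap0 (pi_linear gns (M_annih j))) (linmap0 (pi_linear gns (M_create j))) !subr0.
Qed.

Lemma below_fvec j u : sorted <%R (j :: val u) -> pi (below j) (fvec u) = 0.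
Proof.
move=> ju; rewrite pi_below -[an j _](pi_comp gns) //; [|exact: M_annih|exact: M_create].
rewrite -[annih j \o create j]/(above j) (above_fvec ju) subrr sub0r.
rewrite /an annih_fvec; case e : (pop j u) => [w|] /=.
  by move: ju; rewrite ((popP j w u).1 e) /= ltxx.
by rewrite linmap0 ?oppr0 //; apply: (pi_linear gns); exact: M_create.
Qed.

Lemma below_adjoint j : adjoint_of (pi (below j)) (pi (below j)).
Proof.
apply: (GNS_adjoint gns (M_below j)).
have h (S T : F -> F) : adjoint_of S S -> adjoint_of T T ->
    adjoint_of (-1 \*: S \+ T) (-1 \*: S \+ T).
  by move=> hS hT; have := adjoint_lin (-1) hS hT; rewrite rmorphN rmorph1.
rewrite below_opE; apply: (h); last by apply: (h); [exact: adjoint_above|].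
apply: adjoint_comp; first exact: annih_adjoint.
by apply: adjoint_sym; exact: annih_adjoint.
Qed.

(** The projection onto the line of [vac] is the limit of [above j] as [j] tends to
    [+oo], and the one onto the line of [resid] is the limit of [below j] as [j] tends
    to [-oo]. Both limits run through indices outside any given finite set. *)
Lemma tail_of_diag a b c : tail_alg proc (diag a b c).
Proof.
move=> I _; split; first exact: bounded_diag.
move=> T [bT cT].
have cproc j s : j \notin I -> commute T (proc j s).
  move=> jI; apply: cT; exists [fset j]%fset; first by rewrite /= fdisjoint1X.
  by apply: vN_gen_sub; exists j; [rewrite /= inE|exists s].
have cabove j : j \notin I -> commute T (pi (above j)).
  move=> jI; have := cproc j (delta_mx 0 0, 0) jI; congr (commute T).
  by apply/funext => x; exact: process_above.
have cbelow j : j \notin I -> commute T (pi (below j)).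
  move=> jI; have := cproc j (0, 1) jI; congr (commute T).
  by apply/funext => x; exact: process_below.
have [N0 IN0] := box_exists (enum_fset I).
have notI N k : (N0 <= N)%N -> (N < `|k|)%N -> k \notin I.
  move=> NN Nk; apply/negP => /(allP IN0); rewrite mem_box; lia.
have cvac : commute (line vac) T.
  rewrite vac_fvec.
  apply: (@line_commute [set S | exists2 j, j \notin I & S = pi (above j)]
     (Some nil_index)) => //.
  - by move=> S [j jI ->]; exact: cabove.
  - move=> S [j jI ->]; split; first by move=> x y; exact: (pi_above_adjoint gns).
    by rewrite /= -vac_fvec above_vac.
  - move=> [u|] ou; last first.
      exists (pi (above (N0.+1)%:Z)); last exact: above_resid.
      by exists (N0.+1)%:Z => //; apply: (notI N0); lia.
    have [e|[k [v eu]]] := mono_index_cases u; first by rewrite e eqxx in ou.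
    (* outside [I], and not below the first entry of [u] *)
    pose j : int := (N0 + `|k|).+1%:Z.
    exists (pi (above j)); first by exists j => //; apply: (notI N0); rewrite /j; lia.
    by apply: (above_fvec_le eu); rewrite /j; lia.
have crem : commute (line resid) T.
  apply: (@line_commute [set S | exists2 j, j \notin I & S = pi (below j)] None) => //.
  - by move=> S [j jI ->]; exact: cbelow.
  - move=> S [j jI ->]; split; first exact: below_adjoint.
    exact: below_resid.
  - move=> [u|] // _.
    have [e|[k [v eu]]] := mono_index_cases u.
      exists (pi (below (- (N0.+1)%:Z))); last by apply: below_fvec; rewrite e.
      by exists (- (N0.+1)%:Z) => //; apply: (notI N0); lia.
    (* outside [I], and below the first entry of [u] *)
    pose j : int := - (N0 + `|k|).+1%:Z.
    exists (pi (below j)); first by exists j => //; apply: (notI N0); rewrite /j; lia.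
    apply: below_fvec; rewrite eu sorted_cons2 -eu (valP u) andbT /j; lia.
apply/funext => x /=; rewrite /diag /mid /=.
rewrite !(linmapD _ _ bT.1) !(linmapZ a _ bT.1, linmapZ b _ bT.1, linmapZ c _ bT.1).
by rewrite !(linmapB _ _ bT.1) !(commuteE _ cvac) !(commuteE _ crem).
Qed.

(** * The conditional expectation *)

(** The value of the vector state of [v], or [0] if [v = 0] *)
Definition vstate (v : H) (X : H -> H) : R[i] := ip H (X v) v / ip H v v.

Lemma vstateK (v : H) (X : H -> H) : linear X -> vstate v X * ip H v v = ip H (X v) v.
Proof.
move=> lX; have [->|v0] := eqVneq v 0; first by rewrite !ip0r mulr0.
by rewrite /vstate divfK // gt_eqF // neq0_dnorm_gt0.
Qed.

Lemma vstate_eig (v : H) (X : H -> H) a : X v = a *: v -> vstate v X *: v = a *: v.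
Proof.
move=> Xv; have [->|v0] := eqVneq v 0; first by rewrite !scaler0.
by rewrite /vstate Xv ipZl mulfK // gt_eqF // neq0_dnorm_gt0.
Qed.

Lemma vstate_lin (v : H) c (X Y : H -> H) :
  vstate v (c \*: X \+ Y) = c * vstate v X + vstate v Y.
Proof. by rewrite /vstate /= ipDl ipZl mulrDl mulrA. Qed.

Lemma vstate_ge0 (v : H) (X : H -> H) : positive_op X -> 0 <= vstate v X.
Proof. by move=> [_ pX]; rewrite /vstate divr_ge0 ?ip_ge0. Qed.

Lemma cabsM (a b : R[i]) : cabs (a * b) = cabs a * cabs b.
Proof. by rewrite /cabs sqnM sqrtrM ?sqn_ge0. Qed.

Lemma vstate_bound (v : H) (X : H -> H) (k : R) : 0 <= k ->
  (forall x, hnorm (X x) <= k * hnorm x) -> cabs (vstate v X) <= k.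
Proof.
move=> k0 hX; have [->|v0] := eqVneq v 0.
  by rewrite /vstate !ip0r mul0r /cabs sqn0 sqrtr0.
have n0 : 0 < nsq v by rewrite -ltcR -ipxx neq0_dnorm_gt0.
rewrite /vstate cabsM ipxx.
have -> : cabs (nsq v)%:C^-1 = (nsq v)^-1.
  rewrite -fmorphV /= /cabs /sqn /= expr0n addr0 sqrtr_sqr ger0_norm //.
  by rewrite invr_ge0 ltW.
rewrite ler_pdivrMr //; apply: le_trans (cabs_ip _ _) _.
by rewrite -hnormE expr2 mulrA ler_wpM2r ?hnorm_ge0.
Qed.

Section Expectation.
Variable Lim : (nat -> R[i]) -> R[i].
Hypothesis Lim_lin : forall c z z', bounded_seq z -> bounded_seq z' ->
  Lim (fun n => c * z n + z' n) = c * Lim z + Lim z'.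
Hypothesis Lim_ge0 : forall z, bounded_seq z -> (forall n, 0 <= z n) -> 0 <= Lim z.
Hypothesis Lim_const : forall z c,
  (exists N, forall n, (N <= n)%N -> z n = c) -> Lim z = c.

Definition escape (n : nat) : H := fvec (single (- n%:Z)).

Definition far_state (X : H -> H) : R[i] := Lim (fun n => vstate (escape n) X).

(** On the lines of [vac] and [resid] the expectation can only be the vector state.
    On the rest of [H] it needs a state with the same value on all projections onto
    the sequences beginning with [i]. These are orthogonal with sum [mid], so the
    value is [0] and the state cannot be normal; a generalized limit of the vector
    states of [e_(-n)] does it. *)
Definition tail_exp (X : H -> H) : H -> H :=
  diag (vstate vac X) (far_state X) (vstate resid X).

Lemma bounded_vstate_seq (X : H -> H) : bounded_op X ->
  bounded_seq (fun n => vstate (escape n) X).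
Proof.
by move=> /bounded_pos[k k0 hX]; exists k => n; apply: vstate_bound => //; exact: ltW.
Qed.

Lemma Lim_scale c z : bounded_seq z -> Lim (fun n => c * z n) = c * Lim z.
Proof.
move=> bz; have b0 : bounded_seq (fun=> 0 : R[i]).
  by exists 0 => n; rewrite /cabs sqn0 sqrtr0.
have := Lim_lin c bz b0; rewrite (@Lim_const (fun=> 0) 0); last by exists 0%N.
by rewrite addr0 => <-; congr Lim; apply/funext => n; rewrite addr0.
Qed.

Lemma single_neq_nil k : (single k == nil_index) = false.
Proof. by rewrite -val_eqE. Qed.

Lemma vstate_diag (v : H) a b c a' b' c' (X : H -> H) d d' :
  (forall y, ip H (diag a b c y) v = d * ip H y v) ->
  diag a' b' c' v = d' *: v -> linear X ->
  vstate v (diag a b c \o X \o diag a' b' c') = d * d' * vstate v X.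
Proof.
move=> hd hd' lX; rewrite /vstate /= hd hd' linmapZ // ipZl; ring.
Qed.

Lemma ip_diag_eig (v : H) a b c d (y : H) :
  (forall a b c : R[i], diag a b c v = (d a b c) *: v) ->
  conjc (d (conjc a) (conjc b) (conjc c)) = d a b c ->
  ip H (diag a b c y) v = d a b c * ip H y v.
Proof. by move=> hd dc; rewrite adjoint_diag hd ipZr dc. Qed.

Lemma tail_exp_bimodule a b c a' b' c' (X : H -> H) : bounded_op X ->
  tail_exp (diag a b c \o X \o diag a' b' c') =
  diag a b c \o tail_exp X \o diag a' b' c'.
Proof.
move=> bX; rewrite /tail_exp !diag_comp.
have lX := bX.1.
have -> : vstate vac (diag a b c \o X \o diag a' b' c') = a * (vstate vac X * a').
  rewrite (@vstate_diag _ _ _ _ _ _ _ _ a a') //; first by rewrite -mulrA [a' * _]mulrC.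
    move=> y; rewrite (@ip_diag_eig _ _ _ _ (fun a _ _ => a)) ?conjcK //.
    exact: diag_vac.
  exact: diag_vac.
have -> : vstate resid (diag a b c \o X \o diag a' b' c') = c * (vstate resid X * c').
  rewrite (@vstate_diag _ _ _ _ _ _ _ _ c c') //; first by rewrite -mulrA [c' * _]mulrC.
    move=> y; rewrite (@ip_diag_eig _ _ _ _ (fun _ _ c => c)) ?conjcK //.
    exact: diag_resid.
  exact: diag_resid.
suff -> : far_state (diag a b c \o X \o diag a' b' c') = b * (far_state X * b').
  by rewrite !mulrA.
rewrite [far_state X * _]mulrC mulrA /far_state -Lim_scale; last exact: bounded_vstate_seq.
congr Lim; apply/funext => n.
have hd (a0 b0 c0 : R[i]) : diag a0 b0 c0 (escape n) = b0 *: escape n.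
  by rewrite /escape diag_fvec single_neq_nil.
rewrite (@vstate_diag _ _ _ _ _ _ _ _ b b') // => y.
by rewrite (@ip_diag_eig _ _ _ _ (fun _ b _ => b)) ?conjcK.
Qed.

Lemma tail_exp_diag a b c : tail_exp (diag a b c) = diag a b c.
Proof.
have bD a0 b0 c0 := bounded_diag a0 b0 c0.
apply: op_ext => //; first exact: bD.
  rewrite /tail_exp !diag_resid; apply: vstate_eig.
  exact: diag_resid.
move=> u; rewrite /tail_exp !diag_fvec; case: eqP => [->|_].
  rewrite fvec_nil; apply: vstate_eig; exact: diag_vac.
have [m0|m0] := eqVneq mass 0; first by rewrite mass0_fvec ?scaler0.
congr (_ *: _); apply: Lim_const; exists 0%N => n _.
rewrite /vstate /escape diag_fvec single_neq_nil ipZl.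
rewrite mulfK // fvec_orth eqxx.
by rewrite (inj_eq (@complexI R)).
Qed.

Lemma local_bounded (K : set int) (X : H -> H) : local_alg proc K X ->
  bounded_op X /\ commute (line resid) X.
Proof.
move=> lX; have [] // := local_commute (bounded_line resid) (adjoint_line resid) _ lX.
by move=> j a _; split; exact: line_resid_commute.
Qed.

Lemma tail_exp_cond_exp : is_cond_exp (local_alg proc setT) (tail_alg proc) tail_exp.
Proof.
split.
- by move=> S _; exact: tail_of_diag.
- move=> c S T /local_bounded[bS _] /local_bounded[bT _].
  rewrite /tail_exp !vstate_lin -diag_lin; congr (diag _ _ _).
  rewrite /far_state -Lim_lin; [|exact: bounded_vstate_seq|exact: bounded_vstate_seq].
  by congr Lim; apply/funext => n; rewrite vstate_lin.
- move=> S /local_bounded[bS _] pS; apply: diag_pos.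
  + exact: vstate_ge0.
  + by apply: Lim_ge0; [exact: bounded_vstate_seq|move=> n; exact: vstate_ge0].
  + exact: vstate_ge0.
- by move=> S /tail_diag[a [b [c ->]]]; exact: tail_exp_diag.
- move=> S1 S2 T /tail_diag[a [b [c ->]]].
  move=> /tail_diag[a' [b' [c' ->]]] /local_bounded[bT _].
  exact: tail_exp_bimodule.
Qed.

(** An operator commuting with the projection onto the line of [resid] does not
    mix the two components of [xi]. *)
Lemma vector_state_split (X : H -> H) : bounded_op X -> commute (line resid) X ->
  ip H (X xi) xi = ip H (X vac) vac + ip H (X resid) resid.
Proof.
move=> bX cX; rewrite [in LHS]xi_split (linmapD _ _ bX.1) ipDl !(ipDr vac resid).
have -> : ip H (X vac) resid = 0.
  rewrite -[in LHS](line_eig resid) -adjoint_line (commuteE _ cX).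
  by rewrite vac_fvec resid_line_fvec linmap0 ?ip0l //; exact: bX.1.
have -> : ip H (X resid) vac = 0.
  rewrite -[in LHS](line_eig resid) -(commuteE _ cX) adjoint_line.
  by rewrite vac_fvec resid_line_fvec ip0r.
by rewrite addr0 add0r.
Qed.

Lemma diag_xi a b c a' b' c' : ip H ((diag a b c \o diag a' b' c') xi) xi =
  a * a' * ip H vac vac + c * c' * ip H resid resid.
Proof.
have bD := bounded_diag (a * a') (b * b') (c * c').
rewrite diag_comp vector_state_split //.
  by rewrite diag_vac diag_resid !ipZl.
apply: op_ext.
- by apply: bounded_comp => //; exact: bounded_line.
- by apply: bounded_comp => //; exact: bounded_line.
- rewrite /= line_eig diag_resid linmapZ ?line_eig //.
  exact: (bounded_line resid).1.
- move=> u; rewrite /= resid_line_fvec diag_fvec.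
  rewrite linmapZ; last exact: (bounded_line resid).1.
  by rewrite resid_line_fvec scaler0 linmap0 //; exact: bD.1.
Qed.

Lemma tail_exp_state (X : H -> H) : local_alg proc setT X ->
  ip H (tail_exp X xi) xi = ip H (X xi) xi.
Proof.
move=> /local_bounded[bX cX]; rewrite (vector_state_split bX cX).
have := diag_xi (vstate vac X) (far_state X) (vstate resid X) 1 1 1.
by rewrite diag_comp !mulr1 !(vstateK _ bX.1).
Qed.

Lemma vstate_process (v : H) j a : pi (annih j) v = 0 -> ip H (pi (create j) v) v = 0 ->
  vstate v (proc j a) =
  a.1 0 0 * vstate v (pi (above j)) + a.2 * vstate v (pi (below j)).
Proof.
move=> av cv; rewrite /vstate processE -pi_below /an /cr av.
have cz : pi (create j) 0 = 0.
  by rewrite linmap0 //; apply: (pi_linear gns); exact: M_create.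
rewrite cz !scaler0 !addr0 !ipDl !ipZl cv mulr0 addr0.
rewrite -(pi_comp gns) //; [|exact: M_annih|exact: M_create].
by rewrite mulrDl !mulrA.
Qed.

(** The process takes on [e_(-n)] the value it takes on [resid] as soon as [-n] is
    smaller than its index. *)
Lemma tail_exp_identical i k a : tail_exp (proc i a) = tail_exp (proc k a).
Proof.
rewrite /tail_exp; congr (diag _ _ _).
- have main j : vstate vac (proc j a) = a.1 0 0 * (ip H vac vac / ip H vac vac).
    rewrite vstate_process; [| exact: annih_vac|]; last first.
      by rewrite (pi_adjoint gns) annih_vac ip0r.
    rewrite /vstate above_vac pi_below /an /cr.
    rewrite annih_vac -(pi_comp gns) //; [|exact: M_annih|exact: M_create].
    rewrite -[annih j \o create j]/(above j) above_vac subrr sub0r.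
    rewrite linmap0 ?oppr0 ?ip0l ?mul0r ?mulr0 ?addr0 //.
    by apply: (pi_linear gns); exact: M_create.
  by rewrite !main.
- have main j : far_state (proc j a) = a.2 * (mass%:C / mass%:C).
    apply: Lim_const; exists (`|j|.+1)%N => n jn.
    have aE : pi (annih j) (escape n) = 0.
      rewrite /escape annih_fvec; case e : (pop j _) => [w|] //=.
      by have /= := (popP _ _ _).1 e; case; lia.
    rewrite vstate_process //; last by rewrite (pi_adjoint gns) aE ip0r.
    have ab : pi (above j) (escape n) = 0.
      by apply: (@above_fvec_le _ _ (- n%:Z) [::]) => //; lia.
    rewrite /vstate ab ip0l mul0r mulr0 add0r pi_below /an /cr aE.
    rewrite -(pi_comp gns) //; [|exact: M_annih|exact: M_create].
    rewrite -[annih j \o create j]/(above j) ab subr0.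
    rewrite linmap0 ?subr0; last by apply: (pi_linear gns); exact: M_create.
    by rewrite /escape fvec_orth eqxx.
  by rewrite !main.
- have main j : vstate resid (proc j a) = a.2 * (ip H resid resid / ip H resid resid).
    rewrite vstate_process; [| exact: annih_resid|]; last first.
      by rewrite create_resid ip0l.
    by rewrite /vstate above_resid below_resid ip0l mul0r mulr0 add0r.
  by rewrite !main.
Qed.

Definition support_map (K : {fset int}) u : option mono_index :=
  if all (fun k => k \in K) (val u) then Some u else None.

(** The projection onto the span of the [fvec u] with [u] contained in [K]
    commutes with the algebra of [K] and with the tail algebra. *)
Lemma support_projection (K : {fset int}) : exists2 P : H -> H,
  [/\ bounded_op P, adjoint_of P P, P vac = vac, P resid = 0 &
     forall u, P (fvec u) = oapp fvec 0 (support_map K u)] &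
  forall X : H -> H, vN_gen (local_alg proc [set` K] `|` tail_alg proc) X ->
     [/\ bounded_op X, commute (line resid) X & commute P X].
Proof.
have [|P [P' [bP PP' Pr P'r [Pf P'f]]]] :=
    basis_map (h := support_map K) (h' := support_map K).
  by move=> u v; rewrite /support_map; split; case: ifP => // h [<-]; rewrite h.
have eP : P' = P.
  apply: op_ext => //; [exact: adjoint_bounded PP'|by rewrite Pr P'r|].
  by move=> u; rewrite Pf P'f.
subst P'; exists P; first by split=> //; rewrite vac_fvec Pf.
have cproc j a : j \in K -> commute P (proc j a).
  move=> jK; apply: (commute_basis (h := support_map K) (c := 0)) => //.
  - by rewrite scale0r.
  - move=> u; rewrite /support_map; case e : (pop j u) => [w|] /=.
      by rewrite ((popP j w u).1 e) /= jK /=; case: ifP => //=; rewrite e.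
    by case: ifP => //=; rewrite e.
  - move=> u; rewrite /support_map; case e : (push j u) => [w|] /=.
      by rewrite ((pushP j u w).1 e) /= jK /=; case: ifP => //=; rewrite e.
    by case: ifP => //=; rewrite e.
have dP a b c : commute P (diag a b c).
  have bD := bounded_diag a b c.
  apply: op_ext; [exact: bounded_comp|exact: bounded_comp| |].
    by rewrite /= diag_resid (linmapZ _ _ bP.1) Pr scaler0 linmap0 //; exact: bD.1.
  move=> u; rewrite /= diag_fvec (linmapZ _ _ bP.1).
  have [->|->] : P (fvec u) = fvec u \/ P (fvec u) = 0.
    by rewrite Pf /support_map; case: ifP; [left|right].
    by rewrite diag_fvec.
  by rewrite scaler0 (linmap0 bD.1).
have dr a b c : commute (line resid) (diag a b c).
  have bD := bounded_diag a b c.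
  have bl := bounded_line resid.
  apply: op_ext; [exact: bounded_comp|exact: bounded_comp| |].
    by rewrite /= line_eig diag_resid (linmapZ _ _ bl.1) line_eig.
  move=> u; rewrite /= diag_fvec (linmapZ _ _ bl.1).
  by rewrite resid_line_fvec scaler0 linmap0 //; exact: bD.1.
move=> X vX.
have [bX cX _] : [/\ bounded_op X, commute (line resid) X & commute (line resid) X].
  apply: vN_gen_commute vX; [exact: bounded_line|exact: adjoint_line|].
  move=> S [/local_bounded[bS cS]|/tail_diag[a [b [c ->]]]]; split=> //.
  exact: bounded_diag.
split=> //.
have [_ //] : [/\ bounded_op X, commute P X & commute P X].
apply: vN_gen_commute vX => // S [lS|/tail_diag[a [b [c ->]]]].
  apply: (local_commute bP PP' _ lS) => j a jK.
  by split; exact: cproc.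
by split=> //; exact: bounded_diag.
Qed.

(** [Y vac] lies in the closed span of the [fvec u] with [u] contained in [K] and
    [X^* vac] in the one with [u] contained in [I]; for disjoint [I] and [K] these
    subspaces meet only in the line of [vac]. *)
Lemma tail_exp_independent (I K : {fset int}) : [disjoint I & K]%fset ->
  forall X Y : H -> H, vN_gen (local_alg proc [set` I] `|` tail_alg proc) X ->
              vN_gen (local_alg proc [set` K] `|` tail_alg proc) Y ->
  ip H ((X \o Y) xi) xi = ip H ((tail_exp X \o tail_exp Y) xi) xi.
Proof.
move=> IK X Y vX vY.
have [P [bP PP Pv Pr Pf] hP] := support_projection I.
have [Q [bQ QQ Qv Qr Qf] hQ] := support_projection K.
have [[bX rX PX] [bY rY QY]] := (hP _ vX, hQ _ vY).
have PQ : P \o Q = line vac.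
  apply: op_ext; [exact: bounded_comp|exact: bounded_line| |].
    by rewrite /= Qr (linmap0 bP.1) vac_line_resid.
  move=> u; rewrite /= vac_line_fvec Qf /support_map.
  case: ifP => [uK|uK] /=.
    rewrite Pf /support_map; have [->|[k [v eu]]] := mono_index_cases u; first by [].
    have kI : k \notin I.
      move: uK; rewrite eu /= => /andP[kK _].
      by apply/negP => kI; move/fdisjointP: IK => /(_ _ kI); rewrite kK.
    by rewrite eu /= (negPf kI) /= -val_eqE /= eu.
  rewrite linmap0; last exact: bP.1.
  by case: eqP => // e; rewrite e in uK.
have PYv : P (Y vac) = vstate vac Y *: vac.
  rewrite -[in LHS]Qv -(commuteE _ QY).
  by rewrite -[LHS]/((P \o Q) (Y vac)) PQ.
have Yr : Y resid = vstate resid Y *: resid.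
  by rewrite -[in LHS](line_eig resid) -(commuteE _ rY).
rewrite vector_state_split; [|exact: bounded_comp|]; last first.
  by apply/funext => x; rewrite /= (commuteE _ rX) (commuteE _ rY).
rewrite diag_xi /=.
have -> : ip H (X (Y vac)) vac = vstate vac Y * ip H (X vac) vac.
  transitivity (ip H (P (X (Y vac))) vac); first by rewrite PP Pv.
  rewrite (commuteE _ PX) PYv.
  by rewrite (linmapZ _ _ bX.1) ipZl.
rewrite Yr (linmapZ _ _ bX.1) ipZl -!(vstateK _ bX.1); ring.
Qed.

Lemma level_cond_iid : cond_iid proc xi.
Proof.
exists tail_exp; split.
- exact: tail_exp_cond_exp.
- exact: tail_exp_state.
- exact: tail_exp_independent.
- exact: tail_exp_identical.
Qed.

End Expectation.

End LevelStates.


Theorem theorem3p9 (R : realType) (phi : (fock R -> fock R) -> R[i]%C)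
    (hphi : is_state (monotone_alg R) phi)
    (H : hilbert R) (pi : (fock R -> fock R) -> (H -> H)) (xi : H)
    (hGNS : is_GNS (monotone_alg R) phi pi xi) :
  symmetric_state phi <-> cond_iid (state_process pi) xi.
Proof.
split=> [/symmetric_level lev|[E [_ Exi _ Eid]]].
  have [Lim [Lim_lin Lim_ge0 Lim_const]] := @generalized_limit R.
  exact: (level_cond_iid hphi hGNS lev Lim_lin Lim_ge0 Lim_const).
apply: (level_symmetric hphi hGNS) => i j.
have phiE k : phi (above k) = ip H (E (state_process pi k (delta_mx 0 0, 0)) xi) xi.
  rewrite Exi; last by apply: vN_gen_sub; exists k => //; exists (delta_mx 0 0, 0).
  by rewrite (process_above hGNS) (GNS_state hGNS) //; exact: M_above.
by rewrite !phiE (Eid i j).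
Qed.
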